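(* For every $p$ with $1\le p\le 2$, there is no embedding relation between the amalgam space $(L^2,\ell^1)(\mathbb{R}^n)$ and the Besov space $B^0_{p,1}(\mathbb{R}^n)$; that is, neither the embedding $(L^2,\ell^1)(\mathbb{R}^n)\hookrightarrow B^0_{p,1}(\mathbb{R}^n)$ nor the embedding $B^0_{p,1}(\mathbb{R}^n)\hookrightarrow(L^2,\ell^1)(\mathbb{R}^n)$ holds.
   Context: Let $n\ge1$ and $\mathbb{N}_0=\{0,1,2,\dots\}$. $X\hookrightarrow Y$ denotes continuous embedding: $X\subset Y$ (as subspaces of the tempered distributions $\mathcal{S}'(\mathbb{R}^n)$) and there is $C>0$ with $\|f\|_Y\le C\|f\|_X$ for all $f\in X$. Amalgam space: $(L^2,\ell^1)(\mathbb{R}^n)$ consists of all measurable functions $f$ on $\mathbb{R}^n$ with $\|f\|_{(L^2,\ell^1)}=\sum_{\nu\in\mathbb{Z}^n}\big(\int_{\nu+[-1/2,1/2]^n}|f(x)|^2\,dx\big)^{1/2}<\infty$. Besov space: with $\widehat f(\xi)=\int_{\mathbb{R}^n}e^{-ix\cdot\xi}f(x)\,dx$ and inverse Fourier transform $\mathcal{F}^{-1}$, let $\{\psi_\ell\}_{\ell\ge0}$ be Schwartz functions on $\mathbb{R}^n$ with $\mathrm{supp}\,\psi_0\subset\{|\xi|\le2\}$; $\mathrm{supp}\,\psi_\ell\subset\{2^{\ell-1}\le|\xi|\le2^{\ell+1}\}$ for $\ell\ge1$; $|\partial^\alpha\psi_\ell(\xi)|\le C_\alpha2^{-\ell|\alpha|}$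 for all $\ell\ge0$, $\alpha\in\mathbb{N}_0^n$, $\xi\in\mathbb{R}^n$; and $\sum_{\ell\ge0}\psi_\ell(\xi)=1$ for all $\xi$. Put $\psi_\ell(D)f=\mathcal{F}^{-1}[\psi_\ell\widehat f]$. Then $B^0_{p,1}(\mathbb{R}^n)$ consists of all $f\in\mathcal{S}'(\mathbb{R}^n)$ with $\|f\|_{B^0_{p,1}}=\sum_{\ell\ge0}\|\psi_\ell(D)f\|_{L^p}<\infty$; different choices of $\{\psi_\ell\}$ give equivalent norms. *)

(* Defs.v *)
From HB Require Import structures.
From mathcomp Require Import all_boot all_order all_algebra.
From mathcomp Require Import complex.
From mathcomp Require Import all_classical all_reals all_analysis.

Set Implicit Arguments.
Unset Strict Implicit.
Unset Printing Implicit Defensive.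

Import Order.TTheory GRing.Theory Num.Theory.
Import numFieldNormedType.Exports.

Local Open Scope classical_set_scope.
Local Open Scope ring_scope.
Local Open Scope complex_scope.

(* The product sigma-algebra on row vectors, generated by the coordinates;
   for [T] a [realType] these are the Borel sets of R^n. *)
Section measurable_rV.
Context {d} {T : sigmaRingType d} (n : nat).

Let coord : 'I_n -> 'rV[T]_n -> T := fun i x => x ord0 i.

Let rV_set0 : g_sigma_preimage coord set0.
Proof. exact: sigma_algebra0. Qed.

Let rV_setC A : g_sigma_preimage coord A -> g_sigma_preimage coord (~` A).
Proof. exact: sigma_algebraC. Qed.

Let rV_bigcup (F : _^nat) : (forall i, g_sigma_preimage coord (F i)) ->
  g_sigma_preimage coord (\bigcup_i (F i)).
Proof. exact: sigma_algebra_bigcup. Qed.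

HB.instance Definition _ := @isMeasurable.Build (measure_tuple_display d)
  'rV[T]_n (g_sigma_preimage coord) rV_set0 rV_setC rV_bigcup.

End measurable_rV.

Lemma measurable_rV_coord d (T : sigmaRingType d) n (i : 'I_n) :
  measurable_fun [set: 'rV[T]_n] (fun x : 'rV[T]_n => x ord0 i).
Proof.
move=> _ Y mY; rewrite setTI; apply: sub_sigma_algebra => /=.
rewrite -bigcup_seq/=; exists i => /=; first by rewrite mem_index_enum.
by exists Y => //; rewrite setTI.
Qed.

Lemma measurable_fun_rVP d1 d2 (T1 : measurableType d1)
    (T2 : measurableType d2) n (f : T1 -> 'rV[T2]_n) :
  measurable_fun [set: T1] f <->
  forall i, measurable_fun [set: T1] (fun x => f x ord0 i).
Proof.
split=> [mf i|mf].
  exact: (@measurableT_comp _ _ _ _ _ _ (fun x : 'rV[T2]_n => x ord0 i) _ _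
    (measurable_rV_coord i) mf).
move=> _ A mA; rewrite setTI.
pose G := [set B : set 'rV[T2]_n | measurable (f @^-1` B)].
suff : (@measurable _ 'rV[T2]_n) `<=` G by exact.
apply: smallest_sub => [|B].
  split=> [|B|F] /=; rewrite /G /=.
  - by rewrite preimage_set0.
  - by rewrite setTD preimage_setC; exact: measurableC.
  - by move=> mF; rewrite preimage_bigcup; exact: bigcupT_measurable.
rewrite -bigcup_seq => -[i _ [C mC <-]].
rewrite /G/= setTI; have := mf i measurableT _ mC.
by rewrite setTI.
Qed.

Section lebesgue_measure_rV.
Variable R : realType.

Definition rV_cons n (x : measurableTypeR R * 'rV[R]_n) : 'rV[R]_n.+1 :=
  \row_i oapp (x.2 ord0) x.1 (unlift ord0 i).

Definition rV_uncons n (x : 'rV[R]_n.+1) : measurableTypeR R * 'rV[R]_n :=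
  (x ord0 ord0, \row_i x ord0 (lift ord0 i)).

Lemma rV_consK n : cancel (@rV_cons n) (@rV_uncons n).
Proof.
case=> a v; rewrite /rV_uncons !mxE unlift_none/=; congr pair.
by apply/rowP => i; rewrite !mxE liftK.
Qed.

Lemma rV_unconsK n : cancel (@rV_uncons n) (@rV_cons n).
Proof.
move=> x; apply/rowP => i; rewrite !mxE.
by case: unliftP => [j|] -> /=; rewrite ?mxE.
Qed.

Lemma measurable_rV_cons n : measurable_fun setT (@rV_cons n).
Proof.
apply/measurable_fun_rVP => i; rewrite /rV_cons.
case: (unliftP ord0 i) => [j ij|i0].
  rewrite (_ : (fun _ => _) = (fun v : 'rV[R]_n => v ord0 j) \o snd).
    by apply: measurableT_comp; [exact: measurable_rV_coord|].
  by apply/funext => x; rewrite !mxE ij liftK.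
rewrite (_ : (fun _ => _) = fst) //.
by apply/funext => x; rewrite !mxE i0 unlift_none.
Qed.

Lemma measurable_rV_uncons n : measurable_fun setT (@rV_uncons n).
Proof.
apply/measurable_fun_pairP; split; first exact: measurable_rV_coord.
apply/measurable_fun_rVP => i; rewrite /comp/=.
rewrite (_ : (fun _ => _) = (fun x : 'rV[R]_n.+1 => x ord0 (lift ord0 i))).
  exact: measurable_rV_coord.
by apply/funext => x; rewrite mxE.
Qed.

Section lebesgue_rV_step.
Variables (n : nat) (mu : {sigma_finite_measure set 'rV[R]_n -> \bar R}).

Definition lebesgue_rV_step : set 'rV[R]_n.+1 -> \bar R :=
  pushforward (@lebesgue_measure R \x mu)%E (@rV_cons n).

Let step0 : lebesgue_rV_step set0 = 0%E.
Proof. by rewrite /lebesgue_rV_step /pushforward preimage_set0 measure0. Qed.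

Let step_ge0 A : (0 <= lebesgue_rV_step A)%E.
Proof.
exact: (measure_ge0 (@lebesgue_measure R \x mu)%E).
Qed.

Let step_sigma_additive : semi_sigma_additive lebesgue_rV_step.
Proof.
move=> F mF tF mUF; rewrite /lebesgue_rV_step /pushforward preimage_bigcup.
have mcons A : measurable A -> measurable (@rV_cons n @^-1` A).
  by move=> mA; rewrite -[X in measurable X]setTI; exact: measurable_rV_cons.
apply: measure_semi_sigma_additive.
- by move=> k; exact: mcons.
- apply/trivIsetP => /= i j _ _ ij; rewrite -preimage_setI.
  by move/trivIsetP : tF => /(_ _ _ _ _ ij) ->//; rewrite preimage_set0.
- by rewrite -preimage_bigcup; exact: mcons.
Qed.

HB.instance Definition _ := isMeasure.Build _ _ _ lebesgue_rV_step
  step0 step_ge0 step_sigma_additive.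

Let step_sigma_finite : sigma_finite setT lebesgue_rV_step.
Proof.
have /sigma_finiteP[F [FT ndF mF]] := sigma_finiteT (@lebesgue_measure R).
have /sigma_finiteP[G [GT ndG mG]] := sigma_finiteT mu.
exists (fun i => @rV_uncons n @^-1` (F i `*` G i)).
  rewrite -preimage_bigcup; apply/seteqP; split=> // x _.
  have [i _ Fi] : (\bigcup_i F i) (rV_uncons x).1 by rewrite -FT.
  have [j _ Gj] : (\bigcup_i G i) (rV_uncons x).2 by rewrite -GT.
  exists (maxn i j) => //; split.
    by move: (Fi); apply/subsetPset/ndF/leq_maxl.
  by move: (Gj); apply/subsetPset/ndG/leq_maxr.
move=> i; have [[mFi Fi] [mGi Gi]] := (mF i, mG i); split.
  by rewrite -[X in measurable X]setTI; apply: measurable_rV_uncons => //;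
    exact: measurableX.
rewrite /lebesgue_rV_step /pushforward -comp_preimage.
rewrite (_ : _ \o _ = id) ?preimage_id; last first.
  by apply/funext => x /=; rewrite rV_consK.
by rewrite product_measure1E// lte_mul_pinfty// ge0_fin_numE.
Qed.

HB.instance Definition _ := @Measure_isSigmaFinite.Build _ _ _ lebesgue_rV_step
  step_sigma_finite.

End lebesgue_rV_step.

(* Lebesgue measure on R^n, as the iterated product of [lebesgue_measure]. *)
Fixpoint lebesgue_rV (n : nat) : {sigma_finite_measure set 'rV[R]_n -> \bar R} :=
  match n with
  | 0 => \d_ (0 : 'rV[R]_0)
  | m.+1 => lebesgue_rV_step (lebesgue_rV m)
  end.

Lemma lebesgue_rV_box n (a b : 'rV[R]_n) :
  (forall i, a ord0 i <= b ord0 i) ->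
  lebesgue_rV n [set x | forall i, x ord0 i \in `[a ord0 i, b ord0 i]] =
  (\prod_(i < n) (b ord0 i - a ord0 i))%:E.
Proof.
elim: n a b => [|n IH] a b ab.
  rewrite big_ord0 /= diracE mem_set //=.
  by case.
rewrite big_ord_recl/= /lebesgue_rV_step /pushforward.
set a' := (rV_uncons a).2; set b' := (rV_uncons b).2.
set B := (X in (_ \x _)%E X).
have -> : B = `[a ord0 ord0, b ord0 ord0]%classic `*`
    [set x : 'rV[R]_n | forall i, x ord0 i \in `[a' ord0 i, b' ord0 i]].
  apply/seteqP; split=> [[t v]|[t v]] /=.
    move=> H; split; first by have := H ord0; rewrite mxE unlift_none.
    by move=> i; have := H (lift ord0 i); rewrite !mxE liftK.
  move=> [H1 H2] i; rewrite mxE.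
  by case: unliftP => [j|] -> //=; have := H2 j; rewrite !mxE.
rewrite product_measure1E/=.
- rewrite lebesgue_measure_itv/= IH; last by move=> i; rewrite !mxE.
  rewrite EFinM; congr (_ * (_)%:E)%E; last first.
    by apply: eq_bigr => i _; rewrite !mxE.
  rewrite lte_fin lt_neqAle ab andbT EFinB.
  by case: eqP => [->|]//=; rewrite subee.
- exact: measurable_itv.
- rewrite (_ : [set _ | _] = \bigcap_(i in [set: 'I_n])
     ((fun x : 'rV[R]_n => x ord0 i) @^-1` `[a' ord0 i, b' ord0 i]%classic)).
    apply: fin_bigcap_measurable => // i _.
    by rewrite -[X in measurable X]setTI; apply: measurable_rV_coord.
  by apply/seteqP; split=> x /= h; [move=> i _; exact: h|move=> i; exact: h].
Qed.

End lebesgue_measure_rV.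

Section complex_functions.
Variables (R : realType) (n : nat).
Local Notation V := 'rV[R]_n.
Local Notation C := R[i].
Local Notation cabs := (@complex.ComplexField.Normc.normc R).
Implicit Types (f g phi : V -> C) (x xi : V) (alpha beta : 'I_n -> nat).

(* Borel measurability; every Lebesgue measurable function agrees almost
   everywhere with a Borel one, and functions are only used up to a.e. equality. *)
Definition cmeasurable f :=
  measurable_fun [set: V] (fun x => complex.Re (f x)) /\
  measurable_fun [set: V] (fun x => complex.Im (f x)).

Definition cintegral f : C :=
  \int[lebesgue_rV R n]_x complex.Re (f x) +i*
  \int[lebesgue_rV R n]_x complex.Im (f x).

Definition dotp x xi : R := \sum_(i < n) x ord0 i * xi ord0 i.

(* The Euclidean norm; the library norm on ['rV[R]_n] is the maximum norm. *)
Definition euclid x : R := Num.sqrt (dotp x x).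

(* [cexpi t] is e^{it}. *)
Definition cexpi (t : R) : C := cos t +i* sin t.

Definition cpartial (i : 'I_n) f x : C :=
  'D_(delta_mx ord0 i) (fun y => complex.Re (f y)) x +i*
  'D_(delta_mx ord0 i) (fun y => complex.Im (f y)) x.

Definition cpartials (s : seq 'I_n) f : V -> C := foldr cpartial f s.

Definition csmooth f := forall (s : seq 'I_n) x,
  differentiable (fun y => complex.Re (cpartials s f y)) x /\
  differentiable (fun y => complex.Im (cpartials s f y)) x.

(* [mlen], [mderiv], [mpow]: |alpha|, d^alpha and x^alpha for a multi-index. *)
Definition mlen alpha : nat := \sum_(i < n) alpha i.

Definition mderiv alpha f : V -> C :=
  cpartials (flatten [seq nseq (alpha i) i | i <- enum 'I_n]) f.

Definition mpow x alpha : R := \prod_(i < n) x ord0 i ^+ alpha i.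

Definition schwartz_norm (N : nat) phi : \bar R :=
  ereal_sup [set y | exists alpha beta x, [/\ (mlen alpha <= N)%N,
    (mlen beta <= N)%N & y = (cabs ((mpow x beta)%:C * mderiv alpha phi x))%:E]].

Definition schwartz phi :=
  csmooth phi /\ forall N, (schwartz_norm N phi < +oo)%E.

Definition fourier phi : V -> C :=
  fun xi => cintegral (fun x => cexpi (- dotp x xi) * phi x).

Definition fourier_inv phi : V -> C :=
  fun x => (((2 * pi) ^- n)%:C) * cintegral (fun xi => cexpi (dotp x xi) * phi xi).

(* A tempered distribution is represented by a functional on all functions
   [V -> C], of which only the values at Schwartz functions matter: every notion
   below depends on these values only. *)
Definition functional := (V -> C) -> C.
Implicit Types (u : functional).

(* Linearity, and continuity for the Schwartz topology: domination by one of
   the increasing seminorms [schwartz_norm N]. *)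
Definition tempered u :=
  (forall (a : C) phi psi, schwartz phi -> schwartz psi ->
     u (fun x => a * phi x + psi x) = a * u phi + u psi) /\
  (exists (N : nat) (M : R), forall phi, schwartz phi ->
     ((cabs (u phi))%:E <= M%:E * schwartz_norm N phi)%E).

(* Operations on tempered distributions, by transposition. *)
Definition dist_fourier u : functional := fun phi => u (fourier phi).
Definition dist_fourier_inv u : functional := fun phi => u (fourier_inv phi).
Definition dist_mul (m : V -> C) u : functional :=
  fun phi => u (fun xi => m xi * phi xi).

Definition fourier_multiplier (m : V -> C) u : functional :=
  dist_fourier_inv (dist_mul m (dist_fourier u)).

Definition represents f u :=
  forall phi, schwartz phi -> u phi = cintegral (fun x => f x * phi x).

(* A norm [N] on functions, read on tempered distributions: the norm of a
   function of finite norm representing [u], and [+oo] if there is none.  Two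
   representatives agree almost everywhere and then have the same norm, so the
   infimum only selects the common value. *)
Definition dist_norm (N : (V -> C) -> \bar R) u : \bar R :=
  ereal_inf [set N f | f in
    [set f | [/\ cmeasurable f, (N f < +oo)%E & represents f u]]].

Definition Lp_norm (p : R) f : \bar R :=
  Lnorm (lebesgue_rV R n) p%:E (fun x => (cabs (f x))%:E).

Definition cube (nu : 'rV[int]_n) : set V :=
  [set x | forall i, `|x ord0 i - (nu ord0 i)%:~R| <= 2^-1].

Definition amalgam_norm f : \bar R :=
  (\esum_(nu in [set: 'rV[int]_n])
     (\int[lebesgue_rV R n]_(x in cube nu) (cabs (f x) ^+ 2)%:E) `^ 2^-1)%E.

Definition dyadic_partition (psi : nat -> V -> C) :=
  [/\ forall l, schwartz (psi l),
      closure [set xi | psi 0%N xi != 0] `<=` [set xi | euclid xi <= 2],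
      forall l, (1 <= l)%N -> closure [set xi | psi l xi != 0] `<=`
        [set xi | 2 ^+ l.-1 <= euclid xi <= 2 ^+ l.+1],
      forall alpha, exists Ca : R, forall l xi,
        cabs (mderiv alpha (psi l) xi) <= Ca * 2 ^- (l * mlen alpha) &
      forall xi,
        (fun N => cabs (\sum_(0 <= l < N) psi l xi - 1)) @ \oo --> (0 : R)].

(* The spaces are encoded by their norms on S', with value [+oo] outside. *)
Definition amalgam_L2l1 u : \bar R := dist_norm amalgam_norm u.

Definition besov_0p1 (psi : nat -> V -> C) (p : R) u : \bar R :=
  (\sum_(0 <= l <oo) dist_norm (Lp_norm p) (fourier_multiplier (psi l) u))%E.

Definition space (N : functional -> \bar R) : set functional :=
  [set u | tempered u /\ (N u < +oo)%E].

Definition embeds (NX NY : functional -> \bar R) :=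
  space NX `<=` space NY /\
  exists2 M : R, 0 < M & forall u, space NX u -> (NY u <= M%:E * NX u)%E.

End complex_functions.

(* Main.v *)
Require Import Defs.
From HB Require Import structures.
From mathcomp Require Import all_boot all_order all_algebra.
From mathcomp Require Import complex.
From mathcomp Require Import all_classical all_reals all_analysis.
From mathcomp Require Import measurable_realfun.
From mathcomp Require Import ring lra.

(** All functions are tested by duality against modulated Gaussians.

    The amalgam space is not contained in the Besov space.  On the open unit
    cube Q centred at the origin consider a sum of N = K^2 exponentials
    exp(i a_m x_0) with the frequencies a_m = 2 pi 16^m.  They are orthonormal
    on Q, so that the amalgam norm of this function is its L^2 norm, which is K
    ([lac_amalgam]).  The frequencies lie so far apart that each has four dyadic
    blocks of its own; these blocks, tested against the product of a Gaussian
    with the conjugate exponential, catch a fixed amount, independent of m, up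
    to an error of size O(2^-m) times the L^1 norm ([lac_tail], [lac_test]).
    The Besov norm is therefore at least c K^2 - C K ([not_amalgam_sub_besov]).
    Testing does not see p, because a Gaussian lies in the dual of every L^p
    ([dist_norm_test]).

    The Besov space is not contained in the amalgam space.  Let f be a Gaussian
    of integral 1 and width 1/s whose spectrum is cut off at |xi| = 2^(k+1) by
    a partial sum of the partition of unity ([bump]).  Only the blocks of index
    less than k + 3 are nonzero, and interpolation between L^1 and the sup norm
    bounds the Besov norm of f by C (k+3)^2 s^(n (1 - 1/p)) ([besov_bump]).  The
    pairing of f with exp(- s^2 |x|^2 / 2) stays away from 0 as long as s is
    small compared with 2^k ([bump_test]), whereas that Gaussian, as a
    functional on the amalgam space, has a norm of size at most
    C min (1, s^(-n/2)), by the Cauchy-Schwarz inequality on each cube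
    ([amalgam_test]).  If p = 1, let s tend to infinity with k comparable to
    log s: a power of s beats a power of k.  If p > 1, take k = 0 and let s tend
    to 0 ([embedding_bump]).

    On the way, dyadic blocks are controlled by the bound [psi_kernel] on their
    convolution kernels, which integration by parts gives.  General Fourier
    inversion is avoided: explicit transforms of Gaussians and Fubini's theorem
    take its place ([fourierK_gauss_wave], [fourier_swap]), and where the
    vanishing of a spectrum matters it is proved with a Gaussian cut-off
    ([fourier_fourier_inv_eq0]). *)

Set Implicit Arguments.
Unset Strict Implicit.
Unset Printing Implicit Defensive.

Import Order.TTheory GRing.Theory Num.Theory.
Import numFieldNormedType.Exports.

Local Open Scope classical_set_scope.
Local Open Scope ring_scope.
Local Open Scope complex_scope.

Notation cabs := (@complex.ComplexField.Normc.normc _).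
Notation lebR R :=
  (@lebesgue_measure R : {sigma_finite_measure set (measurableTypeR R) -> \bar R}).

(** * The modulus on complex numbers *)

Section cabs.
Variable R : realType.
Local Notation C := R[i].
Implicit Types z w : C.

Lemma ReM z w : complex.Re (z * w) =
  complex.Re z * complex.Re w - complex.Im z * complex.Im w.
Proof. by case: z w => [a b] [c d]. Qed.

Lemma ImM z w : complex.Im (z * w) =
  complex.Re z * complex.Im w + complex.Im z * complex.Re w.
Proof. by case: z w => [a b] [c d]. Qed.

Lemma ReD z w : complex.Re (z + w) = complex.Re z + complex.Re w.
Proof. by case: z w => [a b] [c d]. Qed.

Lemma ImD z w : complex.Im (z + w) = complex.Im z + complex.Im w.
Proof. by case: z w => [a b] [c d]. Qed.

Lemma ReN z : complex.Re (- z) = - complex.Re z.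
Proof. by case: z. Qed.

Lemma ImN z : complex.Im (- z) = - complex.Im z.
Proof. by case: z. Qed.

Lemma complex_eqP z w :
  complex.Re z = complex.Re w -> complex.Im z = complex.Im w -> z = w.
Proof. by case: z w => [a b] [c d] /= -> ->. Qed.

Lemma cabsE z : cabs z = Num.sqrt (complex.Re z ^+ 2 + complex.Im z ^+ 2).
Proof. by case: z. Qed.

Lemma cabs_ge0 z : 0 <= cabs z.
Proof. by rewrite cabsE sqrtr_ge0. Qed.

Lemma cabs_sqr z : cabs z ^+ 2 = complex.Re z ^+ 2 + complex.Im z ^+ 2.
Proof. by rewrite cabsE sqr_sqrtr// addr_ge0// sqr_ge0. Qed.

Lemma cabs0 : cabs (0 : C) = 0.
Proof. exact: complex.ComplexField.Normc.normc0. Qed.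

Lemma cabs1 : cabs (1 : C) = 1.
Proof. exact: complex.ComplexField.Normc.normc1. Qed.

Lemma cabsM z w : cabs (z * w) = cabs z * cabs w.
Proof. exact: complex.ComplexField.Normc.normcM. Qed.

Lemma cabsD z w : cabs (z + w) <= cabs z + cabs w.
Proof. exact: le_normcD. Qed.

Lemma cabsN z : cabs (- z) = cabs z.
Proof. exact: normcN. Qed.

Lemma cabsB z w : cabs (z - w) <= cabs z + cabs w.
Proof. by rewrite -(cabsN w); exact: cabsD. Qed.

Lemma cabs_real (x : R) : cabs x%:C = `|x|.
Proof. by rewrite cabsE/= expr0n/= addr0 sqrtr_sqr. Qed.

Lemma cabs_sum (I : Type) (r : seq I) (P : pred I) (F : I -> C) :
  cabs (\sum_(i <- r | P i) F i) <= \sum_(i <- r | P i) cabs (F i).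
Proof.
elim/big_rec2: _ => [|i x y _ h]; first by rewrite cabs0.
by rewrite (le_trans (cabsD _ _))// lerD2l.
Qed.

Lemma cabs_prod (I : Type) (r : seq I) (P : pred I) (F : I -> C) :
  cabs (\prod_(i <- r | P i) F i) = \prod_(i <- r | P i) cabs (F i).
Proof. by elim/big_rec2: _ => [|i x y _ <-]; rewrite ?cabs1 ?cabsM. Qed.

Lemma ge_Re_cabs z : `|complex.Re z| <= cabs z.
Proof. by rewrite cabsE -sqrtr_sqr ler_sqrt ?addr_ge0 ?sqr_ge0// lerDl sqr_ge0. Qed.

Lemma ge_Im_cabs z : `|complex.Im z| <= cabs z.
Proof. by rewrite cabsE -sqrtr_sqr ler_sqrt ?addr_ge0 ?sqr_ge0// lerDr sqr_ge0. Qed.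

Lemma cabs_le_ReIm z : cabs z <= `|complex.Re z| + `|complex.Im z|.
Proof.
have a0 := normr_ge0 (complex.Re z); have b0 := normr_ge0 (complex.Im z).
rewrite -(ler_pXn2r (n := 2)) ?nnegrE ?cabs_ge0 ?addr_ge0//.
rewrite cabs_sqr sqrrD !real_normK ?num_real//.
have := mulr_ge0 a0 b0; lra.
Qed.

Lemma cabs_cexpi (t : R) : cabs (cexpi t) = 1.
Proof. by rewrite cabsE/= cos2Dsin2 sqrtr1. Qed.

Lemma cexpiD (s t : R) : cexpi (s + t) = cexpi s * cexpi t.
Proof. by apply: complex_eqP; rewrite ?ReM ?ImM/= ?cosD ?sinD; ring. Qed.

Lemma cexpi0 : cexpi 0 = 1 :> C.
Proof. by rewrite /cexpi cos0 sin0. Qed.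

Lemma cexpi_sum (I : Type) (r : seq I) (P : pred I) (F : I -> R) :
  cexpi (\sum_(i <- r | P i) F i) = \prod_(i <- r | P i) cexpi (F i).
Proof. by elim/big_rec2: _ => [|i x y _ <-]; rewrite ?cexpi0 ?cexpiD. Qed.

Lemma RCM (x y : R) : (x * y)%:C = x%:C * y%:C :> C.
Proof. by rewrite rmorphM. Qed.

Lemma RC_prod (I : Type) (r : seq I) (P : pred I) (F : I -> R) :
  (\prod_(i <- r | P i) F i)%:C = \prod_(i <- r | P i) (F i)%:C :> C.
Proof. exact: rmorph_prod. Qed.

End cabs.

(** * Integrals of complex functions on a measure space *)

Section complex_integral.
Context d (T : measurableType d) (R : realType).
Local Notation C := R[i].
Implicit Types (f g : T -> C).

(** [cmeasurable] over an arbitrary measurable space; likewise [cint] below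
    extends [cintegral] to an arbitrary measure. *)
Definition cmeas f := measurable_fun [set: T] (fun x => complex.Re (f x)) /\
  measurable_fun [set: T] (fun x => complex.Im (f x)).

Lemma cmeasM f g : cmeas f -> cmeas g -> cmeas (fun x => f x * g x).
Proof.
move=> [f1 f2] [g1 g2]; split.
  under eq_fun do rewrite ReM.
  by apply: measurable_funB; exact: measurable_funM.
under eq_fun do rewrite ImM.
by apply: measurable_funD; exact: measurable_funM.
Qed.

Lemma cmeasD f g : cmeas f -> cmeas g -> cmeas (fun x => f x + g x).
Proof.
move=> [f1 f2] [g1 g2]; split.
  by under eq_fun do rewrite ReD; exact: measurable_funD.
by under eq_fun do rewrite ImD; exact: measurable_funD.
Qed.

Lemma cmeas_cst (c : C) : cmeas (fun=> c).
Proof. by split; exact: measurable_cst. Qed.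

Lemma cmeas_sum (I : Type) (r : seq I) (F : I -> T -> C) :
  (forall i, cmeas (F i)) -> cmeas (fun x => \sum_(i <- r) F i x).
Proof.
move=> mF; elim: r => [|i r IH].
  by under eq_fun do rewrite big_nil; exact: cmeas_cst.
by under eq_fun do rewrite big_cons; exact: cmeasD.
Qed.

Lemma cmeas_prod (I : Type) (r : seq I) (F : I -> T -> C) :
  (forall i, cmeas (F i)) -> cmeas (fun x => \prod_(i <- r) F i x).
Proof.
move=> mF; elim: r => [|i r IH].
  by under eq_fun do rewrite big_nil; exact: cmeas_cst.
by under eq_fun do rewrite big_cons; exact: cmeasM.
Qed.

Lemma cmeas_real (h : T -> R) : measurable_fun setT h -> cmeas (fun x => (h x)%:C).
Proof. by move=> mh; split => //=; exact: measurable_cst. Qed.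

Lemma cmeas_cexpi (h : T -> R) : measurable_fun setT h -> cmeas (fun x => cexpi (h x)).
Proof.
move=> mh; split => /=.
  apply: (@measurableT_comp _ _ _ _ _ _ (@cos R)) => //.
  by apply: continuous_measurable_fun; exact: continuous_cos.
apply: (@measurableT_comp _ _ _ _ _ _ (@sin R)) => //.
by apply: continuous_measurable_fun; exact: continuous_sin.
Qed.

Lemma measurable_cabs f : cmeas f -> measurable_fun setT (fun x => cabs (f x)).
Proof.
move=> [mr mi]; under eq_fun do rewrite cabsE.
apply: (@measurableT_comp _ _ _ _ _ _ (@Num.sqrt R)).
  by apply: continuous_measurable_fun; exact: sqrt_continuous.
by apply: measurable_funD; exact: measurable_funX.
Qed.

Lemma cmeas_comp d' (T' : measurableType d') (h : T' -> T) f :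
  measurable_fun setT h -> cmeas f ->
  measurable_fun setT (fun x => complex.Re (f (h x))) /\
  measurable_fun setT (fun x => complex.Im (f (h x))).
Proof.
move=> mh [fr fi].
split; first exact: (@measurableT_comp _ _ _ _ _ _ (fun x => complex.Re (f x))).
exact: (@measurableT_comp _ _ _ _ _ _ (fun x => complex.Im (f x))).
Qed.

Variable mu : {measure set T -> \bar R}.

Definition cint f : C :=
  (\int[mu]_x complex.Re (f x)) +i* (\int[mu]_x complex.Im (f x)).

Definition cintg f := mu.-integrable setT (fun x => (complex.Re (f x))%:E) /\
  mu.-integrable setT (fun x => (complex.Im (f x))%:E).

Lemma integrableZ (c : R) (h : T -> R) : mu.-integrable setT (fun x => (h x)%:E) ->
  mu.-integrable setT (fun x => (c * h x)%:E).
Proof. by move=> ih; have := integrableZl measurableT c ih; apply: eq_integrable. Qed.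

Lemma measurable_cabsE f : cmeas f -> measurable_fun setT (fun x => (cabs (f x))%:E).
Proof. by move=> mf; apply/measurable_EFinP; exact: measurable_cabs. Qed.

Lemma cintg_cmeas f : cintg f -> cmeas f.
Proof.
by move=> [/integrableP[/measurable_EFinP f1 _] /integrableP[/measurable_EFinP f2 _]].
Qed.

Lemma cintg_le f (g : T -> R) : cmeas f -> mu.-integrable setT (EFin \o g) ->
  (forall x, cabs (f x) <= g x) -> cintg f.
Proof.
move=> [mr mi] ig fg; split; apply: (le_integrable _ _ _ ig) => //.
- exact/measurable_EFinP.
- move=> x _ /=; rewrite lee_fin (le_trans (ge_Re_cabs _))//.
  by rewrite (le_trans (fg x))// ler_norm.
- exact/measurable_EFinP.
- move=> x _ /=; rewrite lee_fin (le_trans (ge_Im_cabs _))//.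
  by rewrite (le_trans (fg x))// ler_norm.
Qed.

Lemma cintg_cabs f : cintg f -> mu.-integrable setT (fun x => (cabs (f x))%:E).
Proof.
move=> fi; have [fr fim] := fi.
have := integrableD measurableT (integrable_norm fr) (integrable_norm fim).
apply: le_integrable => //.
  exact/measurable_EFinP/measurable_cabs/cintg_cmeas.
move=> x _ /=; rewrite lee_fin ger0_norm ?cabs_ge0// ger0_norm ?addr_ge0//.
exact: cabs_le_ReIm.
Qed.

Lemma cintg_finite f : cmeas f ->
  (\int[mu]_x (cabs (f x))%:E < +oo)%E -> cintg f.
Proof.
move=> mf fi; apply: (@cintg_le _ (fun x => cabs (f x))) => //.
apply/integrableP; split; first exact/measurable_EFinP/measurable_cabs.
by under eq_integral do rewrite /= ger0_norm ?cabs_ge0//.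
Qed.

(** The factor 2 comes from bounding the real and the imaginary part
    separately. *)
Lemma cint_le f :
  cmeas f -> ((cabs (cint f))%:E <= 2%:E * \int[mu]_x (cabs (f x))%:E)%E.
Proof.
move=> mf.
have aux (h : T -> R) : measurable_fun setT h -> (forall x, `|h x| <= cabs (f x)) ->
    (`|\int[mu]_x h x|%:E <= \int[mu]_x (cabs (f x))%:E)%E.
  move=> mh hf; apply: (@le_trans _ _ (`|\int[mu]_x (h x)%:E|)%E).
    by rewrite /Rintegral; case: (\int[mu]_x (h x)%:E)%E => //=; rewrite normr0 leey.
  apply: le_trans (le_abse_integral mu measurableT _) _; first exact/measurable_EFinP.
  apply: ge0_le_integral => //=.
  - exact/measurable_EFinP/measurableT_comp.
  - exact/measurable_EFinP/measurable_cabs.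
  - by move=> x _; rewrite lee_fin.
have h1 := aux _ mf.1 (fun x => ge_Re_cabs (f x)).
have h2 := aux _ mf.2 (fun x => ge_Im_cabs (f x)).
apply: (@le_trans _ _ (`|complex.Re (cint f)|%:E + `|complex.Im (cint f)|%:E)%E).
  by rewrite -EFinD lee_fin cabs_le_ReIm.
have i0 : (0 <= \int[mu]_x (cabs (f x))%:E)%E.
  by apply: integral_ge0 => x _; rewrite lee_fin cabs_ge0.
rewrite (_ : 2%:E = 1 + 1)%E; last by rewrite -EFinD; congr EFin; ring.
by rewrite ge0_muleDl// mul1e; exact: leeD.
Qed.

Lemma cint_le_dom f (g : T -> R) : cmeas f -> mu.-integrable setT (EFin \o g) ->
  (forall x, cabs (f x) <= g x) -> cabs (cint f) <= 2 * \int[mu]_x g x.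
Proof.
move=> mf ig fg; rewrite -lee_fin; apply: le_trans (cint_le mf) _.
rewrite EFinM /Rintegral fineK ?integrable_fin_num//.
rewrite lee_pmul2l//; apply: ge0_le_integral => //=.
- by move=> x _; rewrite lee_fin cabs_ge0.
- exact/measurable_EFinP/measurable_cabs.
- by case/integrableP : ig.
- by move=> x _; rewrite lee_fin.
Qed.

Lemma cintgD f g : cintg f -> cintg g -> cintg (fun x => f x + g x).
Proof.
move=> [f1 f2] [g1 g2]; split.
  by under eq_fun do rewrite ReD EFinD; exact: integrableD.
by under eq_fun do rewrite ImD EFinD; exact: integrableD.
Qed.

Lemma cintgZ (c : C) f : cintg f -> cintg (fun x => c * f x).
Proof.
move=> [f1 f2]; split.
  under eq_fun do rewrite ReM EFinB !EFinM.
  by apply: integrableB => //; exact: integrableZl.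
under eq_fun do rewrite ImM EFinD !EFinM.
by apply: integrableD => //; exact: integrableZl.
Qed.

Lemma cintD f g : cintg f -> cintg g ->
  cint (fun x => f x + g x) = cint f + cint g.
Proof.
move=> [f1 f2] [g1 g2]; apply: complex_eqP => /=.
  by under eq_Rintegral do rewrite ReD; rewrite RintegralD.
by under eq_Rintegral do rewrite ImD; rewrite RintegralD.
Qed.

Lemma cintZ (c : C) f : cintg f -> cint (fun x => c * f x) = c * cint f.
Proof.
move=> [f1 f2]; apply: complex_eqP; rewrite ?ReM ?ImM /=.
  under eq_Rintegral do rewrite ReM.
  rewrite RintegralB ?RintegralZl//.
    exact: (integrableZl measurableT (complex.Re c) f1).
  exact: (integrableZl measurableT (complex.Im c) f2).
under eq_Rintegral do rewrite ImM.
rewrite RintegralD ?RintegralZl//.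
  exact: (integrableZl measurableT (complex.Re c) f2).
exact: (integrableZl measurableT (complex.Im c) f1).
Qed.

Lemma cintg0 : cintg (fun=> 0).
Proof. by split; exact: integrable0. Qed.

Lemma cint0 : cint (fun=> 0) = 0.
Proof. by rewrite /cint /Rintegral !integral0. Qed.

Lemma cintB f g : cintg f -> cintg g ->
  cint (fun x => f x - g x) = cint f - cint g.
Proof.
move=> fi gi; under eq_fun do rewrite -mulN1r.
by rewrite cintD//; [rewrite cintZ// mulN1r|exact: cintgZ].
Qed.

Lemma cintg_sum (I : Type) (r : seq I) (F : I -> T -> C) :
  (forall i, cintg (F i)) -> cintg (fun x => \sum_(i <- r) F i x).
Proof.
move=> mF; elim: r => [|i r IH].
  by under eq_fun do rewrite big_nil; exact: cintg0.
by under eq_fun do rewrite big_cons; exact: cintgD.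
Qed.

Lemma cint_sum (I : Type) (r : seq I) (F : I -> T -> C) :
  (forall i, cintg (F i)) ->
  cint (fun x => \sum_(i <- r) F i x) = \sum_(i <- r) cint (F i).
Proof.
move=> mF; elim: r => [|i r IH].
  by under eq_fun do rewrite big_nil; rewrite cint0 big_nil.
under eq_fun do rewrite big_cons.
by rewrite cintD//; [rewrite big_cons IH|exact: cintg_sum].
Qed.

Lemma cint_real (h : T -> R) : cint (fun x => (h x)%:C) = (\int[mu]_x h x)%:C.
Proof. by rewrite /cint/= /Rintegral integral0. Qed.

Lemma cintg_mulb (M : R) f g : cmeas g -> (forall x, cabs (g x) <= M) -> cintg f ->
  cintg (fun x => g x * f x).
Proof.
move=> mg gM fi; apply: (@cintg_le _ (fun x => M * cabs (f x))).
- by apply: cmeasM => //; exact: cintg_cmeas.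
- have := integrableZl measurableT M (cintg_cabs fi).
  by apply: eq_integrable => //= x _; rewrite EFinM.
- by move=> x; rewrite cabsM ler_wpM2r// cabs_ge0.
Qed.

Lemma cint_cvg (F : nat -> T -> C) f (g : T -> R) :
  (forall n, cmeas (F n)) -> cmeas f -> mu.-integrable setT (EFin \o g) ->
  (forall n x, cabs (F n x) <= g x) ->
  (forall x, (fun n => cabs (F n x - f x)) @ \oo --> (0 : R)) ->
  (fun n => cabs (cint (F n) - cint f)) @ \oo --> (0 : R).
Proof.
move=> mF mf ig Fg Ff.
have fg x : cabs (f x) <= g x.
  rewrite leNgt; apply/negP => gf.
  have := Ff x; rewrite -subr_gt0 in gf.
  move/cvgrPdist_lt => /(_ _ gf) [n _ /(_ n (leqnn n))].
  rewrite /= sub0r normrN ger0_norm ?cabs_ge0//.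
  apply/negP; rewrite -leNgt.
  have := cabsB (F n x) (F n x - f x); rewrite opprB addrC subrK.
  have := Fg n x; lra.
have Fi n : cintg (F n) by exact: cintg_le ig _.
have fi : cintg f by exact: cintg_le ig _.
have ig2 : mu.-integrable setT (fun x => (2 * g x)%:E).
  exact: (integrableZ _ ig).
have ml n : measurable_fun setT (fun x => cabs (F n x - f x)).
  apply: measurable_cabs; apply: cmeasD => //.
  by under eq_fun do rewrite -mulN1r; apply: cmeasM => //; exact: cmeas_cst.
have cF : {ae mu, forall x, setT x ->
    (fun n => (cabs (F n x - f x))%:E) @ \oo --> ((fun=> 0) x)%:E}.
  by apply: aeW => x _; apply/fine_cvgP; split; [exact: nearW|exact: Ff].
have dF : {ae mu, forall x n, setT x ->
    (`|(cabs (F n x - f x))%:E| <= (2 * g x)%:E)%E}.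
  apply: aeW => x n _ /=; rewrite lee_fin ger0_norm ?cabs_ge0//.
  by rewrite (le_trans (cabsB _ _))// mulr_natl mulr2n lerD.
have [_ _] := dominated_convergence measurableT
  (fun n => (measurable_EFinP _ _).2 (ml n)) (measurable_cst _) cF ig2 dF.
rewrite integral0 => h.
have h2 : (fun n => (2%:E * \int[mu]_x (cabs (F n x - f x))%:E)%E) @ \oo --> (2%:E * 0)%E.
  by apply: cvgeZl.
rewrite mule0 in h2.
have {h2} : (fun n => (cabs (cint (F n) - cint f))%:E) @ \oo --> 0%E.
  apply: (squeeze_cvge _ (cvg_cst 0%E) h2).
  apply: nearW => n; apply/andP; split; first by rewrite lee_fin cabs_ge0.
  rewrite -cintB//; apply: cint_le; apply: cintg_cmeas.
  by have := cintgD (Fi n) (cintgZ (-1) fi); under eq_fun do rewrite mulN1r.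
by move/fine_cvgP => [].
Qed.

End complex_integral.

(** * Fubini for complex functions, and integrals of products over R^n *)

Section fubini_dominated.
Context d1 d2 (T1 : measurableType d1) (T2 : measurableType d2) (R : realType).
Variables (m1 : {sigma_finite_measure set T1 -> \bar R}).
Variables (m2 : {sigma_finite_measure set T2 -> \bar R}).
Variables (a : T1 -> R) (b : T2 -> R).
Hypotheses (ia : m1.-integrable setT (EFin \o a)) (ib : m2.-integrable setT (EFin \o b)).
Hypotheses (a0 : forall x, 0 <= a x) (b0 : forall x, 0 <= b x).

Section real.
Variable (k : T1 * T2 -> R).
Hypotheses (mk : measurable_fun setT k) (kab : forall z, `|k z| <= a z.1 * b z.2).

(** A kernel dominated by a product of integrable functions is integrable on
    the product, so that this pointwise bound is all that an exchange of
    integrals requires. *)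
Lemma dom_integrable : (m1 \x m2)%E.-integrable setT (EFin \o k).
Proof.
apply/integrable12ltyP; first exact/measurable_EFinP.
apply: (@le_lt_trans _ _ (\int[m1]_x ((a x)%:E * \int[m2]_y (b y)%:E))%E).
  apply: ge0_le_integral => //=.
  - by move=> x _; exact: integral_ge0.
  - apply: (measurable_fun_fubini_tonelli_F (fun z => (`|k z|)%:E)) => //.
    exact/measurable_EFinP/measurableT_comp.
  - by apply: emeasurable_funM => //; case/integrableP : ia.
  - move=> x _; rewrite -ge0_integralZl//; last first.
    + by rewrite lee_fin.
    + by move=> y _; rewrite lee_fin.
    + by case/integrableP : ib.
    apply: ge0_le_integral => //=.
    + apply/measurable_EFinP/measurableT_comp => //.
      exact: (measurableT_comp mk (pair1_measurable x)).
    + by apply: emeasurable_funM => //; case/integrableP : ib.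
    + by move=> y _; rewrite lee_fin; exact: (kab (x, y)).
under eq_integral do rewrite muleC.
rewrite ge0_integralZl//.
- rewrite -(fineK (integrable_fin_num measurableT ia)) -(fineK (integrable_fin_num measurableT ib)).
  by rewrite ltry.
- by case/integrableP : ia.
- by move=> x _; rewrite lee_fin.
- by apply: integral_ge0 => y _; rewrite lee_fin.
Qed.

Lemma dom_section1 x : m2.-integrable setT (fun y => (k (x, y))%:E).
Proof.
have : m2.-integrable setT (fun y => (a x)%:E * (b y)%:E)%E by exact: integrableZl.
apply: le_integrable => //.
  by apply/measurable_EFinP; exact: (measurableT_comp mk (pair1_measurable x)).
move=> y _ /=; rewrite lee_fin (le_trans (kab (x, y)))//=.
by rewrite ler_norm.
Qed.

Lemma dom_section2 y : m1.-integrable setT (fun x => (k (x, y))%:E).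
Proof.
have : m1.-integrable setT (fun x => (b y)%:E * (a x)%:E)%E by exact: integrableZl.
apply: le_integrable => //.
  by apply/measurable_EFinP; exact: (measurableT_comp mk (pair2_measurable y)).
move=> x _ /=; rewrite lee_fin (le_trans (kab (x, y)))//=.
by rewrite mulrC ler_norm.
Qed.

Lemma dom_Fubini1 : \int[m1]_x \int[m2]_y k (x, y) = \int[(m1 \x m2)%E]_z k z.
Proof.
congr fine; rewrite -(integral12_prod_meas1 dom_integrable).
apply: eq_integral => x _; rewrite /Rintegral fineK//.
by apply: integrable_fin_num => //; exact: dom_section1.
Qed.

Lemma dom_Fubini2 : \int[m2]_y \int[m1]_x k (x, y) = \int[(m1 \x m2)%E]_z k z.
Proof.
congr fine; rewrite -(integral21_prod_meas1 dom_integrable).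
apply: eq_integral => x _; rewrite /Rintegral fineK//.
by apply: integrable_fin_num => //; exact: dom_section2.
Qed.

End real.

Variable (k : T1 * T2 -> R[i]).
Hypotheses (mk : cmeas k) (kab : forall z, cabs (k z) <= a z.1 * b z.2).

Let kr z : `|complex.Re (k z)| <= a z.1 * b z.2.
Proof. exact: le_trans (ge_Re_cabs _) (kab z). Qed.

Let ki z : `|complex.Im (k z)| <= a z.1 * b z.2.
Proof. exact: le_trans (ge_Im_cabs _) (kab z). Qed.

Lemma cdom_cintg : cintg (m1 \x m2)%E k.
Proof. by split; [exact: dom_integrable mk.1 kr|exact: dom_integrable mk.2 ki]. Qed.

Lemma cdom_Fubini1 :
  cint m1 (fun x => cint m2 (fun y => k (x, y))) = cint (m1 \x m2)%E k.
Proof.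
by apply: complex_eqP => /=; [exact: dom_Fubini1 mk.1 kr|exact: dom_Fubini1 mk.2 ki].
Qed.

Lemma cdom_Fubini2 :
  cint m2 (fun y => cint m1 (fun x => k (x, y))) = cint (m1 \x m2)%E k.
Proof.
by apply: complex_eqP => /=; [exact: dom_Fubini2 mk.1 kr|exact: dom_Fubini2 mk.2 ki].
Qed.

Lemma cdom_swap :
  cint m1 (fun x => cint m2 (fun y => k (x, y))) =
  cint m2 (fun y => cint m1 (fun x => k (x, y))).
Proof. by rewrite cdom_Fubini1 cdom_Fubini2. Qed.

End fubini_dominated.

Section measurable_parameter.
Context d1 d2 (T1 : measurableType d1) (T2 : measurableType d2) (R : realType).
Variable (m2 : {sigma_finite_measure set T2 -> \bar R}).

(** The integral is the difference of those of the positive and negative parts,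
    each measurable by Tonelli. *)
Lemma measurable_Rintegral_param (k : T1 * T2 -> R) : measurable_fun setT k ->
  measurable_fun setT (fun x => \int[m2]_y k (x, y)).
Proof.
move=> mk; apply: (measurableT_comp (fine_measurable measurableT)).
have mK : measurable_fun setT (EFin \o k) by exact/measurable_EFinP.
pose K := EFin \o k.
pose Kp x := (\int[m2]_y K^\+ (x, y))%E; pose Kn x := (\int[m2]_y K^\- (x, y))%E.
have KE : (fun x => \int[m2]_y K (x, y))%E = (Kp \- Kn)%E.
  apply/funext => x; rewrite [LHS]integralE.
  under eq_integral do rewrite funepos_comp/=.
  by under [X in (_ - X = _)%E]eq_integral do rewrite funeneg_comp/=.
rewrite KE.
apply: emeasurable_funB.
  apply: (measurable_fun_fubini_tonelli_F ((EFin \o k)^\+)%E) => //.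
  exact: measurable_funepos.
apply: (measurable_fun_fubini_tonelli_F ((EFin \o k)^\-)%E) => //.
exact: measurable_funeneg.
Qed.

Lemma cmeas_cint_param (k : T1 * T2 -> R[i]) : cmeas k ->
  cmeas (fun x => cint m2 (fun y => k (x, y))).
Proof.
move=> [mr mi]; split.
  exact: (@measurable_Rintegral_param (fun z => complex.Re (k z))).
exact: (@measurable_Rintegral_param (fun z => complex.Im (k z))).
Qed.

End measurable_parameter.

Section integral_rV.
Variable R : realType.
Local Notation C := R[i].
Local Notation leb := (lebR R).
Local Notation mu := (lebesgue_rV R).

(** Lebesgue measure in dimension n + 1 is the image of a product measure: the
    step of every induction on the dimension. *)
Lemma cint_rVS n (f : 'rV[R]_n.+1 -> C) : cmeas f ->
  cintg (leb \x mu n)%E (fun z => f (rV_cons z)) ->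
  cintg (mu n.+1) f /\ cint (mu n.+1) f = cint (leb \x mu n)%E (fun z => f (rV_cons z)).
Proof.
move=> [mr mi] [ir ii].
have aux (h : 'rV[R]_n.+1 -> R) : measurable_fun setT h ->
    (leb \x mu n)%E.-integrable setT (fun z => (h (rV_cons z))%:E) ->
    (mu n.+1).-integrable setT (fun z => (h z)%:E) /\
    \int[mu n.+1]_z h z = \int[(leb \x mu n)%E]_z h (rV_cons z).
  move=> mh ih; have mH : measurable_fun setT (fun z => (h z)%:E) by exact/measurable_EFinP.
  split; first exact: (integrable_pushforward (@measurable_rV_cons R n) mH).
  by congr fine; exact: (integral_pushforward (@measurable_rV_cons R n) mH).
have [? er] := aux _ mr ir; have [? ei] := aux _ mi ii.
by split; [split|exact: complex_eqP].
Qed.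

Lemma rV_cons0 n (z : measurableTypeR R * 'rV[R]_n) : rV_cons z ord0 ord0 = z.1.
Proof. by rewrite mxE unlift_none. Qed.

Lemma rV_consS n (z : measurableTypeR R * 'rV[R]_n) i :
  rV_cons z ord0 (lift ord0 i) = z.2 ord0 i.
Proof. by rewrite mxE liftK. Qed.

Lemma cmeas_coord n (i : 'I_n) (f : measurableTypeR R -> C) : cmeas f ->
  cmeas (fun x : 'rV[R]_n => f (x ord0 i)).
Proof.
move=> [mr mi]; split.
  exact: (measurableT_comp mr (measurable_rV_coord (T := measurableTypeR R) i)).
exact: (measurableT_comp mi (measurable_rV_coord (T := measurableTypeR R) i)).
Qed.

(** Gaussians, boxes and the kernels below are all products of functions of one
    coordinate, and their integrals come from here. *)
Lemma cint_prod n (F : 'I_n -> measurableTypeR R -> C) :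
  (forall i, cintg leb (F i)) ->
  cintg (mu n) (fun x => \prod_(i < n) F i (x ord0 i)) /\
  cint (mu n) (fun x => \prod_(i < n) F i (x ord0 i)) = \prod_(i < n) cint leb (F i).
Proof.
elim: n F => [|n IH] F iF.
  rewrite big_ord0; under eq_fun do rewrite big_ord0; split.
    split => /=; last exact: integrable0.
    apply/integrableP; split; first exact: measurable_cst.
    by rewrite integral_dirac//= diracT mul1e normr1 ltry.
  rewrite /cint/= /Rintegral integral0 integral_dirac//.
  by rewrite diracT mul1e.
have [ip ep] := IH (fun i => F (lift ord0 i)) (fun i => iF _).
set P := (X in cint _ X) in ep; rewrite -/P in ip.
have E z : \prod_(i < n.+1) F i (rV_cons z ord0 i) = F ord0 z.1 * P z.2.
  by rewrite big_ord_recl rV_cons0; under eq_bigr do rewrite rV_consS.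
have ia := cintg_cabs (iF ord0); have ib := cintg_cabs ip.
pose k (z : measurableTypeR R * 'rV[R]_n) := F ord0 z.1 * P z.2.
have mk : cmeas k.
  apply: cmeasM.
    by have [] := cmeas_comp (measurable_fst : measurable_fun _ (@fst (measurableTypeR R) 'rV[R]_n)) (cintg_cmeas (iF ord0)); split.
  by have [] := cmeas_comp (measurable_snd : measurable_fun _ (@snd (measurableTypeR R) 'rV[R]_n)) (cintg_cmeas ip); split.
have kab z : cabs (k z) <= cabs (F ord0 z.1) * cabs (P z.2) by rewrite cabsM.
have a0 x : 0 <= cabs (F ord0 x) by exact: cabs_ge0.
have b0 x : 0 <= cabs (P x) by exact: cabs_ge0.
have ik := cdom_cintg ia ib a0 b0 mk kab.
have fk := cdom_Fubini1 ia ib a0 b0 mk kab.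
have mF : cmeas (fun x : 'rV[R]_n.+1 => \prod_(i < n.+1) F i (x ord0 i)).
  by apply: cmeas_prod => i; exact: cmeas_coord (cintg_cmeas (iF i)).
have [|i1 e1] := cint_rVS mF.
  by under eq_fun do rewrite E.
split => //; rewrite e1; under eq_fun do rewrite E.
rewrite -fk /k/=; under eq_fun do rewrite cintZ//.
under eq_fun do rewrite mulrC.
by rewrite cintZ// big_ord_recl mulrC ep.
Qed.

Lemma Rint_prod n (f : 'I_n -> measurableTypeR R -> R) :
  (forall i, leb.-integrable setT (fun t => (f i t)%:E)) ->
  (mu n).-integrable setT (fun x => (\prod_(i < n) f i (x ord0 i))%:E) /\
  \int[mu n]_x \prod_(i < n) f i (x ord0 i) = \prod_(i < n) \int[leb]_t f i t.
Proof.
move=> fi.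
have cf i : cintg leb (fun t => (f i t)%:C) by split; [exact: fi|exact: integrable0].
have [[ip _] ep] := cint_prod cf.
split; first by move: ip; apply: eq_integrable => // x _; rewrite -RC_prod.
apply: (@complexI R); rewrite RC_prod.
under eq_bigr do rewrite -cint_real; rewrite -ep -cint_real.
by congr cint; apply/funext => x; rewrite RC_prod.
Qed.

(** The measurable sets are generated by the coordinates; an open set is the
    union of the countably many rational cubes that it contains. *)
Lemma rV_open_measurable n (U : set 'rV[R]_n) : open U -> measurable U.
Proof.
move=> oU.
pose B (z : 'rV[int]_n * nat) : set 'rV[R]_n :=
  [set x | forall i, x ord0 i \in `[(z.1 ord0 i)%:~R / z.2.+1%:R,
                                  ((z.1 ord0 i)%:~R + 1) / z.2.+1%:R]].
have mB z : measurable (B z).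
  rewrite (_ : B z = \bigcap_(i in [set: 'I_n])
     ((fun x : 'rV[R]_n => x ord0 i) @^-1`
       `[(z.1 ord0 i)%:~R / z.2.+1%:R, ((z.1 ord0 i)%:~R + 1) / z.2.+1%:R]%classic)).
    apply: fin_bigcap_measurable => // i _.
    by rewrite -[X in measurable X]setTI; apply: measurable_rV_coord.
  by apply/seteqP; split=> x /= h; [move=> i _; exact: h|move=> i; exact: h].
rewrite (_ : U = \bigcup_(z in [set: 'rV[int]_n * nat]) (if `[< B z `<=` U >] then B z else set0)).
  apply: countable_bigcupT_measurable; first exact: countableP.
  by move=> z; case: ifP => _; [exact: mB|exact: measurable0].
apply/seteqP; split => [x Ux|x [z _]]; last by case: asboolP => // h; exact: h.
have [e /= e0 xeU] := (nbhs_ballP _ _).1 (open_nbhs_nbhs (conj oU Ux)).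
have [k ke] : exists k : nat, k.+1%:R^-1 < e.
  have [k _ /(_ k (leqnn k))] := near_infty_natSinv_lt (PosNum e0).
  by exists k.
pose z : 'rV[int]_n := \row_i Num.floor (k.+1%:R * x ord0 i).
have k0 : 0 < k.+1%:R :> R by [].
have xB i : (z ord0 i)%:~R / k.+1%:R <= x ord0 i <= ((z ord0 i)%:~R + 1) / k.+1%:R.
  rewrite ler_pdivrMr// ler_pdivlMr// mulrC !mxE Num.Theory.floor_le/=.
  by apply/ltW; have := Num.Theory.floorD1_gt (k.+1%:R * x ord0 i); rewrite intrD.
exists (z, k) => //; case: asboolP => [_ i /=|nBU]; first by rewrite in_itv/= xB.
exfalso; apply: nBU => y By; apply: xeU; split => // i j.
have -> : i = ord0 by exact: ord1.
rewrite /ball/=; apply: le_lt_trans ke.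
have := By j; rewrite in_itv/=; have := xB j.
rewrite mulrDl mul1r => /andP[h1 h2] /andP[h3 h4].
move: h1 h2 h3 h4; move: (x ord0 j) (y ord0 j) ((z ord0 j)%:~R / k.+1%:R).
move: (k.+1%:R^-1) => K X Y Z h1 h2 h3 h4.
by rewrite ler_norml; apply/andP; split; lra.
Qed.

Lemma rV_continuous_measurable n (f : 'rV[R]_n -> R) :
  continuous f -> measurable_fun setT f.
Proof.
move=> /continuousP cf; apply: (measurability _ (RGenOpens.measurableE R)).
move=> _ [_ [a [b ->] <-]]; rewrite setTI.
by apply: rV_open_measurable; apply: cf; exact: interval_open.
Qed.

End integral_rV.

(** * Integrals on the line *)

Section line.
Variable R : realType.
Local Notation C := R[i].
Local Notation leb := (lebR R).
Implicit Types (s m t xi : R).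

Lemma is_derive1_cont (f : R -> R) (df : R -> R) :
  (forall x : R, is_derive x 1 f (df x)) -> continuous f.
Proof. by move=> h x; apply/differentiable_continuous/derivable1_diffP. Qed.

Lemma Rint_oo_FTC (f F : R -> R) (a b : R) : a < b -> continuous f ->
  (forall x : R, is_derive x 1 F (f x)) ->
  \int[leb]_(x in `]a, b[) f x = F b - F a.
Proof.
move=> ab cf dF; have cF := is_derive1_cont dF.
have mf : measurable_fun setT (EFin \o f).
  by apply/measurable_EFinP; exact: continuous_measurable_fun.
have cI : leb.-integrable `[a, b] (EFin \o f).
  by apply: continuous_compact_integrable; [exact: segment_compact|exact: continuous_subspaceT].
rewrite Rintegral_itv_bndo_bndc; last first.
  by apply: integrableS cI => //; exact: subset_itv_oo_cc.
rewrite Rintegral_itv_obnd_cbnd; last first.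
  by apply: integrableS cI => //; exact: subset_itv_oc_cc.
rewrite /Rintegral (@continuous_FTC2 _ f F)//.
- exact: continuous_subspaceT.
- split.
  + by move=> x _.
  + by apply: cvg_at_right_filter; exact: cF.
  + by apply: cvg_at_left_filter; exact: cF.
- by move=> x _; rewrite derive1E derive_val.
Qed.

(** Integrating over [-n, n] and letting n grow. *)
Lemma Rint_derivative (f F g : R -> R) : continuous f ->
  (forall x : R, is_derive x 1 F (f x)) ->
  leb.-integrable setT (EFin \o g) -> (forall x, `|f x| <= g x) ->
  F (n%:R) @[n --> \oo] --> (0 : R) -> F (- n%:R) @[n --> \oo] --> (0 : R) ->
  \int[leb]_x f x = 0.
Proof.
move=> cf dF ig fg Fp Fn.
have mf : measurable_fun setT f by exact: continuous_measurable_fun.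
pose I n := `](- n%:R : R), n%:R[%classic.
pose h (n : nat) (x : measurableTypeR R) : C := (f x * \1_(I n) x)%:C.
have mh n : cmeas (h n).
  by apply: cmeas_real; apply: measurable_funM => //; apply: measurable_indic; exact: measurable_itv.
have hg n x : cabs (h n x) <= g x.
  rewrite cabs_real normrM (le_trans _ (fg x))// indicE.
  by case: (_ \in _); rewrite ?normr1 ?mulr1// normr0 mulr0.
have hf x : (fun n => cabs (h n x - (f x)%:C)) @ \oo --> (0 : R).
  apply: cvg_near_cst; near=> n.
  rewrite /h (_ : \1_(I n) x = 1) ?mulr1 ?subrr ?cabs0//.
  rewrite indicE mem_set//= /I/= in_itv/= -ltr_norml.
  by near: n; exact: nbhs_infty_gtr.
have := cint_cvg mh (cmeas_real mf) ig hg hf.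
have e n : (0 < n)%N -> cint leb (h n) = (F n%:R - F (- n%:R))%:C.
  move=> n0; rewrite cint_real -(@Rint_oo_FTC f F)//; last first.
    by rewrite gtrN// ltr0n.
  congr (_%:C); rewrite [RHS]Rintegral_mkcond; apply: eq_Rintegral => x _.
  by rewrite patch_indic.
move=> h1.
have h2 : (fun n => cabs ((F n%:R - F (- n%:R))%:C - cint leb (fun x => (f x)%:C)))
    @ \oo --> (0 : R).
  apply: cvg_trans h1; apply: near_eq_cvg; near=> n.
  by rewrite e//; near: n; exact: nbhs_infty_gt.
rewrite cint_real in h2; set L := \int[leb]_x f x in h2 *.
have h3 : (fun n => `|F n%:R - F (- n%:R) - L|) @ \oo --> `|0 - 0 - L|.
  exact: (cvg_norm (cvgB (cvgB Fp Fn) (@cvg_cst _ L _ _ _))).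
have : `|0 - 0 - L| = 0.
  rewrite (_ : (fun n => `|_|) = (fun n =>
      cabs ((F n%:R - F (- n%:R))%:C - L%:C))) in h3; last first.
    by apply/funext => n; rewrite -cabs_real rmorphB.
  exact: cvg_unique h3 h2.
by move/eqP; rewrite subrr sub0r normrN normr_eq0 => /eqP.
Unshelve. all: by end_near. Qed.

(** A dilation of 1 / (1 + t^2) that keeps the integral; products of these
    majorize the inverse Fourier transforms of functions living at frequency s. *)
Definition ckernel s y t : R := s / (1 + (s * (t - y)) ^+ 2).

Lemma ckernel_ge0 s y t : 0 <= s -> 0 <= ckernel s y t.
Proof. by move=> s0; rewrite divr_ge0// addr_ge0// sqr_ge0. Qed.

(** The substitution u = s (t - y) reduces this to the arctangent integral. *)
Lemma ckernel_integral s y : 0 < s ->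
  (\int[leb]_t (ckernel s y t)%:E)%E = pi%:E.
Proof.
move=> s0.
pose F t : R := s * (t - y).
have dF (x : R) : is_derive x 1 F s.
  rewrite /F; apply: is_derive_eq; rewrite /GRing.scale/=; ring.
have F' : derive1 F = cst s.
  by apply/funext => x; rewrite derive1E derive_val.
have G0 (x : R) : 0 <= (oneDsqr x)^-1 by rewrite invr_ge0 addr_ge0// sqr_ge0.
have pi2 : (\int[leb]_x ((oneDsqr x)^-1)%:E = pi%:E)%E.
  rewrite ge0_symfun_integralT//=.
  - rewrite (_ : [set x | _] = `[0, +oo[%classic); last first.
      by apply/seteqP; split => x/=; rewrite in_itv/= andbT.
    by rewrite integral0y_oneDsqr -EFinM mulrCA divff// mulr1.
  - by move=> x; exact: continuous_oneDsqrV.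
  - by move=> x/=; rewrite /oneDsqr sqrrN.
rewrite -pi2 [RHS](@increasing_ge0_integration_by_substitutionT _ F).
- apply: eq_integral => t _; congr EFin.
  by rewrite F' /ckernel /oneDsqr /F/= mulrC.
- by move=> a b ab; rewrite /F ltr_pM2l// ltrD2r.
- by rewrite F'; exact: cst_continuous.
- by rewrite F'; exact: is_cvg_cst.
- by rewrite F'; exact: is_cvg_cst.
- by move=> x.
- rewrite /F; apply/cvgrNyPle => A; near=> x.
  rewrite mulrC -ler_pdivlMr// lerBlDr; near: x.
  by apply: nbhs_ninfty_le; exact: num_real.
- rewrite /F; apply/cvgryPge => A; near=> x.
  rewrite mulrC -ler_pdivrMr// lerBrDr; near: x.
  by apply: nbhs_pinfty_ge; exact: num_real.
- by move=> x; exact: continuous_oneDsqrV.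
- exact: G0.
Unshelve. all: by end_near. Qed.

Lemma measurable_ckernel s y : measurable_fun setT (ckernel s y).
Proof.
apply: continuous_measurable_fun => t.
apply: cvgM; first exact: cvg_cst.
apply: cvgV; first by rewrite gt_eqF// ltr_wpDr// sqr_ge0.
apply: cvgD; first exact: cvg_cst.
apply: (@continuous_comp _ _ _ (fun t => s * (t - y)) (fun x => x ^+ 2)).
  by apply: cvgM; [exact: cvg_cst|apply: cvgB => //; exact: cvg_cst].
exact: exprn_continuous.
Qed.

Lemma ckernel_integrable s y : 0 < s ->
  leb.-integrable setT (EFin \o ckernel s y).
Proof.
move=> s0; apply/integrableP; split.
  by apply/measurable_EFinP; exact: measurable_ckernel.
under eq_integral do rewrite /= ger0_norm ?ckernel_ge0 ?ltW//.
by rewrite ckernel_integral// ltry.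
Qed.

Lemma is_derive_normal_fun s m t : is_derive t 1 (normal_fun m s)
  (- ((t - m) / s ^+ 2) * normal_fun m s t).
Proof.
pose h := fun t : R => (s ^+ 2 *+ 2)^-1 * - (t - m) ^+ 2.
have -> : normal_fun m s = expR \o h.
  by apply/funext => x; rewrite /normal_fun /h/= mulrC.
have dh : is_derive t 1 h (- ((t - m) / s ^+ 2)).
  rewrite /h; apply: is_derive_eq; rewrite /GRing.scale/=.
  have [->|s0] := eqVneq s 0; first by rewrite expr0n/= mul0rn invr0; ring.
  by field.
by apply: (is_derive_eq (is_derive1_comp (is_derive_expR _) dh)); rewrite mulrC.
Qed.

Lemma integral_normal_fun s m : 0 < s ->
  leb.-integrable setT (EFin \o normal_fun m s) /\
  \int[leb]_t normal_fun m s t = Num.sqrt (2 * pi) * s.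
Proof.
move=> s0; have s1 : s != 0 by rewrite gt_eqF.
have E : normal_peak s = (Num.sqrt (2 * pi) * s)^-1.
  rewrite /normal_peak; congr (_^-1).
  by rewrite (_ : _ *+ 2 = (2 * pi) * s ^+ 2); [rewrite sqrtrM ?mulr_ge0 ?pi_ge0// sqrtr_sqr gtr0_norm|ring].
have p0 : Num.sqrt (2 * pi) * s != 0.
  by rewrite mulf_neq0// gt_eqF// sqrtr_gt0 mulr_gt0// pi_gt0.
have H t : normal_fun m s t = (Num.sqrt (2 * pi) * s) * normal_pdf m s t.
  by rewrite normal_pdfE// E mulVKf.
have ip := @integrable_normal_pdf R m s.
split.
  have := integrableZl measurableT (Num.sqrt (2 * pi) * s) ip.
  by apply: eq_integrable => // x _; rewrite /= H EFinM.
under eq_Rintegral do rewrite H.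
rewrite RintegralZl// -[RHS]mulr1; congr (_ * _).
by rewrite /Rintegral integral_normal_pdf.
Qed.

(** Doubling the width absorbs a factor |t|; this dominates the derivatives in
    the characteristic function below. *)
Lemma le_abs_normal_fun s t : 0 < s ->
  `|t| * normal_fun 0 s t <= 2 * s * normal_fun 0 (2 * s) t.
Proof.
move=> s0; have s1 : s != 0 by rewrite gt_eqF.
have e : normal_fun 0 (2 * s) t = expR (3 * (t ^+ 2 / (8 * s ^+ 2))) * normal_fun 0 s t.
  by rewrite /normal_fun -expRD; congr expR; rewrite subr0; field.
rewrite e mulrA ler_wpM2r ?normal_fun_ge0//.
apply: le_trans (ler_wpM2l _ (expR_ge1Dx _)); last by rewrite mulr_ge0// ltW.
rewrite -subr_ge0.
have -> : 2 * s * (1 + 3 * (t ^+ 2 / (8 * s ^+ 2))) - `|t| =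
  ((`|t| - s) ^+ 2 * 2 + `|t| ^+ 2 + 6 * s ^+ 2) / (4 * s).
  by rewrite -(real_normK (num_real t)); field.
apply: divr_ge0; last by rewrite mulr_ge0// ltW.
have := sqr_ge0 (`|t| - s); have := sqr_ge0 `|t|; have := sqr_ge0 s; lra.
Qed.

Lemma continuous_normal_fun s m : continuous (normal_fun m s).
Proof. exact: is_derive1_cont (is_derive_normal_fun s m). Qed.

End line.

(** * The Fourier transform of Gaussians on the line *)

Section gauss_fourier.
Variable R : realType.
Local Notation C := R[i].
Local Notation leb := (lebR R).
Implicit Types (s m t xi th : R).

Lemma is_derive_cos_affine (f : R -> R) (df : R) (x : R) :
  is_derive x 1 f df -> is_derive x 1 (fun t => cos (f t)) (- sin (f x) * df).
Proof. by move=> h; exact: (is_derive1_comp (is_derive_cos _) h). Qed.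

Lemma is_derive_sin_affine (f : R -> R) (df : R) (x : R) :
  is_derive x 1 f df -> is_derive x 1 (fun t => sin (f t)) (cos (f x) * df).
Proof. by move=> h; exact: (is_derive1_comp (is_derive_sin _) h). Qed.

Lemma normal_fun_le s m t : 0 < s ->
  `|t - m| * normal_fun m s t <= 2 * s * normal_fun m (2 * s) t.
Proof.
move=> s0; have := le_abs_normal_fun (t - m) s0.
by rewrite /normal_fun !subr0.
Qed.

Lemma cvg_normal_fun s m (u : nat -> R) : 0 < s ->
  (\forall n \near \oo, n%:R - `|m| <= `|u n - m|) ->
  normal_fun m s (u n) @[n --> \oo] --> (0 : R).
Proof.
move=> s0 um.
have K0 : 0 < 2 * s by rewrite mulr_gt0.
have n1 t : normal_fun m (2 * s) t <= 1.
  rewrite /normal_fun -expR0 ler_expR mulNr oppr_le0 divr_ge0 ?sqr_ge0//.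
  by rewrite mulrn_wge0// sqr_ge0.
apply/cvgrPdist_le => e e0; near=> n.
rewrite sub0r normrN ger0_norm ?normal_fun_ge0//.
have h := normal_fun_le m (u n) s0.
have un : 2 * s / e <= `|u n - m|.
  apply: (@le_trans _ _ (n%:R - `|m|)); last by near: n.
  by rewrite lerBrDr; near: n; exact: nbhs_infty_ger.
have un0 : 0 < `|u n - m| by apply: lt_le_trans un; rewrite divr_gt0.
rewrite -(ler_pM2l un0); apply: le_trans h _.
apply: (@le_trans _ _ (2 * s)); first by rewrite ler_piMr// ltW.
by rewrite -ler_pdivrMr.
Unshelve. all: by end_near. Qed.

Lemma measurable_cos_phase s m xi th : measurable_fun setT
  (fun t : R => cos (xi * (t - m) + th) * normal_fun m s t).
Proof.
apply: continuous_measurable_fun => t; apply: cvgM; last exact: continuous_normal_fun.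
apply: (is_derive1_cont (df := fun t => - sin (xi * (t - m) + th) * xi)) => x.
apply: is_derive_cos_affine; apply: is_derive_eq; rewrite /GRing.scale/=; ring.
Qed.

Lemma integrable_cos_phase s m xi th : 0 < s -> leb.-integrable setT
  (fun t => (cos (xi * (t - m) + th) * normal_fun m s t)%:E).
Proof.
move=> s0; apply: le_integrable (proj1 (integral_normal_fun m s0)) => //.
  by apply/measurable_EFinP; exact: measurable_cos_phase.
move=> t _ /=; rewrite lee_fin normrM ler_piMl//.
by rewrite ler_norml cos_geN1 cos_le1.
Qed.

(** Integrating the derivative of sin (xi (t - m) + th) normal_fun m s t. *)
Lemma integral_sin_phase s m xi th : 0 < s ->
  \int[leb]_t ((t - m) * sin (xi * (t - m) + th) * normal_fun m s t) =
  s ^+ 2 * xi * \int[leb]_t (cos (xi * (t - m) + th) * normal_fun m s t).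
Proof.
move=> s0; have s1 : s != 0 by rewrite gt_eqF.
have dp (t : R) : is_derive t 1 (fun t => xi * (t - m) + th) xi.
  by apply: is_derive_eq; rewrite /GRing.scale/=; ring.
pose F t := sin (xi * (t - m) + th) * normal_fun m s t.
pose f1 t := (t - m) * sin (xi * (t - m) + th) * normal_fun m s t.
pose f2 t := cos (xi * (t - m) + th) * normal_fun m s t.
pose f t := xi * f2 t - s ^- 2 * f1 t.
have dF (t : R) : is_derive t 1 F (f t).
  have h1 := is_derive_sin_affine (dp t).
  have h2 := is_derive_normal_fun s m t.
  by apply: is_derive_eq; rewrite /f /f1 /f2 /GRing.scale/=; ring.
have csin : continuous (fun t : R => sin (xi * (t - m) + th)).
  by apply: is_derive1_cont => x; exact: is_derive_sin_affine (dp x).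
have cn := @continuous_normal_fun R s m.
have cc : continuous f2.
  move=> t; apply: cvgM; last exact: cn.
  by apply: (is_derive1_cont (fun x => is_derive_cos_affine (dp x))).
have c1 : continuous f1.
  move=> t; apply: cvgM; last exact: cn.
  apply: cvgM; last exact: csin.
  by apply: cvgB => //; exact: cvg_cst.
have cf : continuous f.
  move=> t; apply: cvgB; (apply: cvgM; first exact: cvg_cst).
    exact: cc.
  exact: c1.
have if2 : leb.-integrable setT (EFin \o f2) by exact: integrable_cos_phase.
have if1 : leb.-integrable setT (EFin \o f1).
  have S0 : 0 < 2 * s by rewrite mulr_gt0.
  have := integrableZl measurableT (2 * s) (proj1 (integral_normal_fun m S0)).
  apply: le_integrable => //.
    by apply/measurable_EFinP; exact: continuous_measurable_fun.
  move=> t _ /=; rewrite lee_fin -[leLHS]/(`|f1 t|) [leRHS]ger0_norm; last first.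
    by rewrite mulr_ge0 ?normal_fun_ge0// ltW.
  apply: le_trans (normal_fun_le m t s0).
  rewrite /f1 !normrM (ger0_norm (normal_fun_ge0 _ _ _)) ler_wpM2r ?normal_fun_ge0//.
  by rewrite ler_piMr// ler_norml sin_geN1 sin_le1.
have if2' : leb.-integrable setT (fun t => (xi * f2 t)%:E).
  exact: (integrableZ _ if2).
have if1' : leb.-integrable setT (fun t => (s ^- 2 * f1 t)%:E).
  exact: (integrableZ _ if1).
have iff : leb.-integrable setT (EFin \o f).
  by have := integrableB measurableT if2' if1'; apply: eq_integrable.
have F0 (u : nat -> R) : normal_fun m s (u n) @[n --> \oo] --> (0 : R) ->
    F (u n) @[n --> \oo] --> (0 : R).
  move=> h; apply: norm_cvg0; apply: (squeeze_cvgr _ (cvg_cst 0) h).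
  apply: nearW => n; rewrite normr_ge0/= /F normrM.
  rewrite (ger0_norm (normal_fun_ge0 _ _ _)) ler_piMl ?normal_fun_ge0//.
  by rewrite ler_norml sin_geN1 sin_le1.
have h0 : \int[leb]_t f t = 0.
  apply: (@Rint_derivative R f F (fun t => `|f t|)) => //.
  - by have := integrable_norm iff; apply: eq_integrable.
  - apply: F0; apply: cvg_normal_fun => //; apply: nearW => n.
    by have := lerB_dist n%:R m; rewrite normr_nat.
  - apply: (F0 (fun n => - n%:R)); apply: cvg_normal_fun => //; apply: nearW => n.
    by have := lerB_dist (- n%:R) m; rewrite normrN normr_nat.
move: h0; rewrite RintegralB// !RintegralZl// => /eqP; rewrite subr_eq0 => /eqP h.
rewrite -[LHS]/(\int[leb]_t f1 t) -[in RHS]/(\int[leb]_t f2 t).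
by rewrite -mulrA h mulrA mulfV ?mul1r// expf_neq0.
Qed.

(** Let J (xi) be the integral on the left.  Differentiating under the integral
    sign and [integral_sin_phase] give J' = - s^2 xi J; the phase th treats
    cosine and sine at once. *)
Lemma integral_cos_phase s m xi th : 0 < s ->
  \int[leb]_t (cos (xi * (t - m) + th) * normal_fun m s t) =
  cos th * (Num.sqrt (2 * pi) * s) * expR (- (s ^+ 2 * xi ^+ 2) / 2).
Proof.
move=> s0.
pose f x (t : measurableTypeR R) := cos (x * (t - m) + th) * normal_fun m s t.
pose J x := \int[leb]_t f x t.
have df (x t : R) : is_derive x 1 (f ^~ t) (- ((t - m) * sin (x * (t - m) + th) * normal_fun m s t)).
  have dp : is_derive x 1 (fun x => x * (t - m) + th) (t - m).
    by apply: is_derive_eq; rewrite /GRing.scale/=; ring.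
  have h1 := is_derive_cos_affine dp.
  by apply: is_derive_eq; rewrite /GRing.scale/=; ring.
have S0 : 0 < 2 * s by rewrite mulr_gt0.
have dJ (x : R) : is_derive x 1 J (- (s ^+ 2 * x * J x)).
  have p1 z t : partial1of2 f z t = - ((t - m) * sin (z * (t - m) + th) * normal_fun m s t).
    by rewrite partial1of2E derive_val.
  pose G t := 2 * s * normal_fun m (2 * s) t.
  have iG : leb.-integrable setT (EFin \o G).
    exact: (integrableZ _ (proj1 (integral_normal_fun m S0))).
  have Ix : `]x - 1, x + 1[%classic x.
    by rewrite /= in_itv/= ltrBlDr ltrDl ltr01.
  have G0 t : 0 <= G t by rewrite mulr_ge0 ?normal_fun_ge0// ltW.
  have fi z : `]x - 1, x + 1[%classic z -> leb.-integrable setT (EFin \o f z).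
    by move=> _; exact: integrable_cos_phase.
  have fd z y : `]x - 1, x + 1[%classic z -> setT y -> derivable (f ^~ y) z 1.
    by move=> _ _; have := df z y.
  have fG z y : `]x - 1, x + 1[%classic z -> setT y -> `|partial1of2 f z y| <= G y.
    move=> _ _; rewrite p1 normrN; apply: le_trans (normal_fun_le m y s0).
    rewrite !normrM (ger0_norm (normal_fun_ge0 _ _ _)) ler_wpM2r ?normal_fun_ge0//.
    by rewrite ler_piMr// ler_norml sin_geN1 sin_le1.
  have h1 := derivable_under_integral measurableT Ix fi fd G0 iG fG.
  have h2 := differentiation_under_integral measurableT Ix fi fd G0 iG fG.
  apply: DeriveDef => //; rewrite -derive1E h2.
  rewrite /J /f -integral_sin_phase//.
  under eq_Rintegral do rewrite p1 -mulN1r.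
  rewrite RintegralZl ?mulN1r//.
  have iff : leb.-integrable setT (EFin \o (fun t => partial1of2 f x t)).
    apply: le_integrable iG => //; last first.
      by move=> y _ /=; rewrite lee_fin (ger0_norm (G0 y)); exact: fG.
    apply/measurable_EFinP; under eq_fun do rewrite p1.
    apply: continuous_measurable_fun => t; apply: cvgN; apply: cvgM; last exact: continuous_normal_fun.
    apply: cvgM; first by apply: cvgB => //; exact: cvg_cst.
    apply: (is_derive1_cont (df := fun t => cos (x * (t - m) + th) * x)) => y.
    by apply: is_derive_sin_affine; apply: is_derive_eq; rewrite /GRing.scale/=; ring.
  have := integrableN iff; apply: eq_integrable => // t _ /=.
  by rewrite p1 opprK.
pose H x := J x * expR (s ^+ 2 * x ^+ 2 / 2).
have dH (x : R) : is_derive x 1 H 0.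
  have dp : is_derive x 1 (fun x => s ^+ 2 * x ^+ 2 / 2) (s ^+ 2 * x).
    by apply: is_derive_eq; rewrite /GRing.scale/=; field.
  have de := is_derive1_comp (is_derive_expR _) dp.
  have dJx := dJ x.
  by apply: is_derive_eq; rewrite /GRing.scale/=; ring.
have HE := @is_derive_0_is_cst _ H xi 0 dH.
have J0 : J 0 = cos th * (Num.sqrt (2 * pi) * s).
  rewrite /J /f; under eq_Rintegral do rewrite mul0r add0r.
  by rewrite RintegralZl ?(proj2 (integral_normal_fun m s0))//; exact: (proj1 (integral_normal_fun m s0)).
move: HE; rewrite /H expr0n/= mulr0 mul0r expR0 mulr1 J0 => <-.
by rewrite -[RHS]mulrA -expRD mulNr subrr expR0 mulr1.
Qed.

Lemma cint_cexpi_normal_fun s m xi : 0 < s ->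
  cintg leb (fun t => cexpi (xi * t) * (normal_fun m s t)%:C) /\
  cint leb (fun t => cexpi (xi * t) * (normal_fun m s t)%:C) =
  cexpi (xi * m) * (Num.sqrt (2 * pi) * s * normal_fun 0 s^-1 xi)%:C.
Proof.
move=> s0; have E t : cexpi (xi * t) * (normal_fun m s t)%:C =
    cexpi (xi * m) * ((cos (xi * (t - m) + 0) * normal_fun m s t) +i*
                      (cos (xi * (t - m) - pi / 2) * normal_fun m s t)).
  rewrite addr0 cosBpihalf {1}(_ : xi * t = xi * m + xi * (t - m)); last by ring.
  by rewrite cexpiD -mulrA; congr (_ * _); apply: complex_eqP; rewrite ?ReM ?ImM/=; ring.
set h := fun t : measurableTypeR R =>
  (cos (xi * (t - m) + 0) * normal_fun m s t) +i* (cos (xi * (t - m) - pi / 2) * normal_fun m s t).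
have ih : cintg leb h by split; exact: integrable_cos_phase.
have -> : (fun t => cexpi (xi * t) * (normal_fun m s t)%:C) = (fun t => cexpi (xi * m) * h t).
  by apply/funext => t; exact: E.
split; first exact: cintgZ.
rewrite cintZ//; congr (_ * _); apply: complex_eqP => /=.
  rewrite integral_cos_phase// cos0 mul1r; congr (_ * _).
  rewrite /normal_fun subr0; congr expR; field.
  by rewrite gt_eqF.
by rewrite integral_cos_phase// -[- (pi / 2)]add0r cosBpihalf sin0 !mul0r.
Qed.

(** Orthogonality of the exponentials with integer frequencies on a unit
    interval. *)
Lemma cint_unit_interval (k : int) :
  let I := `](- (2^-1)), (2^-1 : R)[%classic in
  cintg leb (fun t => (\1_I t)%:C * cexpi (2 * pi * k%:~R * t)) /\
  cint leb (fun t => (\1_I t)%:C * cexpi (2 * pi * k%:~R * t)) = (k == 0)%:R.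
Proof.
move=> I; set w := 2 * pi * k%:~R.
have ab : (- (2^-1) : R) < 2^-1 by lra.
have mI : measurable I by exact: measurable_itv.
have mf : cmeas (fun t : measurableTypeR R => (\1_I t)%:C * cexpi (w * t)).
  apply: cmeasM; first by apply: cmeas_real; exact: measurable_indic.
  by apply: cmeas_cexpi; apply: measurable_funM.
have iI : leb.-integrable setT (EFin \o \1_I).
  apply/integrableP; split; first by apply/measurable_EFinP; exact: measurable_indic.
  under eq_integral do rewrite /= ger0_norm//.
  by rewrite integral_indic// setIT [ltLHS]lebesgue_measure_itv/= lte_fin ab -EFinB ltry.
split.
  apply: cintg_le mf iI _ => t; rewrite cabsM cabs_cexpi mulr1 cabs_real ger0_norm//.
have dp (t : R) : is_derive t 1 (fun t => w * t) w.
  by apply: is_derive_eq; rewrite /GRing.scale/=; ring.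
have conv (g : R -> R) : \int[leb]_t (\1_I t * g t) = \int[leb]_(t in I) g t.
  rewrite [RHS]Rintegral_mkcond; apply: eq_Rintegral => t _.
  by rewrite patch_indic mulrC.
have er : cint leb (fun t => (\1_I t)%:C * cexpi (w * t)) =
    (\int[leb]_(t in I) cos (w * t)) +i* (\int[leb]_(t in I) sin (w * t)).
  apply: complex_eqP => /=; rewrite -conv; apply: eq_Rintegral => t _.
    by ring.
  by ring.
rewrite er; have [k0|k0] := eqVneq k 0.
  rewrite /w k0 mulr0; apply: complex_eqP => /=.
    under eq_Rintegral do rewrite mul0r cos0.
    rewrite Rintegral_cst// mul1r [X in fine X](_ : _ = 1%:E)//.
    rewrite [LHS]lebesgue_measure_itv/= lte_fin ab -EFinB; congr EFin; lra.
  under eq_Rintegral do rewrite mul0r sin0.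
  by rewrite Rintegral_cst// mul0r.
have w0 : w != 0 by rewrite !mulf_neq0 ?intr_eq0// gt_eqF// pi_gt0.
have cc : continuous (fun t : R => cos (w * t)).
  by apply: is_derive1_cont => x; exact: is_derive_cos_affine (dp x).
have cs : continuous (fun t : R => sin (w * t)).
  by apply: is_derive1_cont => x; exact: is_derive_sin_affine (dp x).
have sk (j : int) : sin (pi * j%:~R) = 0 :> R.
  have hn (n : nat) : sin (pi * n%:R) = 0 :> R.
    elim: n => [|n IH]; first by rewrite mulr0 sin0.
    by rewrite -natr1 mulrDr mulr1 sinD IH sinpi mulr0 mul0r addr0.
  case: j => n; first exact: hn.
  by rewrite NegzE mulrNz mulrN sinN hn oppr0.
have wp : w * 2^-1 = pi * k%:~R by rewrite /w; field.
have d1 (x : R) : is_derive x 1 (fun t => w^-1 * sin (w * t)) (cos (w * x)).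
  have h := is_derive_sin_affine (dp x).
  by apply: is_derive_eq; rewrite /GRing.scale/=; field.
have d2 (x : R) : is_derive x 1 (fun t => - w^-1 * cos (w * t)) (sin (w * x)).
  have h := is_derive_cos_affine (dp x).
  by apply: is_derive_eq; rewrite /GRing.scale/=; field.
apply: complex_eqP => /=.
  by rewrite (Rint_oo_FTC ab cc d1) mulrN sinN wp sk oppr0 mulr0 subrr.
by rewrite (Rint_oo_FTC ab cs d2) mulrN cosN subrr.
Qed.

End gauss_fourier.

(** * The Fourier transform on integrable functions *)

Section fourier_L1.
Variables (R : realType) (n : nat).
Local Notation C := R[i].
Local Notation V := 'rV[R]_n.
Local Notation mu := (lebesgue_rV R n).
Implicit Types (f g h psi phi theta : V -> C) (x y xi eta a : V).

Lemma dotpC x y : dotp x y = dotp y x.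
Proof. by rewrite /dotp; apply: eq_bigr => i _; rewrite mulrC. Qed.

Lemma dotpBl x y z : dotp (x - y) z = dotp x z - dotp y z.
Proof. by rewrite /dotp -sumrB; apply: eq_bigr => i _; rewrite !mxE mulrBl. Qed.

Lemma measurable_dotp : measurable_fun setT (fun z : V * V => dotp z.1 z.2).
Proof.
rewrite /dotp; apply: measurable_sum => i; apply: measurable_funM.
  exact: (measurableT_comp (measurable_rV_coord (T := measurableTypeR R) i) measurable_fst).
exact: (measurableT_comp (measurable_rV_coord (T := measurableTypeR R) i) measurable_snd).
Qed.

Lemma measurable_dotp1 y : measurable_fun setT (fun x : V => dotp x y).
Proof. exact: (measurableT_comp measurable_dotp (pair2_measurable y)). Qed.

Lemma measurable_dotp2 x : measurable_fun setT (fun y : V => dotp x y).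
Proof. exact: (measurableT_comp measurable_dotp (pair1_measurable x)). Qed.

Lemma cmeas_fst f : cmeas f -> cmeas (fun z : V * V => f z.1).
Proof. by move=> mf; have [] := cmeas_comp (measurable_fst : measurable_fun _ (@fst V V)) mf. Qed.

Lemma cmeas_snd f : cmeas f -> cmeas (fun z : V * V => f z.2).
Proof. by move=> mf; have [] := cmeas_comp (measurable_snd : measurable_fun _ (@snd V V)) mf. Qed.

Lemma cintg_cexpi (h : V -> R) f : measurable_fun setT h -> cintg mu f ->
  cintg mu (fun x => cexpi (h x) * f x).
Proof.
move=> mh; apply: (@cintg_mulb _ _ _ _ 1); first exact: cmeas_cexpi.
by move=> x; rewrite cabs_cexpi.
Qed.

Lemma cmeas_fourier f : cmeas f -> cmeas (fourier f).
Proof.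
move=> mf; apply: (@cmeas_cint_param _ _ _ _ _ mu (fun z : V * V => cexpi (- dotp z.2 z.1) * f z.2)).
apply: cmeasM; last exact: cmeas_snd.
apply: cmeas_cexpi; apply: measurableT_comp => //.
by under eq_fun do rewrite dotpC; exact: measurable_dotp.
Qed.

Lemma cmeas_fourier_inv f : cmeas f -> cmeas (fourier_inv f).
Proof.
move=> mf; apply: cmeasM; first exact: cmeas_cst.
apply: (@cmeas_cint_param _ _ _ _ _ mu (fun z : V * V => cexpi (dotp z.1 z.2) * f z.2)).
apply: cmeasM; last exact: cmeas_snd.
by apply: cmeas_cexpi; exact: measurable_dotp.
Qed.

Lemma cabs_fourier_le f xi : cintg mu f ->
  cabs (fourier f xi) <= 2 * \int[mu]_x cabs (f x).
Proof.
move=> fi; apply: cint_le_dom.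
- by apply: cintg_cmeas (cintg_cexpi _ fi); apply: measurableT_comp => //; exact: measurable_dotp1.
- exact: cintg_cabs.
- by move=> x; rewrite cabsM cabs_cexpi mul1r.
Qed.

Lemma two_pi_gt0 : 0 < (2 * pi) ^- n :> R.
Proof. by rewrite invr_gt0 exprn_gt0// mulr_gt0// pi_gt0. Qed.

Lemma cabs_fourier_inv_le f xi : cintg mu f ->
  cabs (fourier_inv f xi) <= (2 * pi) ^- n * (2 * \int[mu]_x cabs (f x)).
Proof.
move=> fi; rewrite cabsM cabs_real gtr0_norm ?two_pi_gt0// ler_pM2l ?two_pi_gt0//.
apply: cint_le_dom.
- by apply: cintg_cmeas; apply: cintg_cexpi => //; exact: measurable_dotp2.
- exact: cintg_cabs.
- by move=> x; rewrite cabsM cabs_cexpi mul1r.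
Qed.

(** Both transforms, and convolution with an inverse transform, are instances
    of one exchange of integrals against a unimodular kernel. *)
Lemma cint_swap f g (e : V * V -> R) : cintg mu f -> cintg mu g ->
  measurable_fun setT e ->
  cint mu (fun x => f x * cint mu (fun y => cexpi (e (x, y)) * g y)) =
  cint mu (fun y => g y * cint mu (fun x => cexpi (e (x, y)) * f x)).
Proof.
move=> fi gi me.
pose k z := f z.1 * (cexpi (e z) * g z.2).
have mk : cmeas k.
  apply: cmeasM; first by apply: cmeas_fst; exact: cintg_cmeas fi.
  by apply: cmeasM; [exact: cmeas_cexpi|apply: cmeas_snd; exact: cintg_cmeas gi].
have kab z : cabs (k z) <= cabs (f z.1) * cabs (g z.2).
  by rewrite !cabsM cabs_cexpi mul1r.
have := cdom_swap (cintg_cabs fi) (cintg_cabs gi) (fun x => cabs_ge0 (f x))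
  (fun y => cabs_ge0 (g y)) mk kab.
rewrite /k/=.
have -> : (fun x => cint mu (fun y => f x * (cexpi (e (x, y)) * g y))) =
    (fun x => f x * cint mu (fun y => cexpi (e (x, y)) * g y)).
  apply/funext => x; rewrite cintZ//; apply: cintg_cexpi => //.
  exact: (measurableT_comp me (pair1_measurable x)).
move=> ->; congr cint; apply/funext => y.
rewrite -cintZ; last first.
  apply: cintg_cexpi => //.
  exact: (measurableT_comp me (pair2_measurable y)).
by congr cint; apply/funext => x; ring.
Qed.

Lemma cmeas_phase (h : V -> R) f : measurable_fun setT h -> cintg mu f ->
  cmeas (fun x => cexpi (h x) * f x).
Proof. by move=> mh fi; exact: cintg_cmeas (cintg_cexpi mh fi). Qed.

Lemma cintZ_bounded (c : C) f g (M : R) : cmeas f -> (forall x, cabs (f x) <= M) ->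
  cintg mu g -> cint mu (fun x => g x * (c * f x)) = c * cint mu (fun x => g x * f x).
Proof.
move=> mf fM gi; rewrite -cintZ; first by congr cint; apply/funext => x; ring.
by under eq_fun do rewrite mulrC; exact: cintg_mulb gi.
Qed.

Lemma cabs_phase_le (h : V -> R) f : measurable_fun setT h -> cintg mu f ->
  cabs (cint mu (fun x => cexpi (h x) * f x)) <= 2 * \int[mu]_x cabs (f x).
Proof.
move=> mh fi; apply: cint_le_dom; [exact: cmeas_phase|exact: cintg_cabs|].
by move=> x; rewrite cabsM cabs_cexpi mul1r.
Qed.

(** By this formula transforms are moved from one factor to the other. *)
Lemma fourier_swap f g : cintg mu f -> cintg mu g ->
  cint mu (fun x => f x * fourier g x) = cint mu (fun x => g x * fourier f x).
Proof.
move=> fi gi.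
have := cint_swap (e := fun z => - dotp z.2 z.1) fi gi.
rewrite /fourier/= => ->.
  congr cint; apply/funext => x; congr (_ * _); congr cint.
  by apply/funext => y; rewrite dotpC.
apply: measurableT_comp => //; under eq_fun do rewrite dotpC.
exact: measurable_dotp.
Qed.

Lemma cmeas_unnormalized_inv f : cmeas f ->
  cmeas (fun x => cint mu (fun y => cexpi (dotp x y) * f y)).
Proof.
move=> mf; apply: (@cmeas_cint_param _ _ _ _ _ mu (fun z : V * V => cexpi (dotp z.1 z.2) * f z.2)).
apply: cmeasM; last exact: cmeas_snd.
by apply: cmeas_cexpi; exact: measurable_dotp.
Qed.

Lemma fourier_inv_swap f g : cintg mu f -> cintg mu g ->
  cint mu (fun x => g x * fourier_inv f x) = cint mu (fun x => f x * fourier_inv g x).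
Proof.
move=> fi gi; have aux (u v : V -> C) : cintg mu u -> cintg mu v ->
    cint mu (fun x => v x * fourier_inv u x) = ((2 * pi) ^- n)%:C *
    cint mu (fun x => v x * cint mu (fun y => cexpi (dotp x y) * u y)).
  move=> ui vi; apply: (cintZ_bounded _ _ (fun x => cabs_phase_le (measurable_dotp2 x) ui)) => //.
  by apply: cmeas_unnormalized_inv; exact: cintg_cmeas ui.
rewrite !aux//; congr (_ * _); rewrite (cint_swap gi fi measurable_dotp).
congr cint; apply/funext => x; congr (_ * _); congr cint.
by apply/funext => y /=; rewrite dotpC.
Qed.

Lemma cmeas_translate2 f : cmeas f -> cmeas (fun z : V * V => f (z.1 - z.2)).
Proof.
move=> mf; have mt : measurable_fun setT (fun z : V * V => z.1 - z.2).
  apply/measurable_fun_rVP => i; under eq_fun do rewrite !mxE.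
  apply: measurable_funB.
    exact: (measurableT_comp (measurable_rV_coord (T := measurableTypeR R) i) measurable_fst).
  exact: (measurableT_comp (measurable_rV_coord (T := measurableTypeR R) i) measurable_snd).
by have [] := cmeas_comp mt mf.
Qed.

Lemma cmeas_translate f y : cmeas f -> cmeas (fun x => f (x - y)).
Proof. by move=> mf; exact: (cmeas_comp (pair2_measurable y) (cmeas_translate2 mf)). Qed.

Lemma cmeas_reflect f x : cmeas f -> cmeas (fun y => f (x - y)).
Proof. by move=> mf; exact: (cmeas_comp (pair1_measurable x) (cmeas_translate2 mf)). Qed.

(** Multiplication by psi on the Fourier side is convolution with its inverse
    transform, by an exchange of integrals.  The map h stands for a translation
    or a reflection. *)
Lemma cint_swap_inv psi g (h : V -> V) : measurable_fun setT h ->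
  cintg mu psi -> cintg mu g -> ((2 * pi) ^- n)%:C *
    cint mu (fun xi => psi xi * cint mu (fun y => cexpi (dotp (h y) xi) * g y)) =
  cint mu (fun y => g y * fourier_inv psi (h y)).
Proof.
move=> mh ip ig; pose e (z : V * V) : R := dotp (h z.2) z.1.
have me : measurable_fun setT e.
  have mp : measurable_fun setT (fun z : V * V => (h z.2, z.1)).
    apply/measurable_fun_pairP.
    by split; [exact: (measurableT_comp mh measurable_snd)|exact: measurable_fst].
  exact: (measurableT_comp measurable_dotp mp).
have mK : cmeas (fun y => cint mu (fun xi => cexpi (dotp (h y) xi) * psi xi)).
  exact: (cmeas_comp mh (cmeas_unnormalized_inv (cintg_cmeas ip))).
rewrite (cint_swap ip ig me).
exact: esym (cintZ_bounded _ mK (fun y => cabs_phase_le (measurable_dotp2 (h y)) ip) ig).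
Qed.

Lemma fourier_mul_inv psi phi y : cintg mu psi -> cintg mu phi ->
  fourier (fun xi => psi xi * fourier_inv phi xi) y =
  cint mu (fun x => phi x * fourier_inv psi (x - y)).
Proof.
move=> ip iphi; have mh : measurable_fun setT (fun x : V => x - y).
  apply/measurable_fun_rVP => i; under eq_fun do rewrite !mxE.
  by apply: measurable_funB => //; exact: measurable_rV_coord.
rewrite -(cint_swap_inv mh ip iphi).
have mJ : cmeas (fun xi => cint mu (fun x => cexpi (dotp (x - y) xi) * phi x)).
  apply: (@cmeas_cint_param _ _ _ _ _ mu (fun z : V * V => cexpi (dotp (z.2 - y) z.1) * phi z.2)).
  apply: cmeasM; last by apply: cmeas_snd; exact: cintg_cmeas iphi.
  have mp : measurable_fun setT (fun z : V * V => (z.2 - y, z.1)).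
    apply/measurable_fun_pairP.
    by split; [exact: (measurableT_comp mh measurable_snd)|exact: measurable_fst].
  exact: cmeas_cexpi (measurableT_comp measurable_dotp mp).
have mp xi : measurable_fun setT (fun x : V => dotp (x - y) xi).
  exact: (measurableT_comp (measurable_dotp1 xi) mh).
rewrite -(cintZ_bounded _ mJ (fun xi => cabs_phase_le (mp xi) iphi) ip).
congr cint; apply/funext => xi; rewrite mulrCA; congr (_ * _).
rewrite /fourier_inv mulrCA; congr (_ * _); rewrite -cintZ; last first.
  by apply: cintg_cexpi => //; exact: measurable_dotp2.
congr cint; apply/funext => x; rewrite mulrA -cexpiD; congr (cexpi _ * _).
by rewrite dotpBl (dotpC x) (dotpC y) addrC.
Qed.

Lemma fourier_inv_mul psi g x : cintg mu psi -> cintg mu g ->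
  fourier_inv (fun xi => psi xi * fourier g xi) x =
  cint mu (fun y => g y * fourier_inv psi (x - y)).
Proof.
move=> ip ig; rewrite -(cint_swap_inv (h := fun y => x - y) _ ip ig); last first.
  apply/measurable_fun_rVP => i; under eq_fun do rewrite !mxE.
  by apply: measurable_funB => //; exact: measurable_rV_coord.
congr (_ * _); congr cint; apply/funext => xi; rewrite mulrCA; congr (_ * _).
rewrite -cintZ; last first.
  by apply: cintg_cexpi => //; apply: measurableT_comp => //; exact: measurable_dotp1.
by congr cint; apply/funext => y; rewrite mulrA -cexpiD dotpBl.
Qed.

End fourier_L1.

(** * Gaussians on R^n *)

Section gaussian.
Variables (R : realType) (n : nat).
Local Notation C := R[i].
Local Notation V := 'rV[R]_n.
Local Notation mu := (lebesgue_rV R n).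
Implicit Types (s : R) (x y xi eta a m : V) (theta : V -> C).

Definition gaussn s m x : R := \prod_(i < n) normal_fun (m ord0 i) s (x ord0 i).

Definition qdist x y : R := \sum_(i < n) (x ord0 i - y ord0 i) ^+ 2.

(** The Schwartz functions against which distributions are tested: a
    Gaussian of width s in x, modulated so that its inverse transform, of width
    1/s, is centred at a. *)
Definition gauss_wave s a x : C := cexpi (- dotp a x) * (gaussn s 0 x)%:C.

(** The maximum of the inverse Fourier transform of [gauss_wave s a], which by
    [gauss_cstV] has integral 1. *)
Definition gauss_cst s : R := (2 * pi) ^- n * (Num.sqrt (2 * pi) * s) ^+ n.

Lemma dotpNl x y : dotp (- x) y = - dotp x y.
Proof. by rewrite /dotp -sumrN; apply: eq_bigr => i _; rewrite mxE mulNr. Qed.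

Lemma qdist_ge0 x y : 0 <= qdist x y.
Proof. by apply: sumr_ge0 => i _; exact: sqr_ge0. Qed.

Lemma gaussnE s m x : gaussn s m x = expR (- qdist x m / (s ^+ 2 *+ 2)).
Proof.
rewrite /gaussn /normal_fun -expR_sum; congr expR.
rewrite -mulr_suml; congr (_ / _).
by rewrite /qdist -sumrN.
Qed.

Lemma gaussn_gt0 s m x : 0 < gaussn s m x.
Proof. by rewrite gaussnE expR_gt0. Qed.

Lemma gaussn_le1 s m x : gaussn s m x <= 1.
Proof.
rewrite gaussnE -expR0 ler_expR mulNr oppr_le0 divr_ge0 ?qdist_ge0//.
by rewrite mulrn_wge0// sqr_ge0.
Qed.

Lemma gaussn_shift s a x : gaussn s 0 (x - a) = gaussn s a x.
Proof.
rewrite !gaussnE; suff -> : qdist (x - a) 0 = qdist x a by [].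
by apply: eq_bigr => i _; rewrite !mxE subr0.
Qed.

Lemma gaussn_sym s a x : gaussn s 0 (a - x) = gaussn s a x.
Proof.
rewrite !gaussnE; suff -> : qdist (a - x) 0 = qdist x a by [].
by apply: eq_bigr => i _; rewrite !mxE subr0; ring.
Qed.

Lemma measurable_gaussn s m : measurable_fun setT (gaussn s m).
Proof.
apply: measurable_prod => i _.
exact: (measurableT_comp (measurable_normal_fun _ _) (measurable_rV_coord (T := measurableTypeR R) i)).
Qed.

Lemma gaussn_integral s m : 0 < s -> mu.-integrable setT (EFin \o gaussn s m) /\
  \int[mu]_x gaussn s m x = (Num.sqrt (2 * pi) * s) ^+ n.
Proof.
move=> s0; have [h1 h2] := @Rint_prod R n (fun i => normal_fun (m ord0 i) s)
  (fun i => proj1 (integral_normal_fun (m ord0 i) s0)).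
split; first exact: h1.
rewrite h2; under eq_bigr do rewrite (proj2 (integral_normal_fun _ s0)).
by rewrite prodr_const card_ord.
Qed.

Lemma cint_cexpi_gaussn s m xi : 0 < s ->
  cintg mu (fun x => cexpi (dotp xi x) * (gaussn s m x)%:C) /\
  cint mu (fun x => cexpi (dotp xi x) * (gaussn s m x)%:C) =
  cexpi (dotp xi m) * ((Num.sqrt (2 * pi) * s) ^+ n * gaussn s^-1 0 xi)%:C.
Proof.
move=> s0; have [h1 h2] := @cint_prod R n
  (fun i t => cexpi (xi ord0 i * t) * (normal_fun (m ord0 i) s t)%:C)
  (fun i => proj1 (cint_cexpi_normal_fun (m ord0 i) (xi ord0 i) s0)).
have E : (fun x : V => \prod_(i < n) (cexpi (xi ord0 i * x ord0 i) * (normal_fun (m ord0 i) s (x ord0 i))%:C))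
    = (fun x => cexpi (dotp xi x) * (gaussn s m x)%:C).
  by apply/funext => x; rewrite big_split/= -cexpi_sum -RC_prod.
rewrite E in h1 h2; split => //; rewrite h2.
under eq_bigr do rewrite (proj2 (cint_cexpi_normal_fun _ _ s0)).
rewrite big_split/= -cexpi_sum -RC_prod; congr (_ * (_%:C)).
rewrite big_split/= prodr_const card_ord; congr (_ * _).
by apply: eq_bigr => i _; rewrite mxE.
Qed.

Lemma cintg_gauss_wave s a : 0 < s -> cintg mu (gauss_wave s a).
Proof.
move=> s0; have [h _] := cint_cexpi_gaussn 0 (- a) s0.
move: h; congr (cintg _ _); apply/funext => x; congr (cexpi _ * _).
by rewrite dotpNl.
Qed.

Lemma gauss_cst_gt0 s : 0 < s -> 0 < gauss_cst s.
Proof.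
move=> s0; rewrite mulr_gt0 ?two_pi_gt0 ?exprn_gt0// mulr_gt0// sqrtr_gt0.
by rewrite mulr_gt0// pi_gt0.
Qed.

Lemma gauss_cstV s : 0 < s -> gauss_cst s * (Num.sqrt (2 * pi) * s^-1) ^+ n = 1.
Proof.
move=> s0; have s1 : s != 0 by rewrite gt_eqF.
have p0 : 0 < 2 * pi :> R by rewrite mulr_gt0// pi_gt0.
rewrite /gauss_cst -mulrA -exprMn (_ : _ * _ * _ = 2 * pi).
  by rewrite mulVf// expf_neq0// gt_eqF.
rewrite mulrACA divff// mulr1 -expr2 sqr_sqrtr//; exact: ltW.
Qed.

Lemma fourier_inv_gauss_wave s a : 0 < s ->
  fourier_inv (gauss_wave s a) = (fun xi => (gauss_cst s * gaussn s^-1 a xi)%:C).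
Proof.
move=> s0; apply/funext => xi; rewrite /fourier_inv.
have [_ h] := cint_cexpi_gaussn 0 (xi - a) s0.
rewrite (_ : cintegral _ = cint mu (fun x => cexpi (dotp (xi - a) x) * (gaussn s 0 x)%:C)).
  rewrite h (_ : dotp _ 0 = 0) ?cexpi0 ?mul1r; last first.
    by rewrite /dotp big1// => i _; rewrite [X in _ * X]mxE mulr0.
  by rewrite gaussn_shift -RCM mulrA.
congr cint; apply/funext => x; by rewrite dotpBl cexpiD -mulrA.
Qed.

Lemma cintg_fourier_inv_gauss_wave s a : 0 < s ->
  cintg mu (fourier_inv (gauss_wave s a)).
Proof.
move=> s0; rewrite fourier_inv_gauss_wave//; split; last exact: integrable0.
have s1 : 0 < s^-1 by rewrite invr_gt0.
have := integrableZl measurableT (gauss_cst s) (proj1 (gaussn_integral a s1)).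
by apply: eq_integrable.
Qed.

(** An explicit case of Fourier inversion; combined with exchanges of integrals
    it replaces the general theorem. *)
Lemma fourierK_gauss_wave s a : 0 < s ->
  fourier (fourier_inv (gauss_wave s a)) = gauss_wave s a.
Proof.
move=> s0; have s1 : 0 < s^-1 by rewrite invr_gt0.
rewrite fourier_inv_gauss_wave//; apply/funext => x; rewrite /fourier.
have [h1 h2] := cint_cexpi_gaussn a (- x) s1.
rewrite (_ : cintegral _ = cint mu (fun xi => (gauss_cst s)%:C * (cexpi (dotp (- x) xi) * (gaussn s^-1 a xi)%:C))).
  rewrite cintZ// h2 invrK.
  rewrite dotpNl dotpC /gauss_wave mulrCA; congr (_ * _).
  rewrite -RCM mulrA gauss_cstV// mul1r.
  by rewrite -[- x]sub0r gaussn_sym.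
congr cint; apply/funext => xi; rewrite RCM mulrCA; congr (_ * (cexpi _ * _)).
by rewrite dotpNl dotpC.
Qed.

(** Apply exp t >= t to t = y / (k + 1) and raise to the power k + 1. *)
Lemma expRN_le (k : nat) (y : R) : 0 < y -> expR (- y) <= (k.+1%:R / y) ^+ k.+1.
Proof.
move=> y0; have y1 : 0 < y / k.+1%:R by rewrite divr_gt0.
rewrite expRN -invf_div exprVn lef_pV2 ?posrE ?exprn_gt0 ?expR_gt0//.
have -> : expR y = expR (y / k.+1%:R) ^+ k.+1 by rewrite -expRM_natr divfK.
rewrite lerXn2r ?nnegrE ?expR_ge0// ?ltW//.
by apply: lt_le_trans (expR_ge1Dx _); rewrite ltrDr.
Qed.

Lemma cvg_harmonic_bound (u : nat -> R) (A : R) :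
  (forall k, `|u k| <= A / k.+1%:R) -> u @ \oo --> (0 : R).
Proof.
move=> h; apply: norm_cvg0.
have hA : (fun k => A * harmonic k) @ \oo --> (A * 0 : R).
  by apply: cvgMr; exact: cvg_harmonic.
rewrite mulr0 in hA; apply: (squeeze_cvgr _ (cvg_cst 0) hA).
by apply: nearW => k; rewrite normr_ge0/=; exact: h.
Qed.

(** Away from the support of theta, the transform of its inverse transform
    vanishes: a Gaussian cut-off of width k in x replaces theta by its average
    against a Gaussian of width 1/k, which is tiny there. *)
Lemma fourier_fourier_inv_eq0 theta xi (d : R) : cintg mu theta ->
  cintg mu (fourier_inv theta) -> 0 < d ->
  (forall eta, theta eta != 0 -> d <= qdist eta xi) ->
  fourier (fourier_inv theta) xi = 0.
Proof.
move=> it ii d0 far.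
pose F (k : nat) x := fourier_inv theta x * gauss_wave k.+1%:R xi x.
pose f x := cexpi (- dotp x xi) * fourier_inv theta x.
have mi := cintg_cmeas ii.
have mF k : cmeas (F k).
  apply: cmeasM => //; apply: cintg_cmeas; exact: cintg_gauss_wave.
have mf : cmeas f.
  by apply: cmeas_phase => //; apply: measurableT_comp => //; exact: measurable_dotp1.
have Fg k x : cabs (F k x) <= cabs (fourier_inv theta x).
  rewrite /F /gauss_wave; move: (fourier_inv theta x) => w.
  rewrite !cabsM cabs_cexpi mul1r cabs_real gtr0_norm ?gaussn_gt0//.
  by apply: ler_piMr; [exact: cabs_ge0|exact: gaussn_le1].
have Ff x : (fun k => cabs (F k x - f x)) @ \oo --> (0 : R).
  apply: (@cvg_harmonic_bound _ (cabs (fourier_inv theta x) * qdist x 0)) => k.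
  rewrite /F /f /gauss_wave; move: (fourier_inv theta x) => w.
  have -> : w * (cexpi (- dotp xi x) * (gaussn k.+1%:R 0 x)%:C) - cexpi (- dotp x xi) * w
    = cexpi (- dotp x xi) * w * (gaussn k.+1%:R 0 x - 1)%:C.
    by rewrite dotpC rmorphB/=; ring.
  rewrite ger0_norm ?cabs_ge0// cabsM -mulrA cabs_real.
  rewrite cabsM cabs_cexpi mul1r ler_wpM2l ?cabs_ge0//.
  rewrite ler0_norm ?subr_le0 ?gaussn_le1// opprB gaussnE.
  have := expR_ge1Dx (- qdist x 0 / (k.+1%:R ^+ 2 *+ 2)).
  rewrite mulNr => h0.
  apply: (@le_trans _ _ (qdist x 0 / (k.+1%:R ^+ 2 *+ 2))).
    by rewrite lerBlDr addrC -lerBlDr.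
  rewrite ler_wpM2l ?qdist_ge0// lef_pV2 ?posrE ?mulrn_wgt0 ?exprn_gt0//.
  have : 1 <= k.+1%:R :> R by rewrite ler1n.
  by rewrite -mulr_natr; move: (k.+1%:R : R) => s s1; nra.
have h1 := cint_cvg mF mf (cintg_cabs ii) Fg Ff.
pose I := \int[mu]_x cabs (theta x).
have I0 : 0 <= I by apply: Rintegral_ge0 => x _; exact: cabs_ge0.
pose A := 2 * I * gauss_cst 1 * (n.+1%:R / (d / 2)) ^+ n.+1.
have h2 k : cabs (cint mu (F k)) <= A / k.+1%:R.
  have [s sE] : exists s : R, s = k.+1%:R by exists k.+1%:R.
  have s0 : 0 < s by rewrite sE.
  have sge1 : 1 <= s by rewrite sE ler1n.
  rewrite -sE.
  have s1 : s != 0 by rewrite gt_eqF.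
  have -> : cint mu (F k) = cint mu (fun x => theta x * fourier_inv (gauss_wave s xi) x).
    rewrite -(fourier_inv_swap it (cintg_gauss_wave xi s0)).
    by congr cint; apply/funext => x; rewrite /F -sE mulrC.
  rewrite fourier_inv_gauss_wave//.
  have K0 := gauss_cst_gt0 s0.
  pose B := gauss_cst s * expR (- (d * s ^+ 2 / 2)).
  apply: (@le_trans _ _ (2 * \int[mu]_x (B * cabs (theta x)))).
    apply: cint_le_dom.
    - apply: cmeasM; first exact: cintg_cmeas it.
      by apply: cmeas_real; apply: measurable_funM => //; exact: measurable_gaussn.
    - exact: (integrableZ _ (cintg_cabs it)).
    - move=> eta; rewrite cabsM mulrC.
      have [->|t0] := eqVneq (theta eta) 0; first by rewrite cabs0 !mulr0.
      rewrite ler_wpM2r ?cabs_ge0// cabs_real ger0_norm; last first.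
        by apply: mulr_ge0; apply: ltW => //; exact: gaussn_gt0.
      rewrite ler_wpM2l ?(ltW K0)// gaussnE ler_expR mulNr lerN2.
      have -> : (s^-1 ^+ 2 *+ 2)^-1 = s ^+ 2 / 2 by field.
      rewrite -mulrA.
      by rewrite ler_wpM2r ?far// divr_ge0// sqr_ge0.
  rewrite RintegralZl//; last exact: cintg_cabs.
  rewrite -/I /A /B.
  have -> : gauss_cst s = gauss_cst 1 * s ^+ n.
    by rewrite /gauss_cst mulr1 -mulrA -exprMn.
  have e1 : expR (- (d * s ^+ 2 / 2)) <= (n.+1%:R / (d / 2)) ^+ n.+1 / (s ^+ 2) ^+ n.+1.
    have y0 : 0 < d * s ^+ 2 / 2 by rewrite divr_gt0// mulr_gt0// exprn_gt0.
    apply: le_trans (expRN_le n y0) _.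
    rewrite -exprVn -exprMn le_eqVlt; apply/orP; left; apply/eqP; congr (_ ^+ _).
    by field; rewrite s1 gt_eqF.
  (* The averaging Gaussian has height of order s^n, which its tail, of order
     s^-(2n+2) at distance sqrt d, beats. *)
  have e2 : s ^+ n * expR (- (d * s ^+ 2 / 2)) <= (n.+1%:R / (d / 2)) ^+ n.+1 / s.
    apply: (@le_trans _ _ (s ^+ n * ((n.+1%:R / (d / 2)) ^+ n.+1 / (s ^+ 2) ^+ n.+1))).
      by rewrite ler_wpM2l// exprn_ge0// ltW.
    rewrite mulrCA; apply: ler_wpM2l.
      by rewrite exprn_ge0// divr_ge0// divr_ge0// ltW.
    rewrite ler_pdivrMr ?exprn_gt0// mulrC -exprM.
    rewrite (_ : (2 * n.+1 = n + n.+2)%N); last by rewrite mul2n -addnn addSnnS.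
    rewrite exprD -mulrA ler_peMr ?exprn_ge0 ?(ltW s0)// exprSr mulfK//.
    exact: exprn_ege1.
  rewrite -[leRHS]mulrA (_ : 2 * _ = 2 * I * gauss_cst 1 * (s ^+ n * expR (- (d * s ^+ 2 / 2)))); last by ring.
  apply: ler_wpM2l e2; apply: mulr_ge0; first exact: mulr_ge0.
  exact: ltW (gauss_cst_gt0 ltr01).
suff : cabs (cint mu f) = 0.
  by move/complex.ComplexField.Normc.eq0_normc.
apply/eqP; rewrite eq_le cabs_ge0 andbT; apply/ler_addgt0Pr => e e0; rewrite add0r.
have e2 : 0 < e / 2 by rewrite divr_gt0.
have h3 : (fun k => cabs (cint mu (F k))) @ \oo --> (0 : R).
  by apply: (@cvg_harmonic_bound _ A) => k; rewrite ger0_norm ?cabs_ge0.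
move/cvgrPdist_lt : h1 => /(_ _ e2)[k1 _ H1].
move/cvgrPdist_lt : h3 => /(_ _ e2)[k2 _ H2].
set N := maxn k1 k2.
have a1 : cabs (cint mu (F N) - cint mu f) < e / 2.
  by have := H1 N (leq_maxl _ _); rewrite sub0r normrN ger0_norm ?cabs_ge0.
have a2 : cabs (cint mu (F N)) < e / 2.
  by have := H2 N (leq_maxr _ _); rewrite sub0r normrN ger0_norm ?cabs_ge0.
have := cabsB (cint mu (F N)) (cint mu (F N) - cint mu f).
rewrite opprB addrC subrK.
move: (cabs _) (cabs _) (cabs _) a1 a2 => u v w; lra.
Qed.

End gaussian.

(** * Partial derivatives of complex functions *)

Section calculus.
Variables (R : realType) (n : nat).
Local Notation C := R[i].
Local Notation V := 'rV[R]_n.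
Implicit Types (f g : V -> C) (h : V -> R) (x v : V) (i j : 'I_n).

Definition cdiff f := forall x, differentiable (fun y => complex.Re (f y)) x /\
  differentiable (fun y => complex.Im (f y)) x.

Lemma derive_chain (g : R -> R) h x v (dg : R) : differentiable h x ->
  is_derive (h x) 1 g dg ->
  differentiable (fun y => g (h y)) x /\ 'D_v (fun y => g (h y)) x = dg * 'D_v h x.
Proof.
move=> dh ig.
have dg' : differentiable g (h x) by apply/derivable1_diffP.
have dc : differentiable (g \o h) x by exact: differentiable_comp.
split; first exact: dc.
rewrite -[LHS]/('D_v (g \o h) x) (deriveE _ dc) diff_comp//= (deriveE _ dh).
rewrite deriv1E; last by apply/derivable1_diffP.
by rewrite derive1E derive_val/= mulrC.
Qed.

Lemma derive_coord x i j :
  'D_(delta_mx ord0 i) (fun y : V => y ord0 j) x = (i == j)%:R.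
Proof.
have @f : {linear V -> R}.
  by exists (fun N : V => N ord0 j); do 2![eexists]; do ?[constructor];
     rewrite ?mxE// => ? *; rewrite ?mxE//; move=> ?; rewrite !mxE.
rewrite -[LHS]/('D_(delta_mx ord0 i) f x) deriveE; last first.
  exact/linear_differentiable/coord_continuous.
by rewrite diff_lin; [rewrite /= mxE eqxx eq_sym|exact: coord_continuous].
Qed.

Lemma cdiff_Re_derivable f x v : cdiff f -> derivable (fun y => complex.Re (f y)) x v.
Proof. by move=> df; apply: diff_derivable; case: (df x). Qed.

Lemma cdiff_Im_derivable f x v : cdiff f -> derivable (fun y => complex.Im (f y)) x v.
Proof. by move=> df; apply: diff_derivable; case: (df x). Qed.

Lemma ReM_fun f g : (fun y => complex.Re (f y * g y)) =
  (fun y => complex.Re (f y)) * (fun y => complex.Re (g y)) -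
  (fun y => complex.Im (f y)) * (fun y => complex.Im (g y)).
Proof. by apply/funext => y; rewrite ReM. Qed.

Lemma ImM_fun f g : (fun y => complex.Im (f y * g y)) =
  (fun y => complex.Re (f y)) * (fun y => complex.Im (g y)) +
  (fun y => complex.Im (f y)) * (fun y => complex.Re (g y)).
Proof. by apply/funext => y; rewrite ImM. Qed.

Lemma cdiffD f g : cdiff f -> cdiff g -> cdiff (fun x => f x + g x).
Proof.
move=> df dg x; have [f1 f2] := df x; have [g1 g2] := dg x; split.
  by under eq_fun do rewrite ReD; exact: differentiableD.
by under eq_fun do rewrite ImD; exact: differentiableD.
Qed.

Lemma cdiffM f g : cdiff f -> cdiff g -> cdiff (fun x => f x * g x).
Proof.
move=> df dg x; have [f1 f2] := df x; have [g1 g2] := dg x; split.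
  by rewrite ReM_fun; apply: differentiableB; exact: differentiableM.
by rewrite ImM_fun; apply: differentiableD; exact: differentiableM.
Qed.

Lemma cdiff_cst (c : C) : cdiff (fun=> c).
Proof. by move=> x; split; exact: differentiable_cst. Qed.

Lemma cdiff_real h : (forall x, differentiable h x) -> cdiff (fun x => (h x)%:C).
Proof. by move=> dh x; split => /=; [exact: dh|exact: differentiable_cst]. Qed.

Lemma cdiff_cexpi h : (forall x, differentiable h x) -> cdiff (fun x => cexpi (h x)).
Proof.
move=> dh x; split => /=.
  exact: (proj1 (derive_chain 0 (dh x) (is_derive_cos _))).
exact: (proj1 (derive_chain 0 (dh x) (is_derive_sin _))).
Qed.

Lemma cpartialD i f g x : cdiff f -> cdiff g ->
  cpartial i (fun y => f y + g y) x = cpartial i f x + cpartial i g x.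
Proof.
move=> df dg; apply: complex_eqP; rewrite ?ReD ?ImD/=.
  by under eq_fun do rewrite ReD; rewrite deriveD//; exact: cdiff_Re_derivable.
by under eq_fun do rewrite ImD; rewrite deriveD//; exact: cdiff_Im_derivable.
Qed.

Lemma cpartialM i f g x : cdiff f -> cdiff g ->
  cpartial i (fun y => f y * g y) x = cpartial i f x * g x + f x * cpartial i g x.
Proof.
move=> df dg; pose v : V := delta_mx ord0 i.
have f1 : derivable (fun y => complex.Re (f y)) x v by exact: cdiff_Re_derivable.
have f2 : derivable (fun y => complex.Im (f y)) x v by exact: cdiff_Im_derivable.
have g1 : derivable (fun y => complex.Re (g y)) x v by exact: cdiff_Re_derivable.
have g2 : derivable (fun y => complex.Im (g y)) x v by exact: cdiff_Im_derivable.
rewrite /cpartial -/v.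
rewrite ReM_fun ImM_fun.
rewrite (deriveB (derivableM f1 g1) (derivableM f2 g2)).
rewrite (deriveM f1 g1) (deriveM f2 g2).
rewrite (deriveD (derivableM f1 g2) (derivableM f2 g1)).
rewrite (deriveM f1 g2) (deriveM f2 g1).
by apply: complex_eqP; rewrite ?ReD ?ImD ?ReM ?ImM /GRing.scale/=; ring.
Qed.

Lemma cpartial_cst i (c : C) x : cpartial i (fun=> c) x = 0.
Proof. by rewrite /cpartial !derive_cst. Qed.

Lemma cpartial_real i h x : cpartial i (fun y => (h y)%:C) x =
  ('D_(delta_mx ord0 i) h x)%:C.
Proof. by rewrite /cpartial/= derive_cst. Qed.

Lemma cpartial_cexpi i h x : differentiable h x ->
  cpartial i (fun y => cexpi (h y)) x =
  (0 +i* 'D_(delta_mx ord0 i) h x) * cexpi (h x).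
Proof.
move=> dh; apply: complex_eqP; rewrite ?ReM ?ImM/=.
  by rewrite (proj2 (derive_chain _ dh (is_derive_cos _))); ring.
by rewrite (proj2 (derive_chain _ dh (is_derive_sin _))); ring.
Qed.

Lemma differentiable_dotp a x : differentiable (fun y : V => dotp a y) x.
Proof.
rewrite (_ : (fun y => _) = \sum_(i < n) (fun y : V => a ord0 i * y ord0 i)).
  apply: differentiable_sum => i; apply: differentiableM.
    exact: differentiable_cst.
  exact: differentiable_coord.
by apply/funext => y; rewrite fct_sumE.
Qed.

Lemma derive_dotp a x i :
  'D_(delta_mx ord0 i) (fun y : V => dotp a y) x = a ord0 i.
Proof.
have dc j : derivable (fun y : V => y ord0 j) x (delta_mx ord0 i).
  exact/diff_derivable/differentiable_coord.
rewrite (_ : (fun y => _) = \sum_(i < n) (a ord0 i *: (fun y : V => y ord0 i))); last first.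
  by apply/funext => y; rewrite fct_sumE.
rewrite derive_sum; last by move=> j; exact: derivableZ.
under eq_bigr do rewrite deriveZ// derive_coord.
rewrite (bigD1 i)//= eqxx big1 ?addr0 /GRing.scale/= ?mulr1// => j ji.
by rewrite eq_sym (negbTE ji) mulr0.
Qed.

End calculus.

(** * Schwartz functions *)

Section schwartz.
Variables (R : realType) (n : nat).
Local Notation C := R[i].
Local Notation V := 'rV[R]_n.
Local Notation mu := (lebesgue_rV R n).
Implicit Types (f phi P : V -> C) (x a : V) (i j : 'I_n).

Lemma mderiv0 phi : mderiv (fun=> 0%N) phi = phi.
Proof.
rewrite /mderiv (_ : flatten _ = [::])//.
by elim: (enum 'I_n) => //= i s ->.
Qed.

Lemma cabs_le_schwartz_norm N phi alpha beta x :
  (mlen alpha <= N)%N -> (mlen beta <= N)%N ->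
  ((`|mpow x beta| * cabs (mderiv alpha phi x))%:E <= schwartz_norm N phi)%E.
Proof.
move=> aN bN; apply: ereal_sup_ubound; exists alpha, beta, x; split => //.
by rewrite cabsM cabs_real.
Qed.

Lemma mpow0 x : mpow x (fun=> 0%N) = 1.
Proof. by rewrite /mpow big1. Qed.

Lemma mlen0 : mlen (fun _ : 'I_n => 0%N) = 0%N.
Proof. by rewrite /mlen big1. Qed.

Lemma cabs_le_schwartz_norm0 phi x : ((cabs (phi x))%:E <= schwartz_norm 0 phi)%E.
Proof.
have := @cabs_le_schwartz_norm 0 phi (fun=> 0%N) (fun=> 0%N) x.
by rewrite mpow0 mderiv0 normr1 mul1r; apply; rewrite mlen0.
Qed.

Lemma schwartz_norm_ge0 N phi : (0 <= schwartz_norm N phi)%E.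
Proof.
have := @cabs_le_schwartz_norm N phi (fun=> 0%N) (fun=> 0%N) 0.
rewrite mlen0 => /(_ isT isT); apply: le_trans.
by rewrite lee_fin mulr_ge0 ?cabs_ge0.
Qed.

Lemma schwartz_norm_fin N phi : schwartz phi -> schwartz_norm N phi \is a fin_num.
Proof. by move=> [_ /(_ N) h]; rewrite ge0_fin_numE// schwartz_norm_ge0. Qed.

Lemma schwartz_bound N phi : schwartz phi -> exists2 M : R, 0 <= M &
  forall alpha beta x, (mlen alpha <= N)%N -> (mlen beta <= N)%N ->
  `|mpow x beta| * cabs (mderiv alpha phi x) <= M.
Proof.
move=> sp; exists (fine (schwartz_norm N phi)).
  by rewrite fine_ge0// schwartz_norm_ge0.
move=> alpha beta x aN bN; rewrite -lee_fin fineK; last exact: schwartz_norm_fin.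
exact: cabs_le_schwartz_norm.
Qed.

Lemma csmooth_cdiff f (s : seq 'I_n) : csmooth f -> cdiff (cpartials s f).
Proof. by move=> sf x; exact: sf. Qed.

Lemma cdiff_cmeas f : cdiff f -> cmeas f.
Proof.
move=> df; split; apply: rV_continuous_measurable => x;
  by apply: differentiable_continuous; case: (df x).
Qed.

Lemma cmeas_schwartz phi : schwartz phi -> cmeas phi.
Proof. by move=> [sp _]; apply: cdiff_cmeas; exact: (@csmooth_cdiff _ [::]). Qed.

(** Decay in every direction at once follows from decay of single monomials:
    at a given point only the coordinates larger than 1 are kept. *)
Lemma prod1Dsqr_le (t : 'I_n -> R) : \prod_i (1 + t i ^+ 2) <=
  2 ^+ n * \prod_i t i ^+ (if 1 < t i ^+ 2 then 2 else 0).
Proof.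
have -> : 2 ^+ n = \prod_(i < n) (2 : R) by rewrite prodr_const card_ord.
rewrite -big_split/=; apply: ler_prod => i _.
rewrite addr_ge0 ?sqr_ge0//=; case: ltP => h.
  by move: (t i ^+ 2) h => u h; lra.
by rewrite expr0; move: (t i ^+ 2) h => u h; lra.
Qed.

Definition ckerneln (s : R) (y x : V) : R := \prod_i ckernel s (y ord0 i) (x ord0 i).

Lemma ckerneln_ge0 s y x : 0 <= s -> 0 <= ckerneln s y x.
Proof. by move=> s0; apply: prodr_ge0 => i _; exact: ckernel_ge0. Qed.

Lemma ckerneln_integral s y : 0 < s -> mu.-integrable setT (EFin \o ckerneln s y) /\
  \int[mu]_x ckerneln s y x = pi ^+ n.
Proof.
move=> s0; have [h1 h2] := @Rint_prod R n (fun i => ckernel s (y ord0 i))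
  (fun i => ckernel_integrable (y ord0 i) s0).
split; first exact: h1.
have -> : pi ^+ n = \prod_(i < n) (pi : R) by rewrite prodr_const card_ord.
rewrite h2; apply: eq_bigr => i _.
by rewrite /Rintegral ckernel_integral.
Qed.

Lemma schwartz_decay phi : schwartz phi -> exists2 M : R, 0 <= M &
  forall x, cabs (phi x) <= M * ckerneln 1 0 x.
Proof.
move=> sp; have [M M0 hM] := schwartz_bound (2 * n) sp.
exists (2 ^+ n * M); first by rewrite mulr_ge0// exprn_ge0.
move=> x; set k := ckerneln 1 0 x.
have kE : k = (\prod_i (1 + x ord0 i ^+ 2))^-1.
  rewrite -prodfV; apply: eq_bigr => i _.
  by rewrite /ckernel mxE subr0 !mul1r.
have p0 : 0 < \prod_i (1 + x ord0 i ^+ 2).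
  by apply: prodr_gt0 => i _; rewrite ltr_wpDr// sqr_ge0.
rewrite kE ler_pdivlMr// mulrC.
apply: le_trans (ler_wpM2r (cabs_ge0 _) (prod1Dsqr_le (fun i => x ord0 i))) _.
rewrite -mulrA ler_wpM2l ?exprn_ge0//.
(* Squares of the coordinates larger than 1: degree at most 2 n. *)
pose b (i : 'I_n) := if 1 < x ord0 i ^+ 2 then 2%N else 0%N.
have := hM (fun=> 0%N) b x; rewrite mderiv0 mlen0 => /(_ isT).
have bN : (mlen b <= 2 * n)%N.
  rewrite mulnC -[X in (_ <= X * _)%N]card_ord -sum_nat_const; apply: leq_sum => i _.
  by rewrite /b; case: ifP.
move=> /(_ bN); apply: le_trans; rewrite ler_wpM2r ?cabs_ge0//.
exact: ler_norm.
Qed.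

Lemma cintg_decay f (M s : R) : 0 < s -> cmeas f ->
  (forall x, cabs (f x) <= M * ckerneln s 0 x) -> cintg mu f.
Proof.
move=> s0 mf fM; apply: cintg_le mf _ fM.
have := integrableZl measurableT M (proj1 (ckerneln_integral 0 s0)).
by apply: eq_integrable.
Qed.

Lemma cintg_schwartz phi : schwartz phi -> cintg mu phi.
Proof.
move=> sp; have [M _ hM] := schwartz_decay sp.
exact: cintg_decay ltr01 (cmeas_schwartz sp) hM.
Qed.

(** Polynomial functions: the prefactors that appear when a Gaussian is
    differentiated. *)
Inductive cpoly : (V -> C) -> Prop :=
| cpoly_cst c : cpoly (fun=> c)
| cpoly_coord i : cpoly (fun x => (x ord0 i)%:C)
| cpolyD P Q : cpoly P -> cpoly Q -> cpoly (fun x => P x + Q x)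
| cpolyM P Q : cpoly P -> cpoly Q -> cpoly (fun x => P x * Q x).

Lemma cpoly_cdiff P : cpoly P -> cdiff P.
Proof.
elim=> [c|i|? ? ? ? ? ?|? ? ? ? ? ?]; [exact: cdiff_cst| |exact: cdiffD|exact: cdiffM].
by apply: cdiff_real => x; exact: differentiable_coord.
Qed.

Lemma cpoly_cpartial P i : cpoly P -> cpoly (cpartial i P).
Proof.
elim=> [c|j|f g pf IHf pg IHg|f g pf IHf pg IHg].
- rewrite (_ : cpartial _ _ = fun=> 0); first exact: cpoly_cst.
  by apply/funext => x; exact: cpartial_cst.
- rewrite (_ : cpartial _ _ = fun=> (i == j)%:R%:C); first exact: cpoly_cst.
  by apply/funext => x; rewrite cpartial_real derive_coord.
- rewrite (_ : cpartial _ _ = fun x => cpartial i f x + cpartial i g x).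
    exact: cpolyD.
  by apply/funext => x; apply: cpartialD; exact: cpoly_cdiff.
- rewrite (_ : cpartial _ _ = fun x => cpartial i f x * g x + f x * cpartial i g x).
    by apply: cpolyD; exact: cpolyM.
  by apply/funext => x; apply: cpartialM; exact: cpoly_cdiff.
Qed.

Lemma cpoly_bound P : cpoly P -> exists (A : R) (m : nat), 0 <= A /\
  forall x, cabs (P x) <= A * (1 + qdist x 0) ^+ m.
Proof.
have q1 x : 1 <= 1 + qdist x 0 by rewrite lerDl qdist_ge0.
have q0 x : 0 <= 1 + qdist x 0 by apply: le_trans (q1 x).
elim=> [c|i|f g _ [A [m [A0 hA]]] _ [B [k [B0 hB]]]|f g _ [A [m [A0 hA]]] _ [B [k [B0 hB]]]].
- by exists (cabs c), 0%N; split => [|x]; rewrite ?cabs_ge0// expr0 mulr1.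
- exists 1, 1%N; split => // x; rewrite cabs_real mul1r expr1.
  have : x ord0 i ^+ 2 <= qdist x 0.
    rewrite /qdist (bigD1 i)//= mxE subr0 lerDl; apply: sumr_ge0 => j _.
    exact: sqr_ge0.
  rewrite -(real_normK (num_real (x ord0 i))); move: `|_| (qdist _ _) => u v; nra.
- exists (A + B), (m + k)%N; split => [|x]; first exact: addr_ge0.
  apply: le_trans (cabsD _ _) _; rewrite mulrDl; apply: lerD.
    apply: le_trans (hA x) _; rewrite ler_wpM2l//.
    by apply: ler_weXn2l => //; exact: leq_addr.
  apply: le_trans (hB x) _; rewrite ler_wpM2l//.
  by apply: ler_weXn2l => //; exact: leq_addl.
- exists (A * B), (m + k)%N; split => [|x]; first exact: mulr_ge0.
  by rewrite cabsM exprD mulrACA ler_pM ?cabs_ge0.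
Qed.

Lemma gauss_waveE s a : gauss_wave s a =
  fun x => cexpi (- dotp a x) * (expR (- (s ^+ 2 *+ 2)^-1 * dotp x x))%:C.
Proof.
apply/funext => x; rewrite /gauss_wave gaussnE; congr (_ * (expR _)%:C).
rewrite mulNr mulrC -mulNr; congr (_ * _).
by apply: eq_bigr => i _; rewrite mxE subr0 expr2.
Qed.

Lemma differentiable_dotpxx x : differentiable (fun y : V => dotp y y) x.
Proof.
rewrite (_ : (fun y => _) = \sum_(i < n) (fun y : V => y ord0 i * y ord0 i)).
  apply: differentiable_sum => i.
  by apply: differentiableM; exact: differentiable_coord.
by apply/funext => y; rewrite fct_sumE.
Qed.

Lemma derive_dotpxx x i :
  'D_(delta_mx ord0 i) (fun y : V => dotp y y) x = 2 * x ord0 i.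
Proof.
have dc j : derivable (fun y : V => y ord0 j) x (delta_mx ord0 i).
  exact/diff_derivable/differentiable_coord.
rewrite (_ : (fun y => _) = \sum_(i < n) ((fun y : V => y ord0 i) * (fun y : V => y ord0 i))); last first.
  by apply/funext => y; rewrite fct_sumE.
rewrite derive_sum; last by move=> j; exact: derivableM.
under eq_bigr do rewrite deriveM// !derive_coord.
rewrite (bigD1 i)//= eqxx big1 ?addr0 /GRing.scale/= => [|j ji].
  by ring.
by rewrite eq_sym (negbTE ji) !mulr0 addr0.
Qed.

Lemma gauss_wave_cdiff s a : cdiff (gauss_wave s a) /\ forall i x,
  cpartial i (gauss_wave s a) x =
  ((0 -i* a ord0 i) + (- (s ^+ 2)^-1)%:C * (x ord0 i)%:C) * gauss_wave s a x.
Proof.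
rewrite gauss_waveE; set c := - (s ^+ 2 *+ 2)^-1.
have d1 x : differentiable (fun y : V => - dotp a y) x.
  by apply: differentiableN; exact: differentiable_dotp.
have d2 x : differentiable (fun y : V => c * dotp y y) x.
  by apply: differentiableM; [exact: differentiable_cst|exact: differentiable_dotpxx].
have d3 x : differentiable (fun y : V => expR (c * dotp y y)) x.
  exact: (proj1 (derive_chain 0 (d2 x) (is_derive_expR _))).
have c1 : cdiff (fun y : V => cexpi (- dotp a y)) by exact: cdiff_cexpi.
have c2 : cdiff (fun y : V => (expR (c * dotp y y))%:C).
  exact: (@cdiff_real _ _ (fun y => expR (c * dotp y y))).
split; first exact: cdiffM.
move=> i x; rewrite cpartialM// cpartial_cexpi// cpartial_real.
rewrite (proj2 (derive_chain _ (d2 x) (is_derive_expR _))).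
have -> : 'D_(delta_mx ord0 i) (fun y : V => - dotp a y) x = - a ord0 i.
  have := @deriveN _ _ _ (fun y : V => dotp a y) x (delta_mx ord0 i).
  rewrite derive_dotp => <- //.
  exact/diff_derivable/differentiable_dotp.
have -> : 'D_(delta_mx ord0 i) (fun y : V => c * dotp y y) x = - (s ^+ 2)^-1 * x ord0 i.
  have := @deriveZ _ _ _ (fun y : V => dotp y y) c x (delta_mx ord0 i).
  rewrite derive_dotpxx => E.
  rewrite -[LHS]/('D_(delta_mx ord0 i) (c *: (fun y : V => dotp y y)) x) E; last first.
    exact/diff_derivable/differentiable_dotpxx.
  rewrite /GRing.scale/= /c -[_ *+ 2]mulr_natr invfM.
  have t0 : (2 : R) != 0 by [].
  by rewrite mulrA mulNr -(mulrA _ 2^-1) mulVf// mulr1.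
rewrite mulrDl mulrA; congr (_ + _).
rewrite [in LHS]RCM; rewrite [in LHS]RCM; ring.
Qed.

Lemma gauss_wave_cpartials s a (l : seq 'I_n) : exists P, cpoly P /\
  cpartials l (gauss_wave s a) = fun x => P x * gauss_wave s a x.
Proof.
have [dG pG] := gauss_wave_cdiff s a.
elim: l => [|i l [P [pP /= ->]]].
  by exists (fun=> 1); split; [exact: cpoly_cst|apply/funext => x; rewrite mul1r].
exists (fun x => cpartial i P x + P x * ((0 -i* a ord0 i) + (- (s ^+ 2)^-1)%:C * (x ord0 i)%:C)).
split.
  apply: cpolyD; first exact: cpoly_cpartial.
  apply: cpolyM => //; apply: cpolyD; first exact: cpoly_cst.
  by apply: cpolyM; [exact: cpoly_cst|exact: cpoly_coord].
apply/funext => x; rewrite cpartialM//; last exact: cpoly_cdiff.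
by rewrite pG; move: (gauss_wave s a x) => w; ring.
Qed.

Lemma cpoly_mpow (beta : 'I_n -> nat) : cpoly (fun x => (mpow x beta)%:C).
Proof.
rewrite (_ : (fun x => _) = fun x : V => \prod_(i < n) (x ord0 i ^+ beta i)%:C); last first.
  by apply/funext => x; rewrite RC_prod.
elim: (index_enum _) => [|i l IH].
  rewrite (_ : (fun x => _) = fun=> 1); first exact: cpoly_cst.
  by apply/funext => x; rewrite big_nil.
rewrite (_ : (fun x => _) = fun x : V => (x ord0 i ^+ beta i)%:C *
    \prod_(i <- l) (x ord0 i ^+ beta i)%:C); last first.
  by apply/funext => x; rewrite big_cons.
apply: cpolyM => //; elim: (beta i) => [|k IHk].
  by under eq_fun do rewrite expr0; exact: cpoly_cst.
rewrite (_ : (fun x => _) = fun x : V => (x ord0 i)%:C * (x ord0 i ^+ k)%:C); last first.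
  by apply/funext => x; rewrite exprS RCM.
by apply: cpolyM => //; exact: cpoly_coord.
Qed.

Lemma cpoly_gauss_wave_bounded s a P : 0 < s -> cpoly P ->
  exists M : R, forall x, cabs (P x * gauss_wave s a x) <= M.
Proof.
move=> s0 /cpoly_bound[A [m [A0 hA]]].
pose c := s ^+ 2 *+ 2; have c0 : 0 < c by rewrite mulrn_wgt0// exprn_gt0.
exists (A * ((m.+1%:R * c) ^+ m.+1 * expR c^-1)) => x.
rewrite cabsM cabsM cabs_cexpi mul1r cabs_real gtr0_norm ?gaussn_gt0//.
apply: le_trans (ler_wpM2r (ltW (gaussn_gt0 _ _ _)) (hA x)) _.
rewrite -mulrA ler_wpM2l//; set t := 1 + qdist x 0.
have t1 : 1 <= t by rewrite lerDl qdist_ge0.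
have t0 : 0 < t by apply: lt_le_trans t1.
have -> : gaussn s 0 x = expR (- (t / c)) * expR c^-1.
  by rewrite -expRD gaussnE -/c; congr expR; rewrite /t; ring.
rewrite mulrA ler_wpM2r ?expR_ge0//.
have y0 : 0 < t / c by rewrite divr_gt0.
apply: le_trans (ler_wpM2l (exprn_ge0 m (ltW t0)) (expRN_le m y0)) _.
rewrite invf_div mulrA expr_div_n mulrCA ler_piMr//.
  by rewrite exprn_ge0// mulr_ge0// ltW.
by rewrite ler_pdivrMr ?exprn_gt0// mul1r exprS ler_peMl// exprn_ge0// ltW.
Qed.

(** Every derivative is a polynomial times the wave itself, and the Gaussian
    beats polynomials. *)
Lemma schwartz_gauss_wave s a : 0 < s -> schwartz (gauss_wave s a).
Proof.
move=> s0; split.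
  move=> l; have [P [pP ->]] := gauss_wave_cpartials s a l.
  by apply: cdiffM; [exact: cpoly_cdiff|exact: (proj1 (gauss_wave_cdiff s a))].
move=> N.
have bnd (alpha beta : 'I_n -> nat) : exists M : R, forall x,
    cabs ((mpow x beta)%:C * mderiv alpha (gauss_wave s a) x) <= M.
  have [P [pP E]] := gauss_wave_cpartials s a (flatten [seq nseq (alpha i) i | i <- enum 'I_n]).
  have [M hM] := cpoly_gauss_wave_bounded a s0 (cpolyM (cpoly_mpow beta) pP).
  by exists M => x; rewrite /mderiv E mulrA.
pose T := {ffun 'I_n -> 'I_N.+1}.
have [M hM] := choice (fun ab : T * T => bnd (fun i => ab.1 i : nat) (fun i => ab.2 i : nat)).
apply: (@le_lt_trans _ _ (\sum_ab `|M ab|)%:E); last by rewrite ltry.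
apply: ge_ereal_sup => _ [alpha [beta [x [aN bN ->]]]]; rewrite lee_fin.
have lt_N (g : 'I_n -> nat) i : (mlen g <= N)%N -> (g i < N.+1)%N.
  by move=> gN; rewrite ltnS (leq_trans _ gN)// /mlen (bigD1 i)//= leq_addr.
pose u : T := [ffun i => Ordinal (lt_N alpha i aN)].
pose v : T := [ffun i => Ordinal (lt_N beta i bN)].
have := hM (u, v) x => /=.
have -> : (fun i => u i : nat) = alpha by apply/funext => i; rewrite ffunE.
have -> : (fun i => v i : nat) = beta by apply/funext => i; rewrite ffunE.
move=> h; apply: le_trans h _; apply: le_trans (ler_norm _) _.
by rewrite (bigD1 (u, v))//= lerDl sumr_ge0.
Qed.

End schwartz.

(** * Integration by parts *)

Section integration_by_parts.
Variable R : realType.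
Local Notation C := R[i].
Local Notation leb := (lebR R).

(** The indicator function of the box [-K, K]^n, as a product so that
    [Rint_prod] applies. *)
Definition boxn n (K : R) (x : 'rV[R]_n) : R :=
  \prod_(i < n) \1_(`[- K, K]%classic) (x ord0 i).

Lemma boxn01 n K (x : 'rV[R]_n) : boxn K x = 1 /\ (forall i, `|x ord0 i| <= K) \/
  boxn K x = 0 /\ exists i, K < `|x ord0 i|.
Proof.
have [h|/existsNP[i /negP h]] := pselect (forall i, `|x ord0 i| <= K); [left|right]; split => //.
- rewrite /boxn big1// => i _; rewrite indicE mem_set//= in_itv/=.
  by rewrite -ler_norml.
- rewrite -ltNge in h; rewrite /boxn (bigD1 i)//= indicE memNset ?mul0r//=.
  by rewrite in_itv/= -ler_norml; apply/negP; rewrite -ltNge.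
- by exists i; rewrite ltNge; exact/negP/negP.
Qed.

Lemma boxn_ge0 n K (x : 'rV[R]_n) : 0 <= boxn K x.
Proof. by have [[-> _]|[-> _]] := boxn01 K x. Qed.

Lemma boxn_cons n K (z : measurableTypeR R * 'rV[R]_n) :
  boxn K (rV_cons z) = \1_(`[- K, K]%classic) z.1 * boxn K z.2.
Proof.
rewrite /boxn big_ord_recl rV_cons0; congr (_ * _).
by apply: eq_bigr => i _; rewrite rV_consS.
Qed.

Lemma integrable_indic_itv (K : R) : 0 < K ->
  leb.-integrable setT (EFin \o \1_(`[- K, K]%classic)) /\
  \int[leb]_t \1_(`[- K, K]%classic) t = 2 * K.
Proof.
move=> K0.
have mI : measurable (`[- K, K]%classic : set (measurableTypeR R)) by exact: measurable_itv.
have e : (\int[leb]_t (\1_(`[- K, K]%classic) t)%:E = (2 * K)%:E)%E.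
  rewrite integral_indic// setIT [LHS]lebesgue_measure_itv/= lte_fin gtrN//.
  by rewrite -EFinB; congr EFin; ring.
split; last by rewrite /Rintegral e.
apply/integrableP; split; first by apply/measurable_EFinP; exact: measurable_indic.
under eq_integral do rewrite /= ger0_norm//.
by rewrite e ltry.
Qed.

Lemma boxn_integral n K : 0 < K ->
  (lebesgue_rV R n).-integrable setT (EFin \o boxn K) /\
  \int[lebesgue_rV R n]_x boxn K x = (2 * K) ^+ n.
Proof.
move=> K0; have [iK eK] := integrable_indic_itv K0.
have [h1 h2] := @Rint_prod R n (fun=> \1_(`[- K, K]%classic)) (fun=> iK).
split; first exact: h1.
by rewrite h2 prodr_const card_ord eK.
Qed.

(** The derivatives are taken along lines, so that the hypotheses restrict to
    hyperplane sections and Fubini gives an induction on the dimension. *)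
Lemma integral_partial_eq0 n (i : 'I_n) (h g : 'rV[R]_n -> R) (K M : R) : 0 < K ->
  measurable_fun setT g -> (forall x, `|g x| <= M * boxn K x) ->
  (forall x (t : R), is_derive t 1 (fun s : R => h (x + s *: delta_mx ord0 i))
                               (g (x + t *: delta_mx ord0 i))) ->
  (forall x, continuous (fun t : R => g (x + t *: delta_mx ord0 i))) ->
  (forall x, boxn K x = 0 -> h x = 0) ->
  \int[lebesgue_rV R n]_x g x = 0.
Proof.
move=> K0; elim: n i h g => [[]//|n IH] i h g mg gM dh cg h0.
have M0 : 0 <= M.
  have := gM 0; have [[-> _]|[_ [j]]] := boxn01 K (0 : 'rV[R]_n.+1).
    by rewrite mulr1; exact: le_trans.
  by rewrite mxE normr0 ltNge ltW.
have [iK _] := integrable_indic_itv K0.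
pose I := \1_(`[- K, K]%classic) : R -> R.
have [ib _] := boxn_integral n K0.
have ia : leb.-integrable setT (EFin \o (fun t => M * I t)).
  exact: (integrableZ _ iK).
have a0 (t : measurableTypeR R) : 0 <= M * I t by rewrite mulr_ge0.
have mk : measurable_fun setT (fun z : measurableTypeR R * 'rV[R]_n => g (rV_cons z)).
  exact: (measurableT_comp mg (@measurable_rV_cons R n)).
have kM (z : measurableTypeR R * 'rV[R]_n) : `|g (rV_cons z)| <= (M * I z.1) * boxn K z.2.
  by rewrite -mulrA -boxn_cons.
have ik := dom_integrable ia ib a0 (boxn_ge0 K) mk kM.
have -> : \int[lebesgue_rV R n.+1]_x g x =
    \int[(leb \x lebesgue_rV R n)%E]_z g (rV_cons z).
  congr fine; apply: (integral_pushforward (@measurable_rV_cons R n)) => //.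
  exact/measurable_EFinP.
have consD (t : R) (v : 'rV[R]_n) (s : R) (j : 'I_n) :
    rV_cons (t, v + s *: delta_mx ord0 j) =
    rV_cons (t, v) + s *: delta_mx ord0 (lift ord0 j).
  apply/rowP => k; rewrite !mxE; case: unliftP => [l ->|->] /=.
    by rewrite !mxE (inj_eq lift_inj).
  by rewrite mulr0 addr0.
have cons0 (t : R) (v : 'rV[R]_n) :
    rV_cons (t, v) = rV_cons (0, v) + t *: delta_mx ord0 ord0.
  apply/rowP => k; rewrite !mxE; case: unliftP => [l ->|->] /=.
    by rewrite mulr0 addr0.
  by rewrite mulr1 add0r.
case: (unliftP ord0 i) => [j ij|i0].
  have z0 t : \int[lebesgue_rV R n]_v g (rV_cons (t, v)) = 0.
    apply: (IH j (fun v => h (rV_cons (t, v))) (fun v => g (rV_cons (t, v)))).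
    - exact: (measurableT_comp mk (pair1_measurable t)).
    - move=> v; apply: le_trans (kM (t, v)) _ => /=.
      rewrite ler_wpM2r ?boxn_ge0// ler_piMr// /I indicE.
      by case: (_ \in _).
    - move=> w s.
      have -> : (fun r : R => h (rV_cons (t, w + r *: delta_mx ord0 j))) =
          (fun r => h (rV_cons (t, w) + r *: delta_mx ord0 i)).
        by apply/funext => r; rewrite (consD t w r j) -ij.
      by rewrite (consD t w s j) -ij; exact: dh.
    - move=> w.
      have -> : (fun r : R => g (rV_cons (t, w + r *: delta_mx ord0 j))) =
          (fun r => g (rV_cons (t, w) + r *: delta_mx ord0 i)).
        by apply/funext => r; rewrite (consD t w r j) -ij.
      exact: cg.
    - by move=> v bv; apply: h0; rewrite boxn_cons bv mulr0.
  rewrite -(dom_Fubini1 ia ib a0 (boxn_ge0 K) mk kM).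
  under eq_Rintegral do rewrite z0.
  by rewrite /Rintegral integral0.
have z0 v : \int[leb]_t g (rV_cons (t, v)) = 0.
  apply: (@Rint_derivative R (fun t => g (rV_cons (t, v))) (fun t => h (rV_cons (t, v))) (fun t => M * I t)).
  - have -> : (fun r => g (rV_cons (r, v))) =
        (fun r : R => g (rV_cons (0, v) + r *: delta_mx ord0 i)).
      by apply/funext => r; rewrite i0 -cons0.
    exact: cg.
  - move=> t.
    have -> : (fun r => h (rV_cons (r, v))) =
        (fun r : R => h (rV_cons (0, v) + r *: delta_mx ord0 i)).
      by apply/funext => r; rewrite i0 -cons0.
    by rewrite cons0 -i0; exact: dh.
  - exact: ia.
  - move=> t; apply: le_trans (kM (t, v)) _ => /=.
    by rewrite ler_piMr//; have [[-> _]|[-> _]] := boxn01 K v.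
  - apply: cvg_near_cst; near=> N; apply: h0; rewrite boxn_cons/= indicE memNset ?mul0r//=.
    rewrite in_itv/= -ler_norml normr_nat; apply/negP; rewrite -ltNge.
    by near: N; exact: nbhs_infty_gtr.
  - apply: cvg_near_cst; near=> N; apply: h0; rewrite boxn_cons/= indicE memNset ?mul0r//=.
    rewrite in_itv/= -ler_norml normrN normr_nat; apply/negP; rewrite -ltNge.
    by near: N; exact: nbhs_infty_gtr.
rewrite -(dom_Fubini2 ia ib a0 (boxn_ge0 K) mk kM).
under eq_Rintegral do rewrite z0.
by rewrite /Rintegral integral0.
Unshelve. all: by end_near. Qed.

Section in_dimension_n.
Variable n : nat.
Local Notation V := 'rV[R]_n.
Local Notation mu := (lebesgue_rV R n).
Implicit Types (f phi : V -> C) (x y xi v : V) (h : V -> R).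

Lemma is_derive_line h x v (t d : R) : is_derive (x + t *: v) v h d ->
  is_derive t 1 (fun s : R => h (x + s *: v)) d.
Proof.
move=> [dh <-].
have E : (fun s : R => s^-1 *: (((fun s => h (x + s *: v)) \o shift t) (s *: (1 : R)) - h (x + t *: v))) =
    (fun s : R => s^-1 *: ((h \o shift (x + t *: v)) (s *: v) - h (x + t *: v))).
  apply/funext => s; congr (_ *: (h _ - _)) => /=.
  by rewrite scalerDl [s *: 1]mulr1 addrCA.
by split; rewrite /derivable /derive E.
Qed.

Lemma continuous_line h x v : continuous h -> continuous (fun t : R => h (x + t *: v)).
Proof.
move=> ch t; apply: (@continuous_comp _ _ _ (fun t : R => x + t *: v) h); last exact: ch.
apply: (@continuousD _ _ _ (fun=> x) (fun t : R => t *: v)).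
  exact: cst_continuous.
exact: scalel_continuous.
Qed.

(** The box is compact. *)
Lemma box_bounded h K : continuous h -> (forall x, boxn K x = 0 -> h x = 0) ->
  exists2 M : R, 0 <= M & forall x, `|h x| <= M * boxn K x.
Proof.
move=> ch h0.
pose B := [set x : V | forall i, `[- K, K]%classic (x ord0 i)].
have cB : compact B := @rV_compact R n (fun=> `[- K, K]%classic) (fun=> @segment_compact R _ _).
have /compact_bounded[M [Mr hM]] := continuous_compact (continuous_subspaceT ch) cB.
exists (`|M| + 1) => [|x]; first by rewrite addr_ge0.
have [[-> bx]|[b0 _]] := boxn01 K x; last by rewrite b0 h0// normr0 mulr0.
rewrite mulr1; apply: (hM (`|M| + 1)); first by rewrite ltr_pwDr// ler_norm.
by exists x => // i /=; rewrite in_itv/= -ler_norml.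
Qed.

Lemma cbox_bounded f K : cdiff f -> (forall x, boxn K x = 0 -> f x = 0) ->
  exists2 M : R, 0 <= M & forall x, cabs (f x) <= M * boxn K x.
Proof.
move=> df f0.
have [A A0 hA] : exists2 M : R, 0 <= M & forall x, `|complex.Re (f x)| <= M * boxn K x.
  apply: box_bounded => [x|x /f0->//].
  by apply: differentiable_continuous; case: (df x).
have [B B0 hB] : exists2 M : R, 0 <= M & forall x, `|complex.Im (f x)| <= M * boxn K x.
  apply: box_bounded => [x|x /f0->//].
  by apply: differentiable_continuous; case: (df x).
exists (A + B) => [|x]; first exact: addr_ge0.
by rewrite (le_trans (cabs_le_ReIm _))// mulrDl lerD.
Qed.

Lemma cbox_cintg f K : 0 < K -> cdiff f -> (forall x, boxn K x = 0 -> f x = 0) ->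
  cintg mu f.
Proof.
move=> K0 df f0; have [M _ hM] := cbox_bounded df f0.
apply: (cintg_le (cdiff_cmeas df) _ hM).
exact: (integrableZ _ (proj1 (boxn_integral n K0))).
Qed.

(** Outside a closed box a function supported in it is locally zero. *)
Lemma cpartial_box f K i : (forall x, boxn K x = 0 -> f x = 0) ->
  forall x, boxn K x = 0 -> cpartial i f x = 0.
Proof.
move=> f0 x; have [[-> _]/eqP|[_ [j xj]] _] := boxn01 K x.
  by rewrite oner_eq0.
have nx : \forall y \near x, f y = 0.
  have oU : open [set y : V | K < `|y ord0 j|].
    rewrite (_ : [set y | _] = (fun y : V => `|y ord0 j|) @^-1` [set t | K < t]).
      apply: open_comp; last exact: open_gt.
      move=> y _; apply: continuous_comp; first exact: coord_continuous.
      exact: norm_continuous.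
    by [].
  apply: filterS (open_nbhs_nbhs (conj oU xj)) => y /= yj.
  apply: f0; have [[_ /(_ j)]|[]//] := boxn01 K y.
  by rewrite leNgt yj.
have nr : \near x, complex.Re (f x) = 0 by apply: filterS nx => y ->.
have ni : \near x, complex.Im (f x) = 0 by apply: filterS nx => y ->.
by rewrite /cpartial (near_eq_derive _ nr) (near_eq_derive _ ni) !derive_cst.
Qed.

End in_dimension_n.
End integration_by_parts.

(** * Kernels of a dyadic partition of unity *)

Section fourier_derivative.
Variables (R : realType) (n : nat).
Local Notation C := R[i].
Local Notation V := 'rV[R]_n.
Local Notation mu := (lebesgue_rV R n).
Implicit Types (f psi : V -> C) (x y xi : V) (K : R).

Lemma cint_cpartial_eq0 i f K : 0 < K -> cdiff f -> cdiff (cpartial i f) ->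
  (forall x, boxn K x = 0 -> f x = 0) -> cint mu (cpartial i f) = 0.
Proof.
move=> K0 df dpf f0; have pf0 := cpartial_box i f0.
have [M _ hM] := cbox_bounded dpf pf0.
have [mr mi] := cdiff_cmeas dpf.
apply: complex_eqP.
  apply: (@integral_partial_eq0 R n i (fun x => complex.Re (f x)) _ K M) => //.
  - by move=> x; apply: le_trans (ge_Re_cabs _) (hM x).
  - move=> x t; apply: (@is_derive_line R n (fun x => complex.Re (f x))).
    by apply: DeriveDef => //; exact: cdiff_Re_derivable.
  - move=> x; apply: (@continuous_line _ _ (fun x => complex.Re (cpartial i f x))) => z.
    by apply: differentiable_continuous; case: (dpf z).
  - by move=> x /f0 ->.
apply: (@integral_partial_eq0 R n i (fun x => complex.Im (f x)) _ K M) => //.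
- by move=> x; apply: le_trans (ge_Im_cabs _) (hM x).
- move=> x t; apply: (@is_derive_line R n (fun x => complex.Im (f x))).
  by apply: DeriveDef => //; exact: cdiff_Im_derivable.
- move=> x; apply: (@continuous_line _ _ (fun x => complex.Im (cpartial i f x))) => z.
  by apply: differentiable_continuous; case: (dpf z).
- by move=> x /f0 ->.
Qed.

(** The integral of the derivative of x |-> exp(i y.x) f(x) is zero. *)
Lemma fourier_inv_cpartial i f K y : 0 < K -> cdiff f -> cdiff (cpartial i f) ->
  (forall x, boxn K x = 0 -> f x = 0) ->
  fourier_inv (cpartial i f) y = (0 -i* y ord0 i) * fourier_inv f y.
Proof.
move=> K0 df dpf f0; have pf0 := cpartial_box i f0.
pose e x : C := cexpi (dotp y x).
have de : cdiff e by apply: cdiff_cexpi => x; exact: differentiable_dotp.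
have pe x : cpartial i e x = (0 +i* y ord0 i) * e x.
  by rewrite cpartial_cexpi ?derive_dotp//; exact: differentiable_dotp.
pose w : C := 0 +i* y ord0 i.
have E : cpartial i (fun x => e x * f x) = (fun x => w * (e x * f x) + e x * cpartial i f x).
  by apply/funext => x; rewrite cpartialM// pe -/w mulrA.
have z : cint mu (cpartial i (fun x => e x * f x)) = 0.
  apply: (@cint_cpartial_eq0 _ _ K) => //.
  - exact: cdiffM.
  - rewrite E; apply: cdiffD; last exact: cdiffM.
    by apply: cdiffM; [exact: cdiff_cst|exact: cdiffM].
  - by move=> x /f0 ->; rewrite mulr0.
have fi : cintg mu f by exact: cbox_cintg f0.
have pfi : cintg mu (cpartial i f) by exact: cbox_cintg pf0.
have efi : cintg mu (fun x => e x * f x) by apply: cintg_cexpi fi; exact: measurable_dotp2.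
have epfi : cintg mu (fun x => e x * cpartial i f x) by apply: cintg_cexpi pfi; exact: measurable_dotp2.
move: z; rewrite E cintD//; last exact: cintgZ.
rewrite cintZ// => /eqP; rewrite addrC addr_eq0 => /eqP z.
rewrite /fourier_inv -[X in _ * X = _]/(cint mu (fun x => e x * cpartial i f x)) z.
rewrite -[X in _ = _ * (_ * X)]/(cint mu (fun x => e x * f x)).
rewrite (_ : 0 -i* y ord0 i = - w); first by ring.
by rewrite /w; apply: complex_eqP; rewrite ?ReN ?ImN /= ?oppr0.
Qed.

Lemma fourier_inv_cpartials (s : seq 'I_n) f K y : 0 < K -> csmooth f ->
  (forall x, boxn K x = 0 -> f x = 0) ->
  (forall x, boxn K x = 0 -> cpartials s f x = 0) /\
  fourier_inv (cpartials s f) y = \prod_(i <- s) (0 -i* y ord0 i) * fourier_inv f y.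
Proof.
move=> K0 sf f0; elim: s => [|i s [IH1 IH2]]; first by rewrite big_nil mul1r.
split; first exact: cpartial_box IH1.
rewrite big_cons -mulrA -IH2 /=.
apply: (@fourier_inv_cpartial _ _ K) => //.
exact: (@csmooth_cdiff _ _ _ (i :: s)).
Qed.

(** Each derivative of f gains a power of y on its inverse transform, and the
    support in a box of side 2 K turns the sup norm into an L^1 norm. *)
Lemma fourier_inv_mderiv_le alpha f K M y : 0 < K -> csmooth f ->
  (forall x, boxn K x = 0 -> f x = 0) ->
  (forall x, cabs (mderiv alpha f x) <= M) ->
  (\prod_i `|y ord0 i| ^+ alpha i) * cabs (fourier_inv f y) <=
  (2 * pi) ^- n * (2 * (M * (2 * K) ^+ n)).
Proof.
move=> K0 sf f0 fM; set s := flatten [seq nseq (alpha i) i | i <- enum 'I_n].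
have [s0 E] := fourier_inv_cpartials s y K0 sf f0.
have -> : \prod_i `|y ord0 i| ^+ alpha i = cabs (\prod_(i <- s) (0 -i* y ord0 i)).
  rewrite cabs_prod big_flatten big_map big_enum_cond; apply: eq_bigr => i _.
  by rewrite big_nseq iter_mulr_1 cabsE/= expr0n/= add0r sqrrN sqrtr_sqr.
rewrite -cabsM -E.
have ds : cdiff (cpartials s f) by exact: csmooth_cdiff.
have is_ := cbox_cintg K0 ds s0.
apply: le_trans (cabs_fourier_inv_le _ is_) _.
rewrite ler_pM2l ?two_pi_gt0// ler_pM2l//.
have [ib eb] := boxn_integral n K0.
have iMb : mu.-integrable setT (fun x => (M * boxn K x)%:E).
  exact: (integrableZ _ ib).
rewrite -eb -RintegralZl//; apply: le_Rintegral => //; first exact: cintg_cabs.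
move=> x _; have [[-> _]|[b0 _]] := boxn01 K x; first by rewrite mulr1; exact: fM.
by rewrite b0 mulr0 s0// cabs0.
Qed.

End fourier_derivative.

Section dyadic.
Variables (R : realType) (n : nat).
Local Notation C := R[i].
Local Notation V := 'rV[R]_n.
Local Notation mu := (lebesgue_rV R n).
Variable psi : nat -> V -> C.
Hypothesis hpsi : dyadic_partition psi.
Implicit Types (x y xi : V) (l k : nat).

Lemma euclid_ge0 xi : 0 <= euclid xi.
Proof. exact: sqrtr_ge0. Qed.

Lemma euclid_sqr xi : euclid xi ^+ 2 = qdist xi 0.
Proof.
have E : dotp xi xi = qdist xi 0 by apply: eq_bigr => i _; rewrite mxE subr0 expr2.
by rewrite /euclid E sqr_sqrtr// qdist_ge0.
Qed.

Lemma euclid_sqr_le x y : euclid x ^+ 2 <= 2 * qdist x y + 2 * euclid y ^+ 2.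
Proof.
rewrite !euclid_sqr /qdist !mulr_sumr -big_split/=; apply: ler_sum => i _; rewrite !mxE.
have := sqr_ge0 (x ord0 i - 2 * y ord0 i); move: (x ord0 i) (y ord0 i) => a b; nra.
Qed.

Lemma le_coord_euclid xi i : `|xi ord0 i| <= euclid xi.
Proof.
rewrite -(ler_pXn2r (n := 2)) ?nnegrE ?euclid_ge0// euclid_sqr.
rewrite real_normK ?num_real// /qdist (bigD1 i)//= mxE subr0 lerDl.
by apply: sumr_ge0 => j _; exact: sqr_ge0.
Qed.

Lemma psi_schwartz l : schwartz (psi l).
Proof. by case: hpsi. Qed.

Lemma psi_cintg l : cintg mu (psi l).
Proof. exact/cintg_schwartz/psi_schwartz. Qed.

Lemma psi_supp l xi : psi l xi != 0 -> euclid xi <= 2 ^+ l.+1.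
Proof.
move=> p0; case: hpsi => _ h0 h1 _ _; have cl := subset_closure (A := [set xi | psi l xi != 0]) p0.
case: l p0 cl => [|l] p0 cl; first by rewrite expr1; exact: h0.
by have /andP[] := h1 l.+1 isT _ cl.
Qed.

Lemma psi_supp_low l xi : psi l.+1 xi != 0 -> 2 ^+ l <= euclid xi.
Proof.
move=> p0; case: hpsi => _ _ h1 _ _.
by have /andP[] := h1 l.+1 isT _ (subset_closure (A := [set xi | psi l.+1 xi != 0]) p0).
Qed.

Lemma psi_box l xi : boxn (2 ^+ l.+1) xi = 0 -> psi l xi = 0.
Proof.
move=> b0; apply/eqP; apply: contraT => /psi_supp h.
have [[b1 _]|[_ [i hi]]] := boxn01 (2 ^+ l.+1) xi.
  by have := oner_neq0 R; rewrite -b1 b0 eqxx.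
by have := lt_le_trans hi (le_trans (le_coord_euclid xi i) h); rewrite ltxx.
Qed.

Lemma psi_bound : exists2 C0 : R, 0 <= C0 & forall l xi, cabs (psi l xi) <= C0.
Proof.
case: hpsi => _ _ _ h _; have [C0 hC] := h (fun=> 0%N).
exists C0 => [|l xi].
  by have := hC 0%N 0; rewrite mlen0 muln0 expr0 invr1 mulr1; apply: le_trans; exact: cabs_ge0.
by have := hC l xi; rewrite mlen0 muln0 expr0 invr1 mulr1 mderiv0.
Qed.

(** Only finitely many terms of the partition are nonzero at a given point, so
    the limit in the definition is attained. *)
Lemma psi_sum k xi : euclid xi < 2 ^+ k -> \sum_(l < k.+1) psi l xi = 1.
Proof.
move=> xk; case: hpsi => _ _ _ _ /(_ xi) h.
have z l : (k < l)%N -> psi l xi = 0.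
  case: l => // l kl; apply/eqP; apply: contraT => /psi_supp_low h1.
  have := lt_le_trans xk (le_trans _ h1); rewrite ltxx; apply.
  by apply: ler_weXn2l; rewrite ?ler1n// -ltnS.
have E N : (k.+1 <= N)%N -> \sum_(0 <= l < N) psi l xi = \sum_(l < k.+1) psi l xi.
  move=> kN; rewrite (big_cat_nat (n := k.+1))//= big_mkord [X in _ + X]big_nat_cond [X in _ + X]big1 ?addr0//.
  by move=> l /andP[/andP[kl _] _]; exact: z.
have h2 : (fun N => cabs (\sum_(0 <= l < N) psi l xi - 1)) @ \oo -->
    cabs (\sum_(l < k.+1) psi l xi - 1).
  apply: cvg_near_cst; near=> N; rewrite E//.
  by near: N; exact: nbhs_infty_ge.
have e0 : cabs (\sum_(l < k.+1) psi l xi - 1) = 0 by exact: cvg_unique h2 h.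
have /eqP := complex.ComplexField.Normc.eq0_normc e0.
by rewrite subr_eq0 => /eqP.
Unshelve. all: by end_near. Qed.

(** The convolution kernels are uniformly bounded in L^1, because they are
    dominated by dilates of one integrable kernel; this is where the bounds on
    the derivatives of the partition are used. *)
Lemma psi_kernel : exists2 C1 : R, 0 <= C1 & forall l y,
  cabs (fourier_inv (psi l) y) <= C1 * ckerneln (2 ^+ l) 0 y.
Proof.
case: hpsi => _ _ _ /choice[Ca hCa] _.
pose al (S : {set 'I_n}) (i : 'I_n) : nat := if i \in S then 2 else 0.
pose D := \sum_(S : {set 'I_n}) `|Ca (al S)|.
have D0 : 0 <= D by exact: sumr_ge0.
pose C1 := 2 ^+ n * ((2 * pi) ^- n * (2 * (D * 4 ^+ n))).
have C10 : 0 <= C1.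
  by rewrite mulr_ge0 ?exprn_ge0// mulr_ge0 ?(ltW (two_pi_gt0 _ _))// !mulr_ge0 ?exprn_ge0.
exists C1 => // l y; set s : R := 2 ^+ l.
have s0 : 0 < s by rewrite exprn_gt0.
(* Differentiate twice in the directions where |s y_i| > 1 and not at all in
   the others; D bounds the constants of all these choices. *)
pose S : {set 'I_n} := finset.finset (fun i => 1 < (s * y ord0 i) ^+ 2).
pose w := cabs (fourier_inv (psi l) y).
have w0 : 0 <= w by exact: cabs_ge0.
have K0 : 0 < 2 ^+ l.+1 :> R by rewrite exprn_gt0.
have h := @fourier_inv_mderiv_le R n (al S) (psi l) (2 ^+ l.+1) (D * s ^- mlen (al S)) y K0
   (proj1 (psi_schwartz l)) (@psi_box l).
have {h} h : (\prod_i `|y ord0 i| ^+ al S i) * w <=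
    (2 * pi) ^- n * (2 * (D * s ^- mlen (al S) * (2 * 2 ^+ l.+1) ^+ n)).
  apply: h => x; apply: le_trans (hCa _ _ _) _.
  rewrite exprM; apply: ler_wpM2r.
    by rewrite invr_ge0 exprn_ge0// ltW.
  apply: le_trans (ler_norm _) _.
  by rewrite /D (bigD1 S)//= lerDl sumr_ge0.
have p0 : 0 < \prod_i (1 + (s * y ord0 i) ^+ 2).
  by apply: prodr_gt0 => i _; rewrite ltr_wpDr// sqr_ge0.
have -> : ckerneln s 0 y = s ^+ n / \prod_i (1 + (s * y ord0 i) ^+ 2).
  rewrite (_ : s ^+ n = \prod_(i < n) s); last by rewrite prodr_const card_ord.
  rewrite -prodfV -big_split/=; apply: eq_bigr => i _.
  by rewrite /ckernel mxE subr0.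
rewrite mulrA ler_pdivlMr// mulrC.
apply: le_trans (ler_wpM2r w0 (prod1Dsqr_le (fun i => s * y ord0 i))) _.
have E : \prod_i (s * y ord0 i) ^+ (if 1 < (s * y ord0 i) ^+ 2 then 2 else 0) =
    s ^+ mlen (al S) * \prod_i `|y ord0 i| ^+ al S i.
  rewrite /mlen expr_sum -big_split/=; apply: eq_bigr => i _.
  rewrite /al finset.in_set; case: ifP => _; last by rewrite !expr0 mulr1.
  by rewrite exprMn real_normK// num_real.
have sm : s ^+ mlen (al S) != 0 by rewrite expf_neq0// gt_eqF.
rewrite E -!mulrA; apply: le_trans (ler_wpM2l _ (ler_wpM2l _ h)) _.
- by rewrite exprn_ge0.
- by rewrite exprn_ge0// ltW.
rewrite le_eqVlt; apply/orP; left; apply/eqP.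
have -> : (2 * 2 ^+ l.+1) ^+ n = 4 ^+ n * s ^+ n :> R.
  by rewrite -exprMn exprS mulrA; congr ((_ * _) ^+ _); ring.
by move: ((2 * pi) ^- n) => c; field.
Qed.

End dyadic.

(** * Testing the norms *)

Section norms.
Variables (R : realType) (n : nat).
Local Notation C := R[i].
Local Notation V := 'rV[R]_n.
Local Notation mu := (lebesgue_rV R n).
Implicit Types (f g h phi : V -> C) (x y : V) (u : functional R n).

(** The counterexamples are integrable functions, and for these this functional
    is tempered ([dist_of_tempered]). *)
Definition dist_of f : functional R n := fun phi => cintegral (fun x => f x * phi x).

Lemma dist_of_tempered f : cintg mu f -> tempered (dist_of f).
Proof.
move=> fi.
have bnd phi : schwartz phi -> exists2 M : R, schwartz_norm 0 phi = M%:E & forall x, cabs (phi x) <= M.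
  move=> sp; have sf := schwartz_norm_fin 0 sp.
  exists (fine (schwartz_norm 0 phi)); first by rewrite fineK.
  by move=> x; rewrite -lee_fin fineK//; exact: cabs_le_schwartz_norm0.
have ii phi : schwartz phi -> cintg mu (fun x => f x * phi x).
  move=> sp; have [M _ hM] := bnd _ sp; under eq_fun do rewrite mulrC.
  by apply: cintg_mulb fi; [exact: cmeas_schwartz|exact: hM].
split.
  move=> a phi1 phi2 s1 s2; rewrite /dist_of.
  rewrite -[X in a * X]/(cint mu (fun x => f x * phi1 x)) -(cintZ a (ii _ s1)).
  rewrite -[X in _ = _ + X]/(cint mu (fun x => f x * phi2 x)).
  rewrite -cintD; [|exact: cintgZ (ii _ s1)|exact: ii].
  by congr cint; apply/funext => x; ring.
exists 0%N, (2 * \int[mu]_x cabs (f x)) => phi sp.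
have [M -> hM] := bnd _ sp; rewrite -EFinM lee_fin.
have iM : mu.-integrable setT (EFin \o (fun x => M * cabs (f x))).
  exact: (integrableZ _ (cintg_cabs fi)).
apply: le_trans (cint_le_dom (cintg_cmeas (ii _ sp)) iM _) _.
  by move=> x; rewrite cabsM mulrC ler_wpM2r ?cabs_ge0.
by rewrite RintegralZl; [rewrite mulrCA mulrC|by []|exact: cintg_cabs].
Qed.

Lemma dist_norm_le (N : (V -> C) -> \bar R) f u (Z : \bar R) : cmeas f ->
  represents f u -> (N f <= Z)%E -> (dist_norm N u <= Z)%E.
Proof.
move=> mf rf fZ; have [Nf|] := ltP (N f) +oo%E.
  by apply: le_trans fZ; apply: ereal_inf_lbound; exists f.
by move=> h; rewrite (_ : Z = +oo%E) ?leey//; apply/eqP; rewrite eq_le leey (le_trans h).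
Qed.

Lemma dist_norm_ge (N : (V -> C) -> \bar R) u (z : \bar R) :
  (forall f, cmeas f -> (N f < +oo)%E -> represents f u -> (z <= N f)%E) ->
  (z <= dist_norm N u)%E.
Proof. by move=> h; apply: le_ereal_inf_tmp => _ [f [mf Nf rf] <-]; exact: h. Qed.

Lemma Lp_norm_ge0 (p : R) f : (0 <= Lp_norm p f)%E.
Proof. exact: Lnorm_ge0. Qed.

Lemma Lp_normE (p : R) f :
  Lp_norm p f = ((\int[mu]_x (cabs (f x) `^ p)%:E) `^ p^-1)%E.
Proof.
rewrite /Lp_norm unlock; suff -> : (\int[mu]_x `|(cabs (f x))%:E| `^ p =
  \int[mu]_x (cabs (f x) `^ p)%:E)%E by [].
by apply: eq_integral => x _ /=; rewrite ger0_norm ?cabs_ge0.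
Qed.

Lemma Lp_norm1 f : Lp_norm 1 f = (\int[mu]_x (cabs (f x))%:E)%E.
Proof.
rewrite /Lp_norm Lnorm1; apply: eq_integral => x _ /=.
by rewrite ger0_norm ?cabs_ge0.
Qed.

Lemma le_poweR (r : R) (x y : \bar R) : (0 <= r)%R -> (0 <= x)%E -> (x <= y)%E ->
  (x `^ r <= y `^ r)%E.
Proof.
move=> r0 x0 xy; apply: gt0_ler_poweR => //; rewrite in_itv/= leey andbT//.
exact: le_trans xy.
Qed.

(** Interpolation between L^1 and the sup norm: |f|^p <= A^(p-1) |f|. *)
Lemma Lp_norm_le (p A B : R) f : 1 <= p -> 0 < A -> cmeas f ->
  (forall x, cabs (f x) <= A) -> (\int[mu]_x (cabs (f x))%:E <= B%:E)%E ->
  (Lp_norm p f <= ((A `^ (p - 1) * B) `^ p^-1)%:E)%E.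
Proof.
move=> p1 A0 mf fA fB; have p0 : 0 < p by apply: lt_le_trans p1.
have I0 : (0 <= \int[mu]_x (cabs (f x))%:E)%E.
  by apply: integral_ge0 => x _; rewrite lee_fin cabs_ge0.
have B0 : 0 <= B by rewrite -lee_fin (le_trans I0).
rewrite Lp_normE -poweR_EFin; apply: le_poweR.
- by rewrite invr_ge0 ltW.
- by apply: integral_ge0 => x _; rewrite lee_fin powR_ge0.
apply: (@le_trans _ _ (\int[mu]_x ((A `^ (p - 1))%:E * (cabs (f x))%:E))%E).
  apply: ge0_le_integral => //=.
  - by move=> x _; rewrite lee_fin powR_ge0.
  - apply/measurable_EFinP/(measurableT_comp (measurable_powR p)).
    exact: measurable_cabs.
  - apply/measurable_EFinP; apply: measurable_funM => //; exact: measurable_cabs.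
  - move=> x _; rewrite -EFinM lee_fin.
    have [->|c0] := eqVneq (cabs (f x)) 0; first by rewrite powR0 ?mulr0// gt_eqF.
    have c1 : 0 < cabs (f x) by rewrite lt_neqAle eq_sym c0 cabs_ge0.
    have -> : cabs (f x) `^ p = cabs (f x) `^ (p - 1) * cabs (f x).
      by rewrite -[X in _ * X]powRr1 ?cabs_ge0// -powRD ?subrK// c0 implybT.
    rewrite ler_wpM2r ?cabs_ge0//; apply: ge0_ler_powR; last exact: fA.
    - by rewrite subr_ge0.
    - by rewrite nnegrE ltW.
    - by rewrite nnegrE ltW.
rewrite ge0_integralZl_EFin//.
- by rewrite EFinM lee_pmul2l// lte_fin powR_gt0.
- by move=> x _; rewrite lee_fin cabs_ge0.
- exact/measurable_EFinP/measurable_cabs.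
- by rewrite powR_ge0.
Qed.

(** A Gaussian lies in the dual space of every L^p. *)
Lemma gaussn_pairing (p : R) : 1 <= p -> exists2 A : R, 0 < A & forall f, cmeas f ->
  (\int[mu]_x (cabs (f x) * gaussn 1 0 x)%:E <= A%:E * Lp_norm p f)%E.
Proof.
move=> p1; have p0 : 0 < p by apply: lt_le_trans p1.
have g0 x : 0 <= gaussn 1 (0 : V) x by exact: ltW (gaussn_gt0 _ _ _).
have [ig eg] := @gaussn_integral R n 1 0 ltr01.
have [p_eq|p_neq] := eqVneq p 1.
  exists 1 => // f mf; rewrite p_eq mul1e Lp_norm1; apply: ge0_le_integral => //=.
  - by move=> x _; rewrite lee_fin mulr_ge0 ?cabs_ge0.
  - apply/measurable_EFinP; apply: measurable_funM; first exact: measurable_cabs.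
    exact: measurable_gaussn.
  - exact/measurable_EFinP/measurable_cabs.
  - by move=> x _; rewrite lee_fin ler_piMr ?cabs_ge0// gaussn_le1.
have pgt1 : 1 < p by rewrite lt_neqAle eq_sym p_neq.
pose q := (1 - p^-1)^-1.
have ip1 : p^-1 < 1 by rewrite invf_lt1.
have q0 : 0 < q by rewrite invr_gt0 subr_gt0.
have q1 : 1 <= q by rewrite invf_ge1 ?subr_gt0// lerBlDr lerDl invr_ge0 ltW.
have pq : p^-1 + q^-1 = 1 by rewrite invrK addrC subrK.
pose A := ((Num.sqrt (2 * pi) * 1) ^+ n) `^ q^-1 : R.
have Ng : (Lnorm mu q%:E (EFin \o gaussn 1 0) <= A%:E)%E.
  rewrite unlock /A -poweR_EFin; apply: le_poweR.
  - by rewrite invr_ge0 ltW.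
  - by apply: integral_ge0 => x _; rewrite lee_fin powR_ge0.
  rewrite -eg /Rintegral fineK ?integrable_fin_num//.
  apply: ge0_le_integral => //=.
  - apply/measurable_EFinP; apply: (measurableT_comp (measurable_powR q)).
    by apply: measurableT_comp => //; exact: measurable_gaussn.
  - exact: measurable_int ig.
  - move=> x _; rewrite lee_fin ger0_norm//.
    by apply: ge1r_powR; rewrite // gaussn_gt0 gaussn_le1.
have A0 : 0 <= A by exact: powR_ge0.
exists (A + 1) => [|f mf]; first by rewrite ltr_wpDl.
have := hoelder mu (measurable_cabs mf) (@measurable_gaussn R n 1 0) p0 q0 pq.
rewrite Lnorm1 (_ : (\int[mu]_x _)%E = (\int[mu]_x (cabs (f x) * gaussn 1 0 x)%:E)%E); last first.
  by apply: eq_integral => x _ /=; rewrite ger0_norm// mulr_ge0 ?cabs_ge0.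
move=> h; apply: le_trans h _; rewrite muleC; apply: lee_wpmul2r.
  exact: Lnorm_ge0.
by apply: le_trans Ng _; rewrite lee_fin lerDl.
Qed.

(** The source of lower bounds for Besov norms.  Only |phi| is prescribed, so
    that one constant serves all modulations of the Gaussian. *)
Lemma dist_norm_test (p : R) : 1 <= p -> exists2 A : R, 0 < A & forall u phi,
  schwartz phi -> (forall x, cabs (phi x) = gaussn 1 0 x) ->
  ((cabs (u phi))%:E <= A%:E * dist_norm (Lp_norm p) u)%E.
Proof.
move=> p1; have [A A0 hA] := gaussn_pairing p1.
exists (2 * A) => [|u phi sp pg]; first by rewrite mulr_gt0.
have A1 : 0 < 2 * A by rewrite mulr_gt0.
rewrite -lee_pdivrMl//; apply: dist_norm_ge => f mf Nf rf.
rewrite lee_pdivrMl// rf//.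
apply: le_trans (cint_le mu (cmeasM mf (cmeas_schwartz sp))) _.
rewrite EFinM -muleA lee_pmul2l//; apply: le_trans (hA f mf).
by rewrite le_eqVlt; apply/orP; left; apply/eqP; apply: eq_integral => x _; rewrite cabsM pg.
Qed.

(** * The amalgam norm *)

Lemma measurable_cube (nu : 'rV[int]_n) : measurable (@cube R n nu).
Proof.
rewrite (_ : cube nu = \bigcap_(i in [set: 'I_n])
   ((fun x : V => x ord0 i) @^-1` `[(nu ord0 i)%:~R - 2^-1, (nu ord0 i)%:~R + 2^-1]%classic)).
  apply: fin_bigcap_measurable => // i _.
  by rewrite -[X in measurable X]setTI; apply: measurable_rV_coord.
apply/seteqP; split=> x /= h; first by move=> i _; rewrite /= in_itv/= -ler_distl.
by move=> i; have := h i I; rewrite /= in_itv/= -ler_distl.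
Qed.

Lemma cauchy_schwarz_set (D : set V) (f g : V -> R) (B : R) : measurable D ->
  measurable_fun setT f -> measurable_fun setT g -> 0 <= B ->
  (\int[mu]_(x in D) (g x ^+ 2)%:E <= (B ^+ 2)%:E)%E ->
  (\int[mu]_(x in D) (`|f x * g x|)%:E <=
    B%:E * (\int[mu]_(x in D) (f x ^+ 2)%:E) `^ 2^-1)%E.
Proof.
move=> mD mf mg B0 gB.
have mfD : measurable_fun setT (f \_ D).
  by apply/(measurable_restrictT _ _).1 => //; exact: measurable_funTS.
have mgD : measurable_fun setT (g \_ D).
  by apply/(measurable_restrictT _ _).1 => //; exact: measurable_funTS.
have h2 (h : V -> R) : Lnorm mu 2%:E (EFin \o (h \_ D)) =
    ((\int[mu]_(x in D) (h x ^+ 2)%:E) `^ 2^-1)%E.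
  rewrite unlock [in RHS]integral_mkcond; congr (_ `^ _)%E.
  apply: eq_integral => x _ /=; rewrite !patchE; case: ifP => _ /=.
    by rewrite powR_mulrn// real_normK ?num_real.
  by rewrite normr0 powR0.
have half : (2^-1 : R) + 2^-1 = 1 by lra.
have two0 : (0 : R) < 2 by [].
have := hoelder mu mfD mgD two0 two0 half.
rewrite Lnorm1 !h2 (_ : (\int[mu]_x _)%E = (\int[mu]_(x in D) (`|f x * g x|)%:E)%E); last first.
  rewrite [RHS]integral_mkcond; apply: eq_integral => x _ /=.
  by rewrite !patchE; case: ifP => _ //; rewrite mulr0 normr0.
move=> h; apply: le_trans h _; rewrite muleC; apply: lee_wpmul2r; first exact: poweR_ge0.
have -> : B%:E = (((B ^+ 2)%:E) `^ 2^-1)%E.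
  by rewrite poweR_EFin powR12_sqrt ?sqr_ge0// sqrtr_sqr ger0_norm.
apply: le_poweR => //.
by apply: integral_ge0 => x _; rewrite lee_fin sqr_ge0.
Qed.

(** The cubes overlap on faces only, and the half-open cubes, enumerated by an
    injection of Z^n into the integers, partition the space. *)
Lemma integral_le_esum_cube (h : V -> R) (t : 'rV[int]_n -> \bar R) (B : R) :
  measurable_fun setT h -> (forall x, 0 <= h x) -> (forall nu, 0 <= t nu)%E ->
  (forall nu, \int[mu]_(x in cube nu) (h x)%:E <= B%:E * t nu)%E ->
  (\int[mu]_x (h x)%:E <= B%:E * \esum_(nu in [set: 'rV[int]_n]) t nu)%E.
Proof.
move=> mh h0 t0 ht.
pose D (nu : 'rV[int]_n) : set V :=
  [set x | forall i, Num.floor (x ord0 i + 2^-1) = nu ord0 i].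
pose E k : set V := if pickle_inv k is Some nu then D nu else set0.
pose t' k := if pickle_inv k is Some nu then t nu else 0%E.
have Dcube nu : D nu `<=` cube nu.
  move=> x Dx i; rewrite ler_distlC -(Dx i).
  have := Num.Theory.floor_le (x ord0 i + 2^-1).
  have := Num.Theory.floorD1_gt (x ord0 i + 2^-1); rewrite intrD.
  by move: (_%:~R) => u h1 h2; apply/andP; split; lra.
have mDi nu (i : 'I_n) : measurable [set x : V | Num.floor (x ord0 i + 2^-1) = nu ord0 i].
  rewrite (_ : [set x | _] = (fun x : V => x ord0 i) @^-1`
     `[(nu ord0 i)%:~R - 2^-1, (nu ord0 i)%:~R + 2^-1[%classic).
    by rewrite -[X in measurable X]setTI; apply: measurable_rV_coord.
  apply/seteqP; split => x /=; rewrite in_itv/=.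
    move=> <-; have := Num.Theory.floor_le (x ord0 i + 2^-1).
    have := Num.Theory.floorD1_gt (x ord0 i + 2^-1); rewrite intrD.
    by move: (_%:~R) => u h1 h2; apply/andP; split; lra.
  move=> /andP[]; move=> h1 h2; apply: Num.Theory.floor_def; rewrite intrD.
  by move: (_%:~R) h1 h2 => u h1 h2; apply/andP; split; lra.
have mE k : measurable (E k).
  rewrite /E; case: pickle_inv => [nu|]; last exact: measurable0.
  rewrite (_ : D nu = \bigcap_(i in [set: 'I_n]) [set x : V | Num.floor (x ord0 i + 2^-1) = nu ord0 i]).
    by apply: fin_bigcap_measurable.
  by apply/seteqP; split => x /= hx; [move=> i _; exact: hx|move=> i; exact: hx].
have ET : \bigcup_k E k = setT.
  apply/seteqP; split => // x _; exists (pickle (\row_i Num.floor (x ord0 i + 2^-1))) => //.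
  by rewrite /E pickleK_inv => i; rewrite mxE.
have trE : trivIset setT E.
  apply/trivIsetP => i j _ _ ij; apply/seteqP; split => // x [].
  rewrite /E; case ei : (pickle_inv i) => [nu|//]; case ej : (pickle_inv j) => [nu'|//] h1 h2.
  move/eqP : ij; apply.
  have e : nu = nu' by apply/rowP => l; rewrite -h1 -h2.
  have := pickle_invK (T := 'rV[int]_n) i; have := pickle_invK (T := 'rV[int]_n) j.
  by rewrite /ocancel ei ej/= e => <- <-.
have -> : (\int[mu]_x (h x)%:E = \sum_(k <oo) \int[mu]_(x in E k) (h x)%:E)%E.
  rewrite -ge0_integral_bigcup// ?ET//; first by apply/measurable_EFinP.
  by move=> x _; rewrite lee_fin.
have t'0 k : (0 <= t' k)%E by rewrite /t'; case: pickle_inv.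
have -> : (\esum_(nu in [set: 'rV[int]_n]) t nu = \sum_(k <oo) t' k)%E.
  rewrite nneseries_esumT// (esumID (range (pickle : 'rV[int]_n -> nat)))//.
  rewrite setTI [X in (_ + X)%E]esum1 ?adde0; last first.
    move=> k [_ nk]; rewrite /t'; case ek : (pickle_inv k) => [nu|//].
    exfalso; apply: nk; exists nu => //.
    by have := pickle_invK (T := 'rV[int]_n) k; rewrite /ocancel ek.
  rewrite esum_image; last by move=> a b _ _; exact: (pcan_inj pickleK).
  by apply: eq_esum => nu _; rewrite /t' /= pickleK_inv.
rewrite -nneseriesZl//; apply: lee_nneseries => [k _ _|k _].
  by apply: integral_ge0 => x _; rewrite lee_fin.
rewrite /E /t'; case: pickle_inv => [nu|]; last by rewrite integral_set0 mule0.
apply: le_trans (ht nu); apply: ge0_subset_integral => //.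
- rewrite (_ : D nu = E (pickle nu)); first exact: mE.
  by rewrite /E pickleK_inv.
- exact: measurable_cube.
- by apply/measurable_EFinP; exact: measurable_funTS.
- by move=> x _; rewrite lee_fin.
Qed.

(** Cauchy-Schwarz on each cube. *)
Lemma amalgam_test u phi (B : R) : schwartz phi -> 0 < B ->
  (forall nu, \int[mu]_(x in cube nu) (cabs (phi x) ^+ 2)%:E <= (B ^+ 2)%:E)%E ->
  ((cabs (u phi))%:E <= (2 * B)%:E * amalgam_L2l1 u)%E.
Proof.
move=> sp B0 hB; have B1 : 0 < 2 * B by rewrite mulr_gt0.
rewrite -lee_pdivrMl//; apply: dist_norm_ge => f mf Nf rf.
rewrite lee_pdivrMl// rf//; have mphi := cmeas_schwartz sp.
apply: le_trans (cint_le mu (cmeasM mf mphi)) _.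
rewrite EFinM -muleA lee_pmul2l//; apply: integral_le_esum_cube.
- exact: measurable_cabs (cmeasM mf mphi).
- by move=> x; exact: cabs_ge0.
- by move=> nu; exact: poweR_ge0.
move=> nu; have := cauchy_schwarz_set (measurable_cube nu) (measurable_cabs mf)
  (measurable_cabs mphi) (ltW B0) (hB nu).
apply: le_trans; rewrite le_eqVlt; apply/orP; left; apply/eqP.
by apply: eq_integral => x _; rewrite cabsM ger0_norm// mulr_ge0 ?cabs_ge0.
Qed.

Lemma dist_norm_Lp_ge0 (p : R) u : (0 <= dist_norm (Lp_norm p) u)%E.
Proof. by apply: dist_norm_ge => f _ _ _; exact: Lp_norm_ge0. Qed.

End norms.

(** * Lacunary sums on a cube *)

Section lacunary.
Variables (R : realType) (n : nat).
Local Notation C := R[i].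
Local Notation V := 'rV[R]_n.+1.
Local Notation mu := (lebesgue_rV R n.+1).
Local Notation leb := (lebR R).
Implicit Types (x xi : V) (m k N : nat).

(** The indicator function of the open unit cube, as a product so that
    [cint_prod] applies.  Being open, it meets only one of the closed cubes of
    the amalgam norm. *)
Definition open_cube x : R := \prod_i \1_(`](- (2^-1)), (2^-1 : R)[%classic) (x ord0 i).

(** Multiples of 2 pi, for orthogonality on the unit cube; the ratio 16 leaves
    room for four dyadic blocks around each frequency. *)
Definition freq m : R := 2 * pi * (16 ^+ m).

Definition lac_sum N x : C := \sum_(m < N) cexpi (freq m * x ord0 ord0).

Definition lac N x : C := (open_cube x)%:C * lac_sum N x.

Definition freqv m : V := freq m *: delta_mx ord0 ord0.

Lemma open_cube01 x : open_cube x = 1 /\ (forall i, `|x ord0 i| < 2^-1) \/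
  open_cube x = 0 /\ exists i, 2^-1 <= `|x ord0 i|.
Proof.
have [h|/existsNP[i /negP h]] := pselect (forall i, `|x ord0 i| < 2^-1); [left|right]; split => //.
- rewrite /open_cube big1// => i _; rewrite indicE mem_set//= in_itv/=.
  by rewrite -ltr_norml.
- rewrite -leNgt in h; rewrite /open_cube (bigD1 i)//= indicE memNset ?mul0r//=.
  by rewrite in_itv/= -ltr_norml; apply/negP; rewrite -leNgt.
- by exists i; rewrite leNgt; exact/negP/negP.
Qed.

Lemma open_cube_ge0 x : 0 <= open_cube x.
Proof. by have [[-> _]|[-> _]] := open_cube01 x. Qed.

Lemma dotp_freqv m x : dotp (freqv m) x = freq m * x ord0 ord0.
Proof.
rewrite /dotp (bigD1 ord0)//= big1 ?addr0 => [|i i0]; first by rewrite !mxE !eqxx mulr1.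
by rewrite !mxE (negbTE i0) andbF mulr0 mul0r.
Qed.

Lemma cint_open_cube (z : int) :
  cintg mu (fun x => (open_cube x)%:C * cexpi (2 * pi * z%:~R * x ord0 ord0)) /\
  cint mu (fun x => (open_cube x)%:C * cexpi (2 * pi * z%:~R * x ord0 ord0)) = (z == 0)%:R.
Proof.
pose zi (i : 'I_n.+1) : int := if i == ord0 then z else 0.
have [h1 h2] := @cint_prod R n.+1 _ (fun i => proj1 (cint_unit_interval R (zi i))).
have E : (fun x : V => \prod_(i < n.+1) ((\1_(`](- (2^-1)), (2^-1 : R)[%classic) (x ord0 i))%:C *
      cexpi (2 * pi * (zi i)%:~R * x ord0 i))) =
    (fun x => (open_cube x)%:C * cexpi (2 * pi * z%:~R * x ord0 ord0)).
  apply/funext => x; rewrite big_split/= -RC_prod; congr (_ * _).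
  rewrite (bigD1 ord0)//= big1 ?mulr1 => [|i i0]; first by rewrite /zi eqxx.
  by rewrite /zi (negbTE i0) mulr0 mul0r cexpi0.
rewrite E in h1 h2; split => //; rewrite h2.
under eq_bigr => i _ do rewrite (proj2 (cint_unit_interval R (zi i))).
rewrite (bigD1 ord0)//= big1 ?mulr1 => [|i i0]; first by rewrite /zi eqxx.
by rewrite /zi (negbTE i0).
Qed.

Lemma open_cube_integral : mu.-integrable setT (EFin \o open_cube) /\
  \int[mu]_x open_cube x = 1.
Proof.
have [[h1 _] h2] := cint_open_cube 0.
have E x : (open_cube x)%:C * cexpi (2 * pi * 0%:~R * x ord0 ord0) = (open_cube x)%:C.
  by rewrite mulr0 mul0r cexpi0 mulr1.
split; first by move: h1; apply: eq_integrable => // x _; rewrite E.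
apply: (@complexI R); rewrite -cint_real -[RHS]h2.
by congr cint; apply/funext => x; rewrite E.
Qed.

Lemma cabs_sqr_conj (z : C) : (cabs z ^+ 2)%:C = z * z^*%C.
Proof. by rewrite cabs_sqr; case: z => a b /=; apply: complex_eqP => /=; ring. Qed.

Lemma conj_cexpi (t : R) : (cexpi t)^*%C = cexpi (- t).
Proof. by rewrite /cexpi/= cosN sinN. Qed.

Lemma conj_lac_sum N x : (lac_sum N x)^*%C = \sum_(m < N) cexpi (- dotp (freqv m) x).
Proof.
rewrite /lac_sum rmorph_sum; apply: eq_bigr => m _.
by rewrite dotp_freqv -conj_cexpi.
Qed.

Lemma cmeas_lac_sum N : cmeas (lac_sum N).
Proof.
apply: cmeas_sum => m; apply: cmeas_cexpi; apply: measurable_funM => //.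
exact: measurable_rV_coord.
Qed.

Lemma cabs_lac_sum_le N x : cabs (lac_sum N x) <= N%:R.
Proof.
apply: le_trans (cabs_sum _ _ _) _.
under eq_bigr do rewrite cabs_cexpi.
by rewrite sumr_const card_ord.
Qed.

Lemma measurable_open_cube : measurable_fun setT open_cube.
Proof. by apply/measurable_EFinP; exact: measurable_int (proj1 open_cube_integral). Qed.

Lemma cmeas_lac N : cmeas (lac N).
Proof.
apply: cmeasM; last exact: cmeas_lac_sum.
by apply: cmeas_real; exact: measurable_open_cube.
Qed.

Lemma cabs_lac N x : cabs (lac N x) = open_cube x * cabs (lac_sum N x).
Proof. by rewrite cabsM cabs_real ger0_norm ?open_cube_ge0. Qed.

Lemma cintg_lac N : cintg mu (lac N).
Proof.
apply: (@cintg_le _ _ _ _ _ (fun x => N%:R * open_cube x)); first exact: cmeas_lac.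
  exact: (integrableZ _ (proj1 open_cube_integral)).
by move=> x; rewrite cabs_lac mulrC ler_wpM2r ?open_cube_ge0// cabs_lac_sum_le.
Qed.

(** The frequencies differ by nonzero multiples of 2 pi, so that the
    exponentials are orthonormal on the cube. *)
Lemma lac_sqr_integral N :
  mu.-integrable setT (fun x => (open_cube x * cabs (lac_sum N x) ^+ 2)%:E) /\
  \int[mu]_x (open_cube x * cabs (lac_sum N x) ^+ 2) = N%:R.
Proof.
pose z m k : int := (16 ^ m)%:Z - (16 ^ k)%:Z.
have E x : (open_cube x * cabs (lac_sum N x) ^+ 2)%:C =
    \sum_(m < N) \sum_(k < N) (open_cube x)%:C * cexpi (2 * pi * (z m k)%:~R * x ord0 ord0).
  rewrite RCM cabs_sqr_conj conj_lac_sum /lac_sum mulr_suml mulr_sumr.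
  apply: eq_bigr => m _; rewrite mulr_sumr mulr_sumr; apply: eq_bigr => k _.
  rewrite dotp_freqv -cexpiD; congr (_ * cexpi _).
  by rewrite /freq /z intrB -!pmulrn !natrX; ring.
have ii m : cintg mu (fun x => \sum_(k < N) (open_cube x)%:C * cexpi (2 * pi * (z m k)%:~R * x ord0 ord0)).
  by apply: cintg_sum => k; exact: (proj1 (cint_open_cube _)).
have [ir _] : cintg mu (fun x => (open_cube x * cabs (lac_sum N x) ^+ 2)%:C).
  by under eq_fun do rewrite E; exact: cintg_sum.
split; first exact: ir.
apply: (@complexI R); rewrite -cint_real; under eq_fun do rewrite E.
rewrite cint_sum//.
have S m : cint mu (fun x => \sum_(k < N) (open_cube x)%:C * cexpi (2 * pi * (z m k)%:~R * x ord0 ord0)) =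
    \sum_(k < N) ((m == k)%N)%:R.
  rewrite cint_sum; last by move=> k; exact: (proj1 (cint_open_cube _)).
  apply: eq_bigr => k _; rewrite (proj2 (cint_open_cube _)) /z subr_eq0.
  by rewrite eqz_nat eqn_exp2l.
have S1 (m : 'I_N) : \sum_(k < N) ((m == k :> nat)%N)%:R = 1 :> C.
  rewrite (bigD1 m)//= eqxx big1 ?addr0// => k km.
  by rewrite -[(_ == _)]/(m == k) eq_sym (negbTE km).
under eq_bigr do rewrite S S1.
by rewrite sumr_const card_ord rmorph_nat.
Qed.

(** The cube has volume 1, and t <= t^2 / (2 K) + K / 2. *)
Lemma lac_L1 N (K : R) : 0 < K -> N%:R = K ^+ 2 -> \int[mu]_x cabs (lac N x) <= K.
Proof.
move=> K0 NK; have [i1 e1] := lac_sqr_integral N; have [i2 e2] := open_cube_integral.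
pose g x := (2 * K)^-1 * (open_cube x * cabs (lac_sum N x) ^+ 2) + (K / 2) * open_cube x.
have j1 : mu.-integrable setT (fun x => ((2 * K)^-1 * (open_cube x * cabs (lac_sum N x) ^+ 2))%:E).
  exact: (integrableZ _ i1).
have j2 : mu.-integrable setT (fun x => ((K / 2) * open_cube x)%:E).
  exact: (integrableZ _ i2).
have ig : mu.-integrable setT (EFin \o g).
  by have := integrableD measurableT j1 j2; apply: eq_integrable.
apply: (@le_trans _ _ (\int[mu]_x g x)).
  apply: le_Rintegral => //; first exact: cintg_cabs (cintg_lac N).
  move=> x _; rewrite cabs_lac /g -subr_ge0.
  set t := cabs _; set q := open_cube x.
  have -> : (2 * K)^-1 * (q * t ^+ 2) + K / 2 * q - q * t = q * ((t - K) ^+ 2 / (2 * K)).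
    by field; rewrite gt_eqF.
  by rewrite mulr_ge0 ?open_cube_ge0// divr_ge0 ?sqr_ge0// mulr_ge0// ltW.
rewrite RintegralD// !RintegralZl// e1 e2 NK le_eqVlt; apply/orP; left; apply/eqP.
by field; rewrite gt_eqF.
Qed.

(** Only the cube at the origin contributes, with the L^2 norm. *)
Lemma lac_amalgam N (K : R) : 0 < K -> N%:R = K ^+ 2 -> (amalgam_norm (lac N) <= K%:E)%E.
Proof.
move=> K0 NK; have [i1 e1] := lac_sqr_integral N.
have sq x : cabs (lac N x) ^+ 2 = open_cube x * cabs (lac_sum N x) ^+ 2.
  by rewrite cabs_lac exprMn; have [[-> _]|[-> _]] := open_cube01 x; rewrite ?expr1n// expr0n.
have m2 : measurable_fun setT (fun x => (cabs (lac N x) ^+ 2)%:E).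
  by apply/measurable_EFinP; apply: measurable_funX; apply: measurable_cabs; exact: cmeas_lac.
rewrite /amalgam_norm (esumID [set (0 : 'rV[int]_n.+1)]); last first.
  by move=> nu _; exact: poweR_ge0.
rewrite setTI esum_set1; last exact: poweR_ge0.
rewrite [X in (_ + X)%E]esum1 ?adde0.
  have -> : K%:E = (((K ^+ 2)%:E) `^ 2^-1)%E.
    by rewrite poweR_EFin powR12_sqrt ?sqr_ge0// sqrtr_sqr gtr0_norm.
  apply: le_poweR => //.
    by apply: integral_ge0 => x _; rewrite lee_fin sqr_ge0.
  apply: (@le_trans _ _ (\int[mu]_x (cabs (lac N x) ^+ 2)%:E)%E).
    apply: ge0_subset_integral => //.
    - exact: measurable_cube.
    - by move=> x _; rewrite lee_fin sqr_ge0.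
  under eq_integral do rewrite sq.
  by rewrite -NK -e1 /Rintegral fineK// integrable_fin_num.
move=> nu [_ /= nu0]; rewrite (_ : (\int[_]_(x in _) _)%E = 0%E).
  by rewrite poweR0r// invr_neq0.
apply: integral0_eq => x xnu.
have [i nui] : exists i, nu ord0 i != 0.
  apply/existsP; rewrite -negb_forall; apply/negP => /forallP h; apply: nu0.
  by apply/rowP => i; rewrite mxE; have := h i => /eqP.
rewrite cabs_lac; have [[_ hx]|[-> _]] := open_cube01 x; last by rewrite mul0r expr0n.
have : 1 <= `|(nu ord0 i)%:~R| :> R.
  by rewrite -intr_norm -[1]/(1%:~R) ler_int -gtz0_ge1 normr_gt0.
have := hx i; have := xnu i; have := ler_distD (x ord0 i) 0 (nu ord0 i)%:~R.
rewrite !sub0r !normrN; move: `|_ - _| `|_| `|_| => a b c h1 h2 h3 h4; exfalso; lra.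
Qed.

Lemma cabs_gauss_wave (s : R) (a : V) x : cabs (gauss_wave s a x) = gaussn s 0 x.
Proof. by rewrite cabsM cabs_cexpi mul1r cabs_real gtr0_norm// gaussn_gt0. Qed.

(** Testing against all the modulated Gaussians at once recovers the square of
    the L^2 norm, up to the minimum of the Gaussian on the cube. *)
Lemma lac_test N : expR (- (n.+1)%:R / 8) * N%:R <=
  cabs (\sum_(m < N) dist_of (lac N) (gauss_wave 1 (freqv m))).
Proof.
have [i1 e1] := lac_sqr_integral N.
have ii m : cintg mu (fun x => lac N x * gauss_wave 1 (freqv m) x).
  under eq_fun do rewrite mulrC; apply: (@cintg_mulb _ _ _ _ 1); last exact: cintg_lac.
    by apply: cintg_cmeas; exact: cintg_gauss_wave.
  by move=> x; rewrite cabs_gauss_wave gaussn_le1.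
rewrite (_ : \sum_(m < N) _ = cint mu (fun x => \sum_(m < N) lac N x * gauss_wave 1 (freqv m) x));
  last by rewrite cint_sum.
have E x : \sum_(m < N) lac N x * gauss_wave 1 (freqv m) x =
    (open_cube x * cabs (lac_sum N x) ^+ 2 * gaussn 1 0 x)%:C.
  rewrite -mulr_sumr /gauss_wave -mulr_suml -conj_lac_sum RCM (RCM (open_cube x)) cabs_sqr_conj /lac.
  by ring.
under eq_fun do rewrite E.
rewrite cint_real cabs_real.
apply: le_trans (ler_norm _); rewrite -e1 -RintegralZl//; apply: le_Rintegral => //.
- exact: (integrableZ _ i1).
- have [j _] : cintg mu (fun x => (open_cube x * cabs (lac_sum N x) ^+ 2 * gaussn 1 0 x)%:C).
    by under eq_fun do rewrite -E; exact: cintg_sum.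
  exact: j.
move=> x _; rewrite mulrC; have [[-> hx]|[-> _]] := open_cube01 x; last by rewrite !mul0r.
rewrite mul1r ler_wpM2l ?sqr_ge0// gaussnE ler_expR expr1n.
rewrite !mulNr lerN2 ler_pdivrMr// (_ : _ / 8 * _ = n.+1%:R * 4^-1); last by field.
apply: (@le_trans _ _ (\sum_(i < n.+1) 4^-1)).
  apply: ler_sum => i _; rewrite mxE subr0 -(real_normK (num_real _)).
  have := hx i; have := normr_ge0 (x ord0 i); move: `|_| => t t0 t1; nra.
by rewrite sumr_const card_ord mulr_natl.
Qed.

End lacunary.

(** * The amalgam space is not contained in the Besov space *)

Section amalgam_not_besov.
Variables (R : realType) (n : nat).
Local Notation C := R[i].
Local Notation V := 'rV[R]_n.+1.
Local Notation mu := (lebesgue_rV R n.+1).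
Variable psi : nat -> V -> C.
Hypothesis hpsi : dyadic_partition psi.
Implicit Types (f g phi : V -> C) (x xi : V) (m k l N : nat).

(** The blocks of index less than k vanish at xi, so the sum is all of
    [psi_sum]. *)
Lemma psi_window k d xi : 2 ^+ k < euclid xi < 2 ^+ (k + d) ->
  \sum_(j < d.+1) psi (k + j)%N xi = 1.
Proof.
move=> /andP[h1 h2]; rewrite -(psi_sum hpsi h2) -addnS big_split_ord/= [X in _ = X + _]big1 ?add0r//.
move=> l _; apply/eqP; apply: contraT => /(psi_supp hpsi) h.
have h3 : euclid xi <= 2 ^+ k by apply: le_trans h _; apply: ler_weXn2l; rewrite ?ler1n.
by have := lt_le_trans h1 h3; rewrite ltxx.
Qed.

Lemma freq_bounds m : 4 * 16 ^+ m <= freq R m <= 8 * 16 ^+ m.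
Proof.
have e0 : 0 < 16 ^+ m :> R by rewrite exprn_gt0.
have p2 : 2 <= pi :> R := pi_ge2 R.
have p4 : pi < 4 :> R by have := pihalf_lt2 R; lra.
by rewrite /freq; apply/andP; split; nra.
Qed.

(** Outside the window 2 * 16^m < |xi| < 16 * 16^m, on which four blocks add up
    to 1, the distance to the frequency is at least 2 * 16^m, because
    4 <= 2 pi <= 8. *)
Lemma qdist_freqv m xi : euclid xi <= 2 * 16 ^+ m \/ 16 * 16 ^+ m <= euclid xi ->
  4 * (16 ^+ m) ^+ 2 <= qdist xi (freqv R n m).
Proof.
have /andP[] := freq_bounds m; have e0 : 0 < 16 ^+ m :> R by rewrite exprn_gt0.
move: (16 ^+ m) e0 => e e0 f1 f2 [h|h].
  have h0 := le_trans (le_coord_euclid xi ord0) h.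
  apply: (@le_trans _ _ ((xi ord0 ord0 - freq R m) ^+ 2)).
    have := ler_norm (xi ord0 ord0).
    move: (`|xi ord0 ord0| : R) (xi ord0 ord0) (freq _ _) h0 f1 f2 => a b c; nra.
  rewrite /qdist (bigD1 ord0)//= !mxE !eqxx mulr1 lerDl.
  by apply: sumr_ge0 => i _; exact: sqr_ge0.
have := euclid_sqr_le xi (freqv R n m); rewrite (euclid_sqr (freqv R n m)).
have -> : qdist (freqv R n m) 0 = freq R m ^+ 2.
  rewrite /qdist (bigD1 ord0)//= !mxE !eqxx mulr1 subr0 big1 ?addr0// => i i0.
  by rewrite !mxE (negbTE i0) andbF mulr0 subr0 expr0n.
by move: (euclid xi) (freq _ _) (qdist _ _) h f1 f2 => a b c; nra.
Qed.

(** One half of the exponent pays for the factor 2^-m, the other half remains as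
    an integrable Gaussian. *)
Lemma gaussn_far m xi : 4 * (16 ^+ m) ^+ 2 <= qdist xi (freqv R n m) ->
  gaussn 1 (freqv R n m) xi <= 2 ^- m * gaussn (Num.sqrt 2) (freqv R n m) xi.
Proof.
move=> h; rewrite !gaussnE sqr_sqrtr// expr1n.
set q := qdist _ _ in h *.
have e0 : 0 < (16 ^+ m) ^+ 2 :> R by rewrite !exprn_gt0.
rewrite (_ : - q / (1 *+ 2) = - (q / 4) + - q / (2 *+ 2)); last by field.
rewrite expRD ler_wpM2r ?expR_ge0//.
apply: (@le_trans _ _ (expR (- (16 ^+ m) ^+ 2))); first by rewrite ler_expR; lra.
apply: le_trans (expRN_le 0 e0) _; rewrite expr1 div1r lef_pV2 ?posrE ?exprn_gt0//.
rewrite -exprM; apply: (@le_trans _ _ (16 ^+ m)).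
  by apply: lerXn2r; rewrite ?nnegrE// ler_nat.
by apply: ler_weXn2l; rewrite ?ler1n// leq_pmulr.
Qed.

Lemma fourierB_sum (I : finType) f (g : I -> V -> C) y : cintg mu f ->
  (forall i, cintg mu (g i)) ->
  fourier (fun xi => f xi - \sum_i g i xi) y = fourier f y - \sum_i fourier (g i) y.
Proof.
move=> cf cg; have mp : measurable_fun setT (fun x : V => - dotp x y).
  exact: measurableT_comp (measurable_dotp1 y).
have cgi i : cintg mu (fun x => cexpi (- dotp x y) * g i x) by exact: cintg_cexpi.
rewrite -[RHS]/(cint mu _ - \sum_i cint mu (fun x => cexpi (- dotp x y) * g i x)).
rewrite -cint_sum// -cintB//; [|exact: cintg_cexpi|exact: cintg_sum].
by congr cint; apply/funext => x; rewrite -mulr_sumr mulrBr.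
Qed.

(** Four consecutive dyadic blocks see almost all of the spectrum of the wave
    [gauss_wave 1 (freqv m)], which is concentrated near [freqv m]. *)
Lemma lac_tail : exists2 B : R, 0 <= B & forall f m, cintg mu f ->
  cabs (dist_of f (gauss_wave 1 (freqv R n m)) - \sum_(j < 4)
    fourier_multiplier (psi (4 * m + 1 + j)%N) (dist_of f) (gauss_wave 1 (freqv R n m)))
  <= B * 2 ^- m * \int[mu]_x cabs (f x).
Proof.
have [C0 C00 hC] := psi_bound hpsi.
have s20 : 0 < Num.sqrt 2 :> R by rewrite sqrtr_gt0.
pose G : R := (Num.sqrt (2 * pi) * Num.sqrt 2) ^+ n.+1.
pose c1 : R := gauss_cst n.+1 1 * (1 + 4 * C0).
have g0 : 0 <= gauss_cst n.+1 1 :> R by apply: ltW; exact: gauss_cst_gt0.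
have c10 : 0 <= c1.
  by apply: mulr_ge0 => //; rewrite addr_ge0// mulr_ge0.
have G0 : 0 <= G by rewrite exprn_ge0// mulr_ge0 // sqrtr_ge0.
exists (4 * (c1 * G)) => [|f m cf]; first by do 2 apply: mulr_ge0 => //.
set a := freqv R n m; set phi := gauss_wave 1 a; set phv := fourier_inv phi.
have cphv : cintg mu phv := cintg_fourier_inv_gauss_wave a ltr01.
have cpj j : cintg mu (fun xi => psi j xi * phv xi).
  by apply: (@cintg_mulb _ _ _ _ C0) => //; exact/cintg_cmeas/psi_cintg.
pose E xi := phv xi - \sum_(j < 4) psi (4 * m + 1 + j)%N xi * phv xi.
have cE : cintg mu E.
  have h := cintg_sum (index_enum 'I_4) (fun j : 'I_4 => cpj (4 * m + 1 + j)%N).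
  have := cintgD cphv (cintgZ (-1) h).
  by rewrite /E; under eq_fun do rewrite mulN1r.
have intf xi g : cintg mu g -> cabs (fourier g xi) <= 2 * \int[mu]_x cabs (g x).
  by move=> cg; exact: cabs_fourier_le.
have cfg g : cintg mu g -> cintg mu (fun x => f x * fourier g x).
  move=> cg; under eq_fun do rewrite mulrC.
  apply: (cintg_mulb _ (fun x => intf x g cg) cf).
  by apply: cmeas_fourier; exact: cintg_cmeas cg.
have -> : dist_of f phi - \sum_(j < 4) fourier_multiplier (psi (4 * m + 1 + j)%N) (dist_of f) phi =
    cint mu (fun x => f x * fourier E x).
  rewrite -[X in dist_of f X](fourierK_gauss_wave a ltr01).
  rewrite -[LHS]/(cint mu (fun x => f x * fourier phv x) - \sum_(j < 4)
     cint mu (fun x => f x * fourier (fun xi => psi (4 * m + 1 + j)%N xi * phv xi) x)).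
  rewrite -cint_sum; last by move=> j; exact/cfg/cpj.
  rewrite -cintB; [|exact: cfg|by apply: cintg_sum => j; exact/cfg/cpj].
  congr cint; apply/funext => x; rewrite -mulr_sumr -mulrBr; congr (_ * _).
  by rewrite /E fourierB_sum.
have Ele xi : cabs (E xi) <= c1 * 2 ^- m * gaussn (Num.sqrt 2) a xi.
  rewrite /E -mulr_suml -[X in X - _]mul1r -mulrBl cabsM /phv fourier_inv_gauss_wave//.
  rewrite invr1 cabs_real ger0_norm; last by apply: mulr_ge0; [exact: g0|exact/ltW/gaussn_gt0].
  have [/andP[w1 w2]|w] := boolP (2 ^+ (4 * m + 1) < euclid xi < 2 ^+ (4 * m + 1 + 3)).
    rewrite psi_window ?w1// subrr cabs0 mul0r; apply: mulr_ge0; last exact/ltW/gaussn_gt0.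
    by apply: mulr_ge0 => //; rewrite invr_ge0 exprn_ge0.
  have far : 4 * (16 ^+ m) ^+ 2 <= qdist xi a.
    apply: qdist_freqv; move: w; rewrite negb_and -!leNgt (exprD _ (4 * m + 1) 3) (exprD _ (4 * m) 1) (exprM _ 4 m).
    have -> : 2 ^+ 4 = 16 :> R by rewrite -natrX.
    have -> : 2 ^+ 3 = 8 :> R by rewrite -natrX.
    rewrite expr1; move: (16 ^+ m) => e /orP[w|w]; [left|right]; lra.
  rewrite [leLHS]mulrCA.
  rewrite (_ : c1 * _ * _ = gauss_cst n.+1 1 * ((1 + 4 * C0) * (2 ^- m * gaussn (Num.sqrt 2) a xi)));
    last by rewrite !mulrA.
  apply: ler_wpM2l; first exact: g0.
  apply: ler_pM; rewrite ?cabs_ge0 ?(ltW (gaussn_gt0 _ _ _))//; last exact: gaussn_far.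
  apply: le_trans (cabsB _ _) _; rewrite cabs1 lerD2l.
  apply: le_trans (cabs_sum _ _ _) _; apply: le_trans (ler_sum _ (fun j _ => hC _ _)) _.
  by rewrite sumr_const card_ord mulr_natl.
have [iG eG] := gaussn_integral (n := n.+1) a s20.
have igE : mu.-integrable setT (EFin \o (fun xi => c1 * 2 ^- m * gaussn (Num.sqrt 2) a xi)).
  exact: (integrableZ _ iG).
have IE : \int[mu]_xi cabs (E xi) <= c1 * 2 ^- m * G.
  rewrite /G -eG -RintegralZl//; apply: le_Rintegral => //; exact: cintg_cabs.
have ig : mu.-integrable setT (EFin \o (fun x => 2 * (c1 * 2 ^- m * G) * cabs (f x))).
  exact: (integrableZ _ (cintg_cabs cf)).
apply: le_trans (cint_le_dom (cintg_cmeas (cfg _ cE)) ig _) _.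
  move=> x; rewrite cabsM mulrC ler_wpM2r ?cabs_ge0//.
  by apply: le_trans (intf _ _ cE) _; rewrite ler_wpM2l.
rewrite RintegralZl//; last exact: cintg_cabs.
by rewrite le_eqVlt; apply/orP; left; apply/eqP; ring.
Qed.

Lemma sum_blocks_le (d : nat -> \bar R) N : (forall l, 0 <= d l)%E ->
  (\sum_(m < N) \sum_(j < 4) d (4 * m + 1 + j)%N <= \sum_(0 <= l < 4 * N + 1) d l)%E.
Proof.
move=> d0; elim: N => [|N IH]; first by rewrite big_ord0 sume_ge0.
rewrite big_ord_recr/= mulnSr -addnA (addnC 4) addnA.
rewrite (@big_cat_nat _ _ _ (4 * N + 1))//= ?leq_addr//; apply: leeD => //.
rewrite -{2}[(4 * N + 1)%N]add0n big_addn addKn big_mkord.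
by under [leRHS]eq_bigr do rewrite addnC.
Qed.

Lemma sum_half_le N : \sum_(m < N) 2 ^- m <= 2 :> R.
Proof.
suff -> : \sum_(m < N) 2 ^- m = 2 - 2 * 2 ^- N :> R by rewrite lerBlDr lerDl mulr_ge0// invr_ge0 exprn_ge0.
elim: N => [|N IH]; first by rewrite big_ord0 expr0 invr1; ring.
by rewrite big_ord_recr/= IH exprS invfM; field; rewrite expf_neq0.
Qed.

(** K^2 frequencies cost only K in the amalgam norm, but each of them adds a
    fixed amount to the Besov norm. *)
Lemma not_amalgam_sub_besov (p : R) : 1 <= p ->
  ~ embeds (@amalgam_L2l1 R n.+1) (besov_0p1 psi p).
Proof.
move=> p1 [_ [M M0 hM]].
have [B B0 hB] := lac_tail; have [A A0 hA] := @dist_norm_test R n.+1 p p1.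
pose c : R := expR (- (n.+1)%:R / 8).
have c0 : 0 < c := expR_gt0 _.
suff key (k : nat) : c * (k.+1%:R ^+ 2) <= (2 * B + A * M) * k.+1%:R.
  set X : R := 2 * B + A * M in key; have := key (Num.trunc (X / c)).
  have := truncnS_gt (X / c); rewrite ltr_pdivrMr//.
  by move: (_.+1%:R) (ltr0Sn R (Num.trunc (X / c))) => t t0 h1 h2; nra.
pose K : R := k.+1%:R; pose N := (k.+1 ^ 2)%N.
have K0 : 0 < K by rewrite ltr0n.
have NK : N%:R = K ^+ 2 by rewrite natrX.
set f := @lac R n N; set u := dist_of f.
have cf : cintg mu f := cintg_lac _ _ _.
have am : (amalgam_L2l1 u <= K%:E)%E.
  by apply: (@dist_norm_le _ _ _ f) => //; [exact: cmeas_lac|exact: lac_amalgam].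
have us : Defs.space (@amalgam_L2l1 R n.+1) u.
  by split; [exact: dist_of_tempered|exact: le_lt_trans am (ltry _)].
pose d l := dist_norm (Lp_norm p) (fourier_multiplier (psi l) u).
have d0 l : (0 <= d l)%E := dist_norm_Lp_ge0 _ _.
have sd : (\sum_(m < N) \sum_(j < 4) d (4 * m + 1 + j)%N <= (M * K)%:E)%E.
  apply: le_trans (sum_blocks_le N d0) _.
  apply: le_trans (nneseries_lim_ge _ _) _; first by move=> l *; exact: d0.
  apply: le_trans (hM _ us) _.
  by rewrite EFinM lee_wpmul2l// lee_fin ltW.
pose mt m (j : 'I_4) := cabs (fourier_multiplier (psi (4 * m + 1 + j)%N) u (gauss_wave 1 (freqv R n m))).
have smt : \sum_(m < N) \sum_(j < 4) mt m j <= A * (M * K).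
  rewrite -lee_fin -sumEFin EFinM.
  apply: le_trans (_ : (A%:E * (\sum_(m < N) \sum_(j < 4) d (4 * m + 1 + j)%N) <= _)%E); last first.
    by apply: lee_wpmul2l => //; rewrite lee_fin ltW.
  rewrite ge0_sume_distrr; last by move=> m _; apply: sume_ge0.
  apply: lee_sum => m _; rewrite -sumEFin ge0_sume_distrr//.
  apply: lee_sum => j _; apply: hA; first exact: schwartz_gauss_wave.
  by move=> x; rewrite cabs_gauss_wave.
have := lac_test R n N; rewrite -/f -/u -/c NK => /le_trans; apply.
pose D m := u (gauss_wave 1 (freqv R n m)) - \sum_(j < 4)
    fourier_multiplier (psi (4 * m + 1 + j)%N) u (gauss_wave 1 (freqv R n m)).
rewrite (_ : \sum_(m < N) _ = \sum_(m < N) D m + \sum_(m < N) \sum_(j < 4)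
    fourier_multiplier (psi (4 * m + 1 + j)%N) u (gauss_wave 1 (freqv R n m))); last first.
  by rewrite -big_split/=; apply: eq_bigr => m _; rewrite /D subrK.
apply: le_trans (cabsD _ _) _; rewrite mulrDl; apply: lerD; last first.
  rewrite -mulrA; apply: le_trans smt; apply: le_trans (cabs_sum _ _ _) _.
  by apply: ler_sum => m _; exact: cabs_sum.
apply: le_trans (cabs_sum _ _ _) _.
apply: (@le_trans _ _ (\sum_(m < N) (B * K) * 2 ^- m)); last first.
  rewrite -mulr_sumr [leRHS](_ : _ = B * K * 2); last by rewrite /K; ring.
  by apply: ler_wpM2l (sum_half_le N); apply: mulr_ge0 => //; exact: ltW.
apply: ler_sum => m _; apply: le_trans (hB f m cf) _.
rewrite [leRHS]mulrAC ler_wpM2l ?lac_L1// mulr_ge0// invr_ge0 exprn_ge0//.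
Qed.

End amalgam_not_besov.

(** * Convolution with a kernel dominated by a dilated integrable one *)

Section convolution.
Variables (R : realType) (n : nat).
Local Notation C := R[i].
Local Notation V := 'rV[R]_n.
Local Notation mu := (lebesgue_rV R n).
Implicit Types (f g q phi psi : V -> C) (x y xi : V) (s A B : R).

Definition conv g q x : C := cint mu (fun y => g y * q (x - y)).

Lemma cmeas_conv g q : cmeas g -> cmeas q -> cmeas (conv g q).
Proof.
move=> mg mq; apply: (@cmeas_cint_param _ _ _ _ _ mu (fun z : V * V => g z.2 * q (z.1 - z.2))).
by apply: cmeasM; [exact: cmeas_snd|exact: cmeas_translate2].
Qed.

Lemma ckerneln_shift s x y : ckerneln s 0 (x - y) = ckerneln s y x.
Proof. by apply: eq_bigr => i _; rewrite /ckernel !mxE subr0. Qed.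

Lemma ckerneln_sym s x y : ckerneln s y x = ckerneln s x y.
Proof.
apply: eq_bigr => i _; rewrite /ckernel -[x ord0 i - _]opprB.
by rewrite mulrN sqrrN.
Qed.

Section bounds.
Variables (g q : V -> C) (s A : R).
Hypotheses (s0 : 0 < s) (A0 : 0 <= A) (mq : cmeas q)
  (hq : forall x, cabs (q x) <= A * ckerneln s 0 x).

Lemma conv_L1_le : cintg mu g ->
  (\int[mu]_x (cabs (conv g q x))%:E <= (2 * A * pi ^+ n * \int[mu]_x cabs (g x))%:E)%E.
Proof.
move=> ig; have mg := cintg_cmeas ig; have mc := cmeas_conv mg mq.
pose k (z : V * V) : R := cabs (g z.2) * cabs (q (z.1 - z.2)).
have mk : measurable_fun setT k.
  apply: measurable_funM; first by apply: (measurableT_comp (measurable_cabs mg)).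
  exact: (measurable_cabs (cmeas_translate2 mq)).
have mEk : measurable_fun setT (EFin \o k) by apply/measurable_EFinP.
have k0 z : (0 <= (EFin \o k) z)%E by rewrite lee_fin mulr_ge0 ?cabs_ge0.
have mx x : measurable_fun setT (fun y => (k (x, y))%:E).
  by apply/measurable_EFinP; exact: (measurableT_comp mk (pair1_measurable x)).
have my y : measurable_fun setT (fun x => (k (x, y))%:E).
  by apply/measurable_EFinP; exact: (measurableT_comp mk (pair2_measurable y)).
apply: (@le_trans _ _ (\int[mu]_x (2%:E * \int[mu]_y (k (x, y))%:E))%E).
  apply: ge0_le_integral => //.
  - by move=> x _; rewrite lee_fin cabs_ge0.
  - exact: measurable_cabsE.
  - apply: emeasurable_funM => //.
    exact: (measurable_fun_fubini_tonelli_F (EFin \o k)).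
  move=> x _; apply: le_trans (cint_le mu _) _.
    by apply: cmeasM => //; exact: cmeas_reflect.
  by under eq_integral do rewrite cabsM.
rewrite ge0_integralZl//; last 2 first.
- exact: (measurable_fun_fubini_tonelli_F (EFin \o k)).
- by move=> x _; apply: integral_ge0 => y _; exact: (k0 (x, y)).
rewrite -!mulrA EFinM lee_wpmul2l// ?lee_fin//.
rewrite (@fubini_tonelli _ _ _ _ _ mu mu _ mEk k0)/=.
apply: (@le_trans _ _ (\int[mu]_y ((cabs (g y))%:E * (A * pi ^+ n)%:E))%E).
  apply: ge0_le_integral => //.
  - by move=> y _; apply: integral_ge0 => x _; exact: (k0 (x, y)).
  - exact: (measurable_fun_fubini_tonelli_G (EFin \o k)).
  - by apply: emeasurable_funM => //; apply/measurable_EFinP; exact: measurable_cabs.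
  move=> y _; have [ic ec] := ckerneln_integral y s0.
  have ic' := integrableZl measurableT (cabs (g y) * A) ic.
  have -> : ((cabs (g y))%:E * (A * pi ^+ n)%:E =
      \int[mu]_x ((cabs (g y) * A)%:E * (EFin \o ckerneln s y) x))%E.
    rewrite integralZl// -EFinM mulrA EFinM; congr (_ * _)%E.
    by rewrite -ec /Rintegral fineK//; exact: integrable_fin_num.
  apply: ge0_le_integral => //.
  - by move=> x _; exact: (k0 (x, y)).
  - by case/integrableP : ic'.
  move=> x _; rewrite lee_fin /k/= -mulrA ler_wpM2l ?cabs_ge0//.
  by rewrite -ckerneln_shift.
rewrite ge0_integralZr//; last 3 first.
- exact: measurable_cabsE.
- by move=> y _; rewrite lee_fin cabs_ge0.
- by rewrite lee_fin mulr_ge0// exprn_ge0// pi_ge0.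
rewrite muleC mulrA [leRHS]EFinM; apply: lee_wpmul2l; first by rewrite lee_fin mulr_ge0// exprn_ge0// pi_ge0.
rewrite /Rintegral fineK//; apply: integrable_fin_num => //; exact: cintg_cabs.
Qed.

Lemma cintg_conv : cintg mu g -> cintg mu (conv g q).
Proof.
move=> ig; apply: cintg_finite; first exact: (cmeas_conv (cintg_cmeas ig) mq).
exact: le_lt_trans (conv_L1_le ig) (ltry _).
Qed.

Lemma conv_sup_le B x : cmeas g -> (forall y, cabs (g y) <= B) ->
  cabs (conv g q x) <= 2 * A * pi ^+ n * B.
Proof.
move=> mg gB.
have [ic ec] := ckerneln_integral x s0.
have ig : mu.-integrable setT (EFin \o (fun y => B * A * ckerneln s x y)).
  exact: (integrableZ _ ic).
apply: le_trans (cint_le_dom _ ig _) _.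
- by apply: cmeasM => //; exact: cmeas_reflect.
- move=> y; rewrite cabsM -mulrA ler_pM ?cabs_ge0//.
  by rewrite -ckerneln_sym -ckerneln_shift.
rewrite RintegralZl// ec le_eqVlt; apply/orP; left; apply/eqP; ring.
Qed.

End bounds.

(** The multiplier acts on the test function as a convolution, by
    [fourier_mul_inv], and Fubini moves the convolution to f. *)
Lemma multiplier_represents f psi : cintg mu f -> cintg mu psi ->
  represents (conv f (fourier_inv psi)) (fourier_multiplier psi (dist_of f)).
Proof.
move=> cf cp phi sp; have cph := cintg_schwartz sp.
have mq := cmeas_fourier_inv (cintg_cmeas cp).
pose q := fourier_inv psi; pose B : R := (2 * pi) ^- n * (2 * \int[mu]_x cabs (psi x)).
have hq x : cabs (q x) <= B := cabs_fourier_inv_le x cp.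
transitivity (cint mu (fun x => cint mu (fun y => f x * phi y * q (y - x)))).
  rewrite -[LHS]/(cint mu (fun x => f x * fourier (fun xi => psi xi * fourier_inv phi xi) x)).
  congr cint; apply/funext => x; rewrite fourier_mul_inv// -cintZ; last first.
    under eq_fun do rewrite mulrC; exact: (cintg_mulb (cmeas_translate x mq) (fun y => hq (y - x)) cph).
  by congr cint; apply/funext => y; rewrite mulrA.
pose k (z : V * V) : C := f z.1 * phi z.2 * q (z.2 - z.1).
have mk : cmeas k.
  apply: cmeasM; first by apply: cmeasM; [exact: (cmeas_fst (cintg_cmeas cf))|exact: (cmeas_snd (cintg_cmeas cph))].
  exact: (cmeas_comp (@measurable_swap _ _ V V) (cmeas_translate2 mq)).
have B0 : 0 <= B := le_trans (cabs_ge0 _) (hq 0).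
have ia := cintg_cabs cf; have ib := integrableZl measurableT B (cintg_cabs cph).
have kab z : cabs (k z) <= cabs (f z.1) * (B * cabs (phi z.2)).
  rewrite (cabsM (_ * _)) (cabsM (f _)) -mulrA; apply: ler_wpM2l; first exact: cabs_ge0.
  rewrite [leLHS]mulrC; apply: ler_wpM2r; first exact: cabs_ge0.
  exact: hq.
have b0 y : 0 <= B * cabs (phi y) by rewrite mulr_ge0// cabs_ge0.
rewrite (cdom_swap (m1 := mu) (m2 := mu) (b := fun y => B * cabs (phi y)) ia ib (fun x => cabs_ge0 (f x)) b0 mk kab).
congr cint; apply/funext => y; rewrite /conv [RHS]mulrC -cintZ; last first.
  under eq_fun do rewrite mulrC; exact: (cintg_mulb (cmeas_reflect y mq) (fun x => hq (y - x)) cf).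
by congr cint; apply/funext => x; rewrite -[LHS]/(f x * phi y * q (y - x)) -mulrA mulrCA.
Qed.

End convolution.

(** * The Besov space is not contained in the amalgam space *)

Section besov_not_amalgam.
Variables (R : realType) (n : nat).
Local Notation C := R[i].
Local Notation V := 'rV[R]_n.
Local Notation mu := (lebesgue_rV R n).
Variable psi : nat -> V -> C.
Hypothesis hpsi : dyadic_partition psi.
Implicit Types (f g phi : V -> C) (x xi : V) (k l : nat) (s p : R).

Lemma gauss_wave0 s x : gauss_wave s 0 x = (gaussn s 0 x)%:C.
Proof.
rewrite /gauss_wave (_ : dotp 0 x = 0) ?oppr0 ?cexpi0 ?mul1r//.
by rewrite /dotp big1// => i _; rewrite mxE mul0r.
Qed.

(** A cut-off: 1 for |xi| < 2^k by [psi_sum], and 0 for |xi| > 2^(k+1) by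
    [psi_supp]. *)
Definition low k xi : C := \sum_(l < k.+1) psi l xi.

(** The Gaussian of width 1/s and integral 1, with its spectrum cut off. *)
Definition bump k s : V -> C := fourier_inv (fun xi => low k xi * gauss_wave s 0 xi).

Lemma cintg_psi_mul l g : cintg mu g -> cintg mu (fun xi => psi l xi * g xi).
Proof.
have [C0 _ hC] := psi_bound hpsi.
exact: cintg_mulb (cintg_cmeas (psi_cintg hpsi l)) (hC l).
Qed.

Lemma cintg_low_mul k g : cintg mu g -> cintg mu (fun xi => low k xi * g xi).
Proof.
move=> ig; under eq_fun do rewrite mulr_suml.
by apply: cintg_sum => l; exact: cintg_psi_mul.
Qed.

Lemma bumpE k s x : 0 < s -> bump k s x =
  \sum_(l < k.+1) conv (fourier_inv (gauss_wave s 0)) (fourier_inv (psi l)) x.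
Proof.
move=> s0; have ig := cintg_fourier_inv_gauss_wave (0 : V) s0.
transitivity (\sum_(l < k.+1) fourier_inv (fun xi => psi l xi * gauss_wave s 0 xi) x).
  rewrite /bump /fourier_inv -mulr_sumr; congr (_ * _).
  rewrite -[RHS](cint_sum (mu := mu)) => [|l].
    by congr cint; apply/funext => xi; rewrite -mulr_sumr /low mulr_suml.
  apply: cintg_cexpi; first exact: measurable_dotp2.
  exact/cintg_psi_mul/cintg_gauss_wave.
apply: eq_bigr => l _; rewrite -{1}(fourierK_gauss_wave (0 : V) s0).
exact: (fourier_inv_mul _ (psi_cintg hpsi l) ig).
Qed.

Lemma psi_conv : exists2 D : R, 0 < D & forall l f, cintg mu f ->
  [/\ cmeas (conv f (fourier_inv (psi l))), cintg mu (conv f (fourier_inv (psi l))),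
   (\int[mu]_x (cabs (conv f (fourier_inv (psi l)) x))%:E <= (D * \int[mu]_x cabs (f x))%:E)%E &
   forall B x, (forall y, cabs (f y) <= B) -> cabs (conv f (fourier_inv (psi l)) x) <= D * B].
Proof.
have [C1 C10 hC] := psi_kernel hpsi.
have C0 : 0 < C1 + 1 by apply: ltr_wpDl.
exists (2 * (C1 + 1) * pi ^+ n) => [|l f cf].
  by apply: mulr_gt0; [exact: mulr_gt0|exact: exprn_gt0 (pi_gt0 R)].
have l0 : 0 < 2 ^+ l :> R by exact: exprn_gt0.
have mq := cmeas_fourier_inv (cintg_cmeas (psi_cintg hpsi l)).
have hq x : cabs (fourier_inv (psi l) x) <= (C1 + 1) * ckerneln (2 ^+ l) 0 x.
  apply: le_trans (hC l x) _; apply: ler_wpM2r; last by rewrite lerDl.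
  by apply: ckerneln_ge0; exact: ltW.
split.
- exact: cmeas_conv (cintg_cmeas cf) mq.
- exact: cintg_conv l0 (ltW C0) mq hq cf.
- exact: conv_L1_le l0 (ltW C0) mq hq cf.
- by move=> B x gB; exact: (conv_sup_le l0 mq hq x (cintg_cmeas cf) gB).
Qed.

(** The k + 1 summands of the cut-off are bounded one by one: the loss of a
    factor k + 1 is harmless. *)
Lemma bump_bounds : exists2 D : R, 0 < D & forall k s, 0 < s ->
  [/\ cintg mu (bump k s), \int[mu]_x cabs (bump k s x) <= D * k.+1%:R &
   forall x, cabs (bump k s x) <= D * k.+1%:R * gauss_cst n s].
Proof.
have [D D0 hD] := psi_conv; exists D => // k s s0.
pose g : V -> C := fourier_inv (gauss_wave s 0).
have cg : cintg mu g := cintg_fourier_inv_gauss_wave (0 : V) s0.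
have s0' : 0 < s^-1 by rewrite invr_gt0.
have gc0 : 0 < gauss_cst n s := gauss_cst_gt0 n s0.
have ag x : cabs (g x) = gauss_cst n s * gaussn s^-1 0 x.
  rewrite /g fourier_inv_gauss_wave// cabs_real ger0_norm//.
  by apply: mulr_ge0; [exact: ltW|exact/ltW/gaussn_gt0].
have [iG eG] := gaussn_integral (0 : V) s0'.
have g1 : \int[mu]_x cabs (g x) = 1.
  under eq_Rintegral do rewrite ag.
  by rewrite RintegralZl// eG gauss_cstV.
have gs x : cabs (g x) <= gauss_cst n s.
  by rewrite ag ler_piMr ?gaussn_le1// ltW.
have bE : bump k s = fun x => \sum_(l < k.+1) conv g (fourier_inv (psi l)) x.
  by apply/funext => x; exact: bumpE.
have cc (l : 'I_k.+1) : cintg mu (conv g (fourier_inv (psi l))) by have [] := hD l g cg.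
have cb : cintg mu (bump k s) by rewrite bE; exact: cintg_sum.
split => //.
  rewrite -lee_fin /Rintegral fineK; last by apply: integrable_fin_num => //; exact: cintg_cabs.
  apply: (@le_trans _ _ (\int[mu]_x \sum_(l < k.+1) (cabs (conv g (fourier_inv (psi l)) x))%:E)%E).
    apply: ge0_le_integral => //.
    - by move=> x _; rewrite lee_fin cabs_ge0.
    - by apply: measurable_cabsE; exact: cintg_cmeas cb.
    - apply: emeasurable_sum => l; apply/measurable_EFinP; apply: measurable_cabs.
      exact: cintg_cmeas (cc l).
    by move=> x _; rewrite bE sumEFin lee_fin; exact: cabs_sum.
  rewrite ge0_integral_sum//; last 2 first.
  - by move=> l; apply: measurable_cabsE; exact: cintg_cmeas (cc l).
  - by move=> l x _; rewrite lee_fin cabs_ge0.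
  apply: (@le_trans _ _ (\sum_(l < k.+1) D%:E)%E).
    apply: lee_sum => l _; have [_ _ h _] := hD l g cg.
    by rewrite g1 mulr1 in h.
  by rewrite sumEFin sumr_const card_ord mulr_natr.
move=> x; rewrite bE; apply: le_trans (cabs_sum _ _ _) _.
apply: (@le_trans _ _ (\sum_(l < k.+1) D * gauss_cst n s)).
  by apply: ler_sum => l _; have [_ _ _ h] := hD l g cg; exact: h.
by rewrite sumr_const card_ord -[X in X <= _]mulr_natr mulrAC.
Qed.

Lemma qdistC (x y : V) : qdist x y = qdist y x.
Proof. by apply: eq_bigr => i _; rewrite -[x ord0 i - _]opprB sqrrN. Qed.

(** The spectrum of [bump k s] lies in the ball of radius 2^(k+1), while [psi l]
    vanishes inside the ball of radius 2^(k+2). *)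
Lemma multiplier_bump_eq0 k l s phi : 0 < s -> (k.+3 <= l)%N -> schwartz phi ->
  fourier_multiplier (psi l) (dist_of (bump k s)) phi = 0.
Proof.
move=> s0 kl sp; have [D _ hD] := bump_bounds; have [cb _ _] := hD k s s0.
have ct := cintg_low_mul k (cintg_gauss_wave (0 : V) s0).
have mphi : cmeas (fourier_inv phi) by apply: cmeas_fourier_inv; exact: cmeas_schwartz.
have cphi := cintg_schwartz sp.
have cp : cintg mu (fun xi => psi l xi * fourier_inv phi xi).
  under eq_fun do rewrite mulrC.
  exact: cintg_mulb mphi (fun xi => cabs_fourier_inv_le xi cphi) (psi_cintg hpsi l).
rewrite -[LHS]/(cint mu (fun x => bump k s x * fourier (fun xi => psi l xi * fourier_inv phi xi) x)).
rewrite fourier_swap// -[RHS](cint0 mu); congr cint; apply/funext => xi.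
have [->|p0] := eqVneq (psi l xi) 0; first by rewrite !mul0r.
rewrite (fourier_fourier_inv_eq0 (d := (2 ^+ k.+1) ^+ 2) ct cb) ?mulr0//.
move=> eta; rewrite mulf_eq0 negb_or => /andP[t0 _].
have e1 : euclid eta <= 2 ^+ k.+1.
  have [j pj] : exists j : 'I_k.+1, psi j eta != 0.
    apply/existsP; rewrite -negb_forall; apply: contra t0 => /forallP h.
    by rewrite /low big1// => j _; apply/eqP; exact: h.
  by apply: le_trans (psi_supp hpsi pj) _; apply: ler_weXn2l; rewrite ?ler1n.
have e2 : 2 ^+ k.+2 <= euclid xi.
  case: l kl p0 {cp} => // l kl /(psi_supp_low hpsi); apply: le_trans.
  by apply: ler_weXn2l; rewrite ?ler1n.
have := euclid_sqr_le xi eta; rewrite qdistC.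
have := euclid_ge0 eta; have e0 : 0 < 2 ^+ k.+1 :> R by rewrite exprn_gt0.
move: e1 e2 e0; rewrite (exprS _ k.+1).
by move: (2 ^+ k.+1) (euclid eta) (euclid xi) (qdist _ _) => a b c d; nra.
Qed.

(** At most k + 3 blocks are nonzero, and each is bounded by interpolation between
    L^1 and the sup norm. *)
Lemma besov_bump : exists2 D : R, 0 < D & forall k s p, 0 < s -> 1 <= p ->
  (besov_0p1 psi p (dist_of (bump k s)) <=
   (D * k.+3%:R ^+ 2 * gauss_cst n s `^ ((p - 1) / p))%:E)%E.
Proof.
have [D1 D10 hD1] := psi_conv; have [D2 D20 hD2] := bump_bounds.
have D0 : 0 < D1 * D2 by exact: mulr_gt0.
exists (D1 * D2) => // k s p s0 p1; have [cb b1 b2] := hD2 k s s0.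
have p0 : 0 < p by lra.
have gc0 : 0 < gauss_cst n s := gauss_cst_gt0 n s0.
pose W : R := D1 * D2 * k.+1%:R; have W0 : 0 < W by apply: mulr_gt0.
pose Z : R := W * gauss_cst n s `^ ((p - 1) / p).
have Z0 : 0 <= Z by apply: mulr_ge0; [exact: ltW|exact: powR_ge0].
pose d l := dist_norm (Lp_norm p) (fourier_multiplier (psi l) (dist_of (bump k s))).
have dZ l : (d l <= Z%:E)%E.
  have [m1 _ i1 s1] := hD1 l _ cb.
  apply: (dist_norm_le m1); first exact: multiplier_represents cb (psi_cintg hpsi l).
  have -> : Z = ((W * gauss_cst n s) `^ (p - 1) * W) `^ p^-1.
    have WE : W `^ (p - 1) * W = W `^ p.
      rewrite -{2}(powRr1 (ltW W0)) -powRD ?subrK//.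
      by rewrite (gt_eqF W0) implybT.
    rewrite (powRM _ (ltW W0) (ltW gc0)) mulrAC WE powRM ?powR_ge0// -!powRrM.
    by rewrite divff ?gt_eqF// powRr1// ltW.
  apply: Lp_norm_le => //; first exact: mulr_gt0.
    move=> x; apply: le_trans (s1 _ x b2) _.
    by rewrite /W !mulrA.
  apply: le_trans i1 _; rewrite lee_fin /W -mulrA.
  by apply: ler_wpM2l => //; exact: ltW.
have d0 l : (k.+3 <= l)%N -> d l = 0%E.
  move=> kl; apply/eqP; rewrite eq_le dist_norm_Lp_ge0 andbT.
  apply: (@dist_norm_le _ _ _ (fun=> 0)).
  - exact: cmeas_cst.
  - move=> phi sp; rewrite multiplier_bump_eq0//.
    by rewrite -[RHS]/(cint mu (fun x => 0 * phi x)); under eq_fun do rewrite mul0r; rewrite cint0.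
  have -> : (0 : \bar R)%E = ((1 `^ (p - 1) * 0) `^ p^-1)%:E.
    by rewrite mulr0 powR0// invr_eq0 gt_eqF.
  apply: Lp_norm_le => //; first by move=> x; rewrite cabs0.
  by under eq_integral do rewrite cabs0; rewrite integral0.
rewrite /besov_0p1 (nneseries_split 0 k.+3); last by move=> l _; exact: dist_norm_Lp_ge0.
rewrite add0n (eseries0 (N := k.+3)) ?adde0; last by move=> l kl _; exact: d0.
apply: (@le_trans _ _ (\sum_(0 <= l < k.+3) Z%:E)%E); first by apply: lee_sum => l _; exact: dZ.
rewrite big_mkord sumEFin sumr_const card_ord lee_fin -[leLHS]mulr_natr /Z /W.
rewrite [leLHS](_ : _ = D1 * D2 * (k.+1%:R * k.+3%:R) * gauss_cst n s `^ ((p - 1) / p)); last by ring.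
apply: ler_wpM2r; first exact: powR_ge0.
apply: ler_wpM2l; first exact: ltW.
by rewrite -natrM -natrX ler_nat expnS expn1 leq_mul2r/= leqW// leqW.
Qed.

Lemma gaussn_sqr s x : gaussn s 0 x ^+ 2 = gaussn (s / Num.sqrt 2) 0 x.
Proof.
have [->|s0] := eqVneq s 0.
  by rewrite !gaussnE mul0r expr0n/= mul0rn invr0 mulr0 expR0 expr1n.
rewrite !gaussnE expr2 -expRD exprMn exprVn sqr_sqrtr//; congr expR.
by field.
Qed.

Lemma gaussn_le_far s k xi : 0 < s -> 2 ^+ k <= euclid xi ->
  gaussn s 0 xi <= 2 * s ^+ 2 * 4 ^- k.
Proof.
move=> s0 h; have e0 : 0 < 2 ^+ k :> R by rewrite exprn_gt0.
have k0 : 0 < 4 ^+ k :> R by rewrite exprn_gt0.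
have hq : 4 ^+ k <= qdist xi 0.
  rewrite -euclid_sqr (_ : 4 ^+ k = (2 ^+ k) ^+ 2); last by rewrite exprAC; congr (_ ^+ k); ring.
  by apply: lerXn2r => //; rewrite nnegrE ?euclid_ge0// ltW.
have q0 : 0 < qdist xi 0 := lt_le_trans k0 hq.
have s20 : 0 < s ^+ 2 *+ 2 by rewrite mulrn_wgt0// exprn_gt0.
rewrite gaussnE mulNr; apply: le_trans (expRN_le 0 (divr_gt0 q0 s20)) _.
rewrite expr1 div1r invf_div -[s ^+ 2 *+ 2]mulr_natl; apply: ler_wpM2l.
  by rewrite mulr_natl ltW.
by rewrite lef_pV2 ?posrE.
Qed.

(** Without the cut-off the pairing is the integral of the square of a Gaussian
    in a scale-invariant normalization, namely 2^(-n/2); the cut-off changes the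
    integrand only where |xi| >= 2^k. *)
Lemma bump_test : exists2 D : R, 0 < D & forall k s, 0 < s ->
  (Num.sqrt 2) ^- n <= cabs (dist_of (bump k s) (gauss_wave s^-1 0)) +
    D * k.+1%:R * s ^+ 2 * 4 ^- k.
Proof.
have [C0 C00 hC] := psi_bound hpsi.
exists (4 * (1 + C0)) => [|k s s0]; first by apply: mulr_gt0 => //; apply: ltr_pwDl.
have s0' : 0 < s^-1 by rewrite invr_gt0.
have t0 : 0 < s / Num.sqrt 2 by rewrite divr_gt0// sqrtr_gt0.
pose c : R := gauss_cst n s^-1; have c0 : 0 < c := gauss_cst_gt0 n s0'.
have cK : c * (Num.sqrt (2 * pi) * s) ^+ n = 1 by have := gauss_cstV n s0'; rewrite invrK.
pose G xi : C := (c * gaussn s 0 xi ^+ 2)%:C.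
have [i2 e2] := gaussn_integral (0 : V) t0.
have ir : mu.-integrable setT (EFin \o (fun xi => c * gaussn s 0 xi ^+ 2)).
  have := integrableZl measurableT c i2; apply: eq_integrable => // xi _.
  by rewrite /= gaussn_sqr.
have cG : cintg mu G.
  apply: (cintg_le _ ir).
    by apply: cmeas_real; apply/measurable_EFinP; exact: measurable_int ir.
  move=> xi; rewrite cabs_real ger0_norm//.
  by apply: mulr_ge0; [exact: ltW|exact: sqr_ge0].
have mG : cint mu G = ((Num.sqrt 2) ^- n)%:C.
  rewrite cint_real; congr _%:C.
  under eq_Rintegral do rewrite gaussn_sqr.
  by rewrite RintegralZl// e2 mulrA exprMn mulrA cK mul1r exprVn.
have E : dist_of (bump k s) (gauss_wave s^-1 0) = cint mu (fun xi => low k xi * G xi).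
  have ct := cintg_low_mul k (cintg_gauss_wave (0 : V) s0).
  rewrite -[LHS]/(cint mu (fun x => bump k s x * gauss_wave s^-1 0 x)).
  under eq_fun do rewrite mulrC.
  rewrite (fourier_inv_swap ct (cintg_gauss_wave (0 : V) s0')).
  congr cint; apply/funext => xi; rewrite fourier_inv_gauss_wave// invrK gauss_wave0.
  by rewrite -mulrA -RCM /G /c expr2 mulrCA.
have [i1 e1] := gaussn_integral (0 : V) s0.
pose e : R := c * ((1 + C0) * k.+1%:R * (2 * s ^+ 2 * 4 ^- k)).
have e0 : 0 <= e.
  apply: mulr_ge0; first exact: ltW.
  apply: mulr_ge0; first by apply: mulr_ge0 => //; exact: addr_ge0.
  by apply: mulr_ge0; [apply: mulr_ge0 => //; exact: sqr_ge0|rewrite invr_ge0 exprn_ge0].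
have ie : mu.-integrable setT (EFin \o (fun xi => e * gaussn s 0 xi)).
  exact: (integrableZ _ i1).
have clG := cintg_low_mul k cG; have cB : cintg mu (fun xi => G xi - low k xi * G xi).
  by have := cintgD cG (cintgZ (-1) clG); under eq_fun do rewrite mulN1r.
have err : cabs (cint mu (fun xi => G xi - low k xi * G xi)) <= 4 * (1 + C0) * k.+1%:R * s ^+ 2 * 4 ^- k.
  apply: le_trans (cint_le_dom (cintg_cmeas cB) ie _) _; last first.
    rewrite RintegralZl// e1 [leLHS](_ : _ = 2 * ((1 + C0) * k.+1%:R * (2 * s ^+ 2 * 4 ^- k)) *
      (c * (Num.sqrt (2 * pi) * s) ^+ n)); last by rewrite /e; ring.
    by rewrite cK mulr1 le_eqVlt; apply/orP; left; apply/eqP; ring.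
  move=> xi; rewrite -[X in X - _]mul1r -mulrBl cabsM cabs_real.
  have g0 := gaussn_gt0 s 0 xi.
  rewrite ger0_norm; last by apply: mulr_ge0; [exact: ltW|exact: sqr_ge0].
  have [h|h] := ltP (euclid xi) (2 ^+ k).
    rewrite /low (psi_sum hpsi h) subrr cabs0 mul0r; apply: mulr_ge0; last exact: ltW.
    exact: e0.
  rewrite [leLHS](_ : _ = c * (cabs (1 - low k xi) * gaussn s 0 xi) * gaussn s 0 xi); last first.
    by move: (cabs _) => a; ring.
  apply: ler_wpM2r; first exact: ltW.
  apply: ler_wpM2l; first exact: ltW.
  apply: ler_pM; [exact: cabs_ge0|exact: ltW| |exact: gaussn_le_far].
  apply: le_trans (cabsB _ _) _; rewrite cabs1.
  apply: (@le_trans _ _ (1 + k.+1%:R * C0)).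
    rewrite lerD2l; apply: le_trans (cabs_sum _ _ _) _.
    apply: le_trans (ler_sum _ (fun j _ => hC _ _)) _.
    by rewrite sumr_const card_ord mulr_natl.
  by rewrite mulrDl mul1r (mulrC C0) lerD2r ler1n.
rewrite -[leLHS]ger0_norm; last by rewrite invr_ge0 exprn_ge0// sqrtr_ge0.
rewrite -cabs_real -mG E.
rewrite (_ : cint mu G = cint mu (fun xi => low k xi * G xi) + cint mu (fun xi => G xi - low k xi * G xi)).
  by apply: le_trans (cabsD _ _) _; rewrite lerD2l.
by rewrite cintB// addrC subrK.
Qed.

Lemma cube_measure (nu : 'rV[int]_n) : mu (cube nu) = 1%E.
Proof.
have -> : cube nu = [set x | forall i, x ord0 i \in
    `[(\row_i ((nu ord0 i)%:~R - 2^-1) : V) ord0 i, (\row_i ((nu ord0 i)%:~R + 2^-1) : V) ord0 i]].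
  apply/seteqP; split => x h i; have := h i; rewrite !mxE in_itv/= ler_distl; lra.
rewrite lebesgue_rV_box => [|i]; last by rewrite !mxE; lra.
congr EFin; apply: big1 => i _; rewrite !mxE; lra.
Qed.

End besov_not_amalgam.

(** * Conclusion *)

Section conclusion.
Variables (R : realType) (n : nat).
Local Notation V := 'rV[R]_n.
Local Notation mu := (lebesgue_rV R n).
Variable psi : nat -> V -> R[i].
Hypothesis hpsi : dyadic_partition psi.

Lemma harmonic_contra (c X : R) : 0 < c -> ~ (forall i : nat, c <= X / i.+1%:R).
Proof.
move=> c0 h; have := h (Num.trunc (X / c)).
have := truncnS_gt (X / c); rewrite ltr_pdivrMr// ler_pdivlMr//.
by rewrite mulrC => h1 h2; have := lt_le_trans h1 h2; rewrite ltxx.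
Qed.

(** The embedding would force this inequality at all scales: 2 B bounds the norm
    of the test Gaussian as a functional on the amalgam space, and the last term
    is the error of the cut-off. *)
Lemma embedding_bump (p : R) : 1 <= p ->
  embeds (besov_0p1 psi p) (@amalgam_L2l1 R n) ->
  exists2 D : R, 0 < D & forall k (s B : R), 0 < s -> 0 < B ->
  (forall nu, \int[mu]_(x in cube nu) (gaussn s^-1 0 x ^+ 2)%:E <= (B ^+ 2)%:E)%E ->
  (Num.sqrt 2) ^- n <= D * (B * k.+3%:R ^+ 2 * gauss_cst n s `^ ((p - 1) / p) +
    k.+1%:R * s ^+ 2 * 4 ^- k).
Proof.
move=> p1 [_ [M M0 hM]].
have [D1 D10 h1] := besov_bump hpsi; have [D2 D20 h2] := bump_test hpsi.
have [D3 D30 h3] := bump_bounds hpsi.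
have MD : 0 < 2 * M * D1 by apply: mulr_gt0 => //; exact: mulr_gt0.
exists (2 * M * D1 + D2) => [|k s B s0 B0 hB]; first exact: addr_gt0.
have s0' : 0 < s^-1 by rewrite invr_gt0.
have [cb _ _] := h3 k s s0; set u := dist_of (bump psi k s).
set g := gauss_cst n s `^ _.
have g0 : 0 <= g by exact: powR_ge0.
have bu : (besov_0p1 psi p u <= (D1 * k.+3%:R ^+ 2 * g)%:E)%E by exact: h1.
have us : Defs.space (besov_0p1 psi p) u.
  by split; [exact: dist_of_tempered|exact: le_lt_trans bu (ltry _)].
have hu : cabs (u (gauss_wave s^-1 0)) <= 2 * M * D1 * (B * k.+3%:R ^+ 2 * g).
  rewrite -lee_fin; apply: le_trans (amalgam_test u (schwartz_gauss_wave 0 s0') B0 _) _.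
    move=> nu; under eq_integral do rewrite gauss_wave0 cabs_real real_normK ?num_real//.
    exact: hB.
  rewrite (_ : 2 * M * D1 * _ = 2 * B * (M * (D1 * k.+3%:R ^+ 2 * g))); last by ring.
  rewrite [leRHS]EFinM; apply: lee_wpmul2l; first by rewrite lee_fin mulr_ge0// ltW.
  apply: le_trans (hM _ us) _; rewrite [leRHS]EFinM; apply: lee_wpmul2l bu.
  by rewrite lee_fin ltW.
apply: le_trans (h2 k s s0) _.
have x0 : 0 <= B * k.+3%:R ^+ 2 * g by apply: mulr_ge0 => //; apply: mulr_ge0; [exact: ltW|exact: sqr_ge0].
have y0 : 0 <= k.+1%:R * s ^+ 2 * 4 ^- k.
  by apply: mulr_ge0; [apply: mulr_ge0 => //; exact: sqr_ge0|rewrite invr_ge0 exprn_ge0].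
rewrite -/u [X in _ + X](_ : _ = D2 * (k.+1%:R * s ^+ 2 * 4 ^- k)); last by rewrite !mulrA.
rewrite mulrDl !mulrDr; move: hu x0 y0; move: (cabs _) (B * _ * g) (_ * 4 ^- k) => a x y hu x0 y0.
have := mulr_ge0 (ltW D20) x0; have := mulr_ge0 (ltW MD) y0; lra.
Qed.

Lemma gaussn_cube_le (s : R) (nu : 'rV[int]_n) (h : V -> \bar R) :
  measurable_fun setT h -> (forall x, (gaussn s 0 x)%:E <= h x)%E ->
  (\int[mu]_(x in cube nu) (gaussn s 0 x ^+ 2)%:E <= \int[mu]_(x in cube nu) h x)%E.
Proof.
move=> mh gh; apply: ge0_le_integral => //.
- exact: measurable_cube.
- by move=> x _; rewrite lee_fin sqr_ge0.
- apply: (measurable_funS measurableT) => //; apply/measurable_EFinP.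
  by apply: measurable_funX; exact: measurable_gaussn.
- exact: (measurable_funS measurableT).
move=> x _; apply: le_trans (gh x).
by rewrite lee_fin expr2 ler_piMl ?gaussn_le1// ltW// gaussn_gt0.
Qed.

Lemma gaussn_cube_le1 (s : R) (nu : 'rV[int]_n) :
  (\int[mu]_(x in cube nu) (gaussn s 0 x ^+ 2)%:E <= (1 ^+ 2)%:E)%E.
Proof.
apply: le_trans (gaussn_cube_le (h := cst 1%E) _ _ _) _ => //.
  by move=> x; rewrite lee_fin gaussn_le1.
rewrite integral_cst; last exact: measurable_cube.
by rewrite mul1e expr1n le_eqVlt; apply/orP; left; apply/eqP; exact: cube_measure.
Qed.

Lemma gaussn_cube_le_integral (s B : R) (nu : 'rV[int]_n) : 0 < s ->
  (Num.sqrt (2 * pi) * s) ^+ n <= B ->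
  (\int[mu]_(x in cube nu) (gaussn s 0 x ^+ 2)%:E <= B%:E)%E.
Proof.
move=> s0 sB; have [i1 e1] := gaussn_integral (0 : V) s0.
have mg : measurable_fun setT (fun x : V => (gaussn s 0 x)%:E).
  by apply/measurable_EFinP; exact: measurable_gaussn.
apply: le_trans (gaussn_cube_le nu mg _) _ => //.
apply: (@le_trans _ _ (\int[mu]_x (gaussn s 0 x)%:E)%E).
  apply: ge0_subset_integral => //; first exact: measurable_cube.
  by move=> x _; rewrite lee_fin ltW// gaussn_gt0.
rewrite -lee_fin in sB; apply: le_trans sB.
by rewrite -e1 /Rintegral fineK//; apply: integrable_fin_num.
Qed.

Lemma succ_le_exp2 i : i.+1%:R <= 2 ^+ i :> R.
Proof. by rewrite -natrX ler_nat ltn_expl. Qed.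

(** Narrow bumps, with s = 256^i and k = 16 i: the dual norm of the test function
    is O(16^-i), the Besov norm O((i + 1)^2), and s^2 4^-k = 2^(-16 i). *)
Lemma not_besov_sub_amalgam1 : (0 < n)%N ->
  ~ embeds (besov_0p1 psi 1) (@amalgam_L2l1 R n).
Proof.
move=> n0 /(embedding_bump (lexx 1))[D D0 hD].
pose w : R := Num.sqrt (2 * pi); have w0 : 0 < w by rewrite sqrtr_gt0 mulr_gt0// pi_gt0.
pose P : R := Num.sqrt (w ^+ n); have P0 : 0 < P by rewrite sqrtr_gt0 exprn_gt0.
(* All terms are bounded by multiples of 1 / (i + 1), since 16^i = (2^i)^4 is at
   least (i + 1)^4. *)
apply: (@harmonic_contra ((Num.sqrt 2) ^- n) (D * (256 * P + 16))).
  by rewrite invr_gt0 exprn_gt0// sqrtr_gt0.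
move=> i; pose a : R := 16 ^+ i; have a0 : 0 < a by rewrite exprn_gt0.
have a1 : 1 <= a by rewrite exprn_ege1// ler1n.
have s0 : 0 < a ^+ 2 by rewrite exprn_gt0.
have B0 : 0 < P / a by rewrite divr_gt0.
have hB nu : (\int[mu]_(x in cube nu) (gaussn (a ^+ 2)^-1 0 x ^+ 2)%:E <= ((P / a) ^+ 2)%:E)%E.
  apply: gaussn_cube_le_integral; first by rewrite invr_gt0.
  rewrite !exprMn -/w [P ^+ 2]sqr_sqrtr ?exprn_ge0 ?(ltW w0)//.
  apply: ler_wpM2l; first by rewrite exprn_ge0// ltW.
  rewrite !exprVn lef_pV2 ?posrE ?exprn_gt0//.
  by apply: ler_eXnr; rewrite // exprn_ege1.
apply: le_trans (hD (16 * i)%N _ _ s0 B0 hB) _.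
rewrite -[leRHS]mulrA; apply: ler_wpM2l; first exact: ltW.
rewrite subrr mul0r powRr0 mulr1 mulrDl.
set t : R := i.+1%:R; have t1 : 1 <= t by rewrite ler1n.
have ta : t ^+ 4 <= a.
  rewrite /a (_ : 16 ^+ i = (2 ^+ i) ^+ 4 :> R); last first.
    by rewrite exprAC; congr (_ ^+ i); ring.
  by apply: lerXn2r; rewrite ?nnegrE// succ_le_exp2.
have e3 : (16 * i).+3%:R <= 16 * t :> R.
  by rewrite /t -natrM ler_nat mulnS -addn3 addnC leq_add2r.
have e1 : (16 * i).+1%:R <= 16 * t :> R.
  by rewrite /t -natrM ler_nat mulnS -addn1 addnC leq_add2r.
have e4 : (4 ^+ (16 * i))^-1 = (a ^+ 8)^-1 :> R.
  congr _^-1; rewrite /a exprM [RHS]exprAC; congr (_ ^+ i); ring.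
rewrite e4.
have t0 : 0 < t by lra.
have ht : t ^+ 2 / a <= t^-1.
  rewrite ler_pdivrMr// mulrC ler_pdivlMr// -exprSr.
  by apply: le_trans ta; apply: ler_weXn2l.
apply: lerD.
  rewrite [leLHS](_ : _ = P * ((16 * i).+3%:R ^+ 2 / a)); last by ring.
  rewrite [leRHS](_ : _ = P * (256 * t^-1)); last by ring.
  apply: ler_wpM2l; first exact: ltW.
  apply: le_trans (_ : (16 * t) ^+ 2 / a <= _).
    apply: ler_wpM2r; first by rewrite invr_ge0 ltW.
    apply: lerXn2r; rewrite ?nnegrE//.
    by rewrite mulr_ge0.
  rewrite (_ : _ / a = 256 * (t ^+ 2 / a)); last by ring.
  by apply: ler_wpM2l ht; exact: ler0n.
rewrite -mulrA (_ : (a ^+ 2) ^+ 2 / a ^+ 8 = (a ^+ 4)^-1); last by field; rewrite gt_eqF.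
apply: (@le_trans _ _ (16 * t * a^-1)).
  apply: ler_pM => //; first by rewrite invr_ge0 exprn_ge0// ltW.
  rewrite lef_pV2 ?posrE ?exprn_gt0//.
  by apply: ler_eXnr.
rewrite -mulrA; apply: ler_wpM2l => //; apply: le_trans ht.
apply: ler_wpM2r; first by rewrite invr_ge0 ltW.
by apply: ler_eXnr.
Qed.

(** Wide bumps, with k = 0 and s small: the Besov norm tends to 0 with s, because
    the exponent 1 - 1/p is positive. *)
Lemma not_besov_sub_amalgam_gt1 (p : R) : (0 < n)%N -> 1 < p ->
  ~ embeds (besov_0p1 psi p) (@amalgam_L2l1 R n).
Proof.
move=> n0 p1 /(embedding_bump (ltW p1))[D D0 hD].
pose c : R := (Num.sqrt 2) ^- n; have c0 : 0 < c by rewrite invr_gt0 exprn_gt0// sqrtr_gt0.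
pose a : R := (p - 1) / p; have a0 : 0 < a by rewrite divr_gt0; lra.
pose K : R := gauss_cst n 1; have K0 : 0 < K by exact: gauss_cst_gt0.
pose e : R := c / (40 * D); have e0 : 0 < e by rewrite divr_gt0// mulr_gt0.
have ea0 : 0 < e `^ a^-1 by exact: powR_gt0.
pose s : R := Num.min 1 (Num.min e (e `^ a^-1 / K)).
have s0 : 0 < s by rewrite !lt_min ltr01 e0 divr_gt0.
have [s1 se sK] : [/\ s <= 1, s <= e & s <= e `^ a^-1 / K].
  by rewrite /s !ge_min !lexx ?orbT.
have hg : gauss_cst n s `^ a <= e.
  have -> : e = (e `^ a^-1) `^ a by rewrite -powRrM mulVf ?gt_eqF// powRr1// ltW.
  apply: (ge0_ler_powR (ltW a0)); rewrite ?nnegrE; [exact/ltW/gauss_cst_gt0|exact: ltW|].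
  apply: (@le_trans _ _ (s * K)); last by rewrite -ler_pdivlMr.
  have -> : gauss_cst n s = s ^+ n * K.
    by rewrite /K /gauss_cst mulr1 (exprMn _ (Num.sqrt _) s) mulrA mulrC.
  apply: ler_wpM2r; first exact: ltW.
  by apply: ler_iXnr; rewrite // ltW.
have s2 : s ^+ 2 <= e by rewrite expr2; apply: le_trans se; rewrite ler_piMl// ltW.
have De : D * e = c / 40 by rewrite /e; field; rewrite gt_eqF.
have := hD 0%N s 1 s0 ltr01 (fun nu => gaussn_cube_le1 _ nu).
rewrite -/a -/c expr0 invr1 !mul1r mulr1 => h.
have h2 : 3 ^+ 2 * gauss_cst n s `^ a + s ^+ 2 <= 10 * e by lra.
have := ler_wpM2l (ltW D0) h2; lra.
Qed.

End conclusion.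

Theorem proposition1p3 (R : realType) (n : nat) (hn : (1 <= n)%N)
    (psi : nat -> 'rV[R]_n -> R[i]) (hpsi : dyadic_partition psi)
    (p : R) (hp : 1 <= p <= 2) :
  ~ embeds (@amalgam_L2l1 R n) (besov_0p1 psi p) /\
  ~ embeds (besov_0p1 psi p) (@amalgam_L2l1 R n).
Proof.
have /andP[p1 _] := hp; split.
  by case: n hn psi hpsi => // m _ psi hpsi; exact: not_amalgam_sub_besov.
move: p1; rewrite le_eqVlt => /predU1P[<-|p1]; first exact: not_besov_sub_amalgam1.
exact: not_besov_sub_amalgam_gt1.
Qed.
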